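(* Let $D$ be a (nonempty) diagram of an oriented link, with a marked point chosen on it away from the crossings, and let $\mathrm{Kh}(D)$ be the geometric complex associated to $D$ over $\mathbb{Z}$, an object of $\mathrm{Kom}_{/h}(\mathrm{Mat}(\mathcal{C}ob_{/l}))$. Then $\mathrm{Kh}(D)$ is equivalent to a complex built from the category of free $\mathbb{Z}[H]$-modules. That is, $\mathrm{Kh}(D)$ is isomorphic in $\mathrm{Kom}_{/h}(\mathrm{Mat}(\mathcal{C}ob_{/l}))$ to a complex all of whose chain objects are finite direct sums of degree-shifted copies of a single object, the special circle, and whose differentials are matrices with entries in the ring of $\mathbb{Z}$-linear combinations of connected cobordisms (tubes of arbitrary genus) from the special circle to itself, a ring isomorphic to the polynomial ring $\mathbb{Z}[H]$, where $H$ corresponds to the tube of genus $1$ (so $H$ is the special 1-handle operator, adding a handle to the component of the special circle).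
   Context: The category $\mathcal{C}ob_{/l}$ over a commutative ground ring $R$ (here $R=\mathbb{Z}$): objects are finite (possibly empty) disjoint unions of circles $\bigcirc^n$, $n\ge 0$ ($\bigcirc^0=\emptyset$). Morphisms from $\bigcirc^n$ to $\bigcirc^m$ are formal $R$-linear combinations of compact orientable 2-dimensional cobordisms from $\bigcirc^n$ to $\bigcirc^m$ (abstract surfaces, not necessarily connected, possibly with closed components; circles and cobordisms are oriented compatibly with gluing and cobordisms are taken up to homeomorphism fixing the boundary, so a cobordism is determined by the partition of its boundary circles into connected components, the genus of each component, and the genera of its closed components), modulo the following local relations. Composition is gluing, extended bilinearly. - 4TU: if $D_1,D_2,D_3,D_4$ are four disjoint disks in the interior of a (not necessarily connected) cobordism $C$ and $C_{ij}$ denotes the cobordism obtained from $C$ by removing $D_i$ and $D_j$ and gluing in a tube (annulus, compatible with orientations) with the same boundary, then $C_{12}+C_{34}=C_{13}+C_{24}$. - S: a cobordism with a connected component that is a sphere equals $0$. - T: a connected component that is a torus may be removed and replaced by the factor $2$. Grading: a cobordism $C$ has degree $\chi(C)$; objects may carry formal degree shifts $\{m\}$, and a cobordism $C:O_1\{m_1\}\to O_2\{m_2\}$ has degree $\chi(C)+m_2-m_1$. $\mathrm{Mat}(\mathcal{C}ob_{/l})$ is the additive closure: objects are finite columns (formal direct sums) of objects, morphisms are matrices of morphisms. $\mathrm{Kom}_{/h}(\mathrm{Mat}(\mathcal{C}ob_{/l}))$ is the category of bounded complexes over $\mathrm{Mat}(\mathcal{C}ob_{/l})$ with degree-$0$ differentials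 and degree-$0$ chain maps modulo homotopy. The geometric complex $\mathrm{Kh}(D)$ of an oriented link diagram $D$ with $n$ ordered crossings, $n_+$ positive and $n_-$ negative: for $\alpha\in\{0,1\}^n$ let $D_\alpha$ be the collection of circles obtained by replacing the $i$-th crossing by its $\alpha_i$-smoothing ($0$- or $1$-smoothing). The chain object in homological degree $r$ is $\bigoplus_{|\alpha|=r+n_-} D_\alpha\{r+n_+-n_-\}$, where $|\alpha|=\sum_i\alpha_i$. If $\alpha'$ is obtained from $\alpha$ by changing the $j$-th entry from $0$ to $1$, the corresponding entry of the differential is $(-1)^{\sum_{i<j}\alpha_i}$ times the saddle cobordism $D_\alpha\to D_{\alpha'}$ at the $j$-th crossing (identity cylinders elsewhere); all other entries are $0$. The marked point on $D$ determines in each $D_\alpha$ the special circle, namely the circle containing the marked point; in every saddle cobordism of the complex the special circles of source and target lie in the same connected component. *)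

(* Defs.v *)
From HB Require Import structures.
From mathcomp Require Import all_boot all_order all_algebra.
From mathcomp Require Import freeg.

Set Implicit Arguments.
Unset Strict Implicit.
Unset Printing Implicit Defensive.

Import Order.TTheory GRing.Theory Num.Theory.
Local Open Scope ring_scope.

Section Component.
Variables (V : finType) (e : rel V).

Definition component :=
  {A : {set V} | A \in [set [set y | connect e x y] | x in V]}.

Definition component_of (x : V) : component :=
  exist _ [set y | connect e x y] (imset_f (fun x => [set y | connect e x y]) isT).

Lemma component_inhabited (A : component) : exists x, x \in val A.
Proof.
by case: A => A /= /imsetP[x _ ->]; exists x; rewrite inE connect0.
Qed.

Definition component_repr (A : component) : V := xchoose (component_inhabited A).

End Component.

(* An object of the cobordism category is a finite set of circles.  A cobordism
from [S] to [T] is an orientable surface with boundary circles [S + T], given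
by the complete invariants of its homeomorphism type rel boundary: its
components, numbered by ['I_ncomp], the component on which each boundary circle
lies, and the genus of each component.  Components which are not in the image
of [bdry] are closed.  The numbering is forgotten by [homeo] below. *)

Record cob (S T : finType) := Cob {
  ncomp : nat;
  bdry : {ffun S + T -> 'I_ncomp};
  genus : {ffun 'I_ncomp -> nat}
}.
Arguments bdry {S T} C : rename.
Arguments genus {S T} C : rename.

Section CobChoice.
Variables S T : finType.

Let code := {k : nat & ({ffun S + T -> 'I_k} * {ffun 'I_k -> nat})%type}.

Let encode (C : cob S T) : code :=
  Tagged (fun k => ({ffun S + T -> 'I_k} * {ffun 'I_k -> nat})%type)
         (bdry C, genus C).

Let decode (c : code) : cob S T := Cob (tagged c).1 (tagged c).2.

Let encodeK : cancel encode decode. Proof. by case. Qed.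

HB.instance Definition _ := Choice.copy (cob S T) (can_type encodeK).

End CobChoice.

Definition cob_of (S T K : finType) (b : S + T -> K) (g : K -> nat) : cob S T :=
  Cob [ffun x => enum_rank (b x)] [ffun i : 'I_#|K| => g (enum_val i)].

Definition homeo (S T : finType) (C C' : cob S T) : Prop :=
  exists2 s : 'I_(ncomp C) -> 'I_(ncomp C'), bijective s &
    (forall x, bdry C' x = s (bdry C x)) /\
    (forall i, genus C' (s i) = genus C i).

(* The surface obtained from connected pieces [K] of genera [g] by gluing, for
   each [e : E], a boundary circle of the piece [src e] to one of the piece
   [tgt e]; [b] locates the remaining boundary circles.  The glued component
   consisting of the pieces in [A] has the genera of these pieces, plus the
   first Betti number (edges + 1 - vertices) of its connected gluing graph. *)
Section Glue.
Variables (S T K E : finType).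
Variables (b : S + T -> K) (g : K -> nat) (src tgt : E -> K).

Definition glue_rel : rel K := [rel x y | [exists e,
  ((x, y) == (src e, tgt e)) || ((x, y) == (tgt e, src e))]].

Definition glue : cob S T :=
  cob_of (fun x => component_of glue_rel (b x))
         (fun A : component glue_rel =>
            (\sum_(k in val A) g k + (#|[set e | src e \in val A]| + 1 - #|val A|))%N).

End Glue.

Definition cob_id (S : finType) : cob S S :=
  cob_of (fun x : S + S => match x with inl s => s | inr s => s end)
         (fun=> 0%N).

(* [cob_comp C C'] is [C] followed by [C']. *)
Definition cob_comp (S T U : finType) (C : cob S T) (C' : cob T U) : cob S U :=
  glue (K := ('I_(ncomp C) + 'I_(ncomp C'))%type)
    (fun x : S + U => match x with
       | inl s => inl (bdry C (inl s))
       | inr u => inr (bdry C' (inr u)) end)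
    (fun k => match k with inl i => genus C i | inr i => genus C' i end)
    (fun t : T => inl (bdry C (inr t)))
    (fun t : T => inr (bdry C' (inl t))).

(* Remove a disk from the component [i] and one from the component [j]
   (possibly [i = j]), and glue in a tube. *)
Definition add_tube (S T : finType) (C : cob S T) (i j : 'I_(ncomp C)) :
    cob S T :=
  glue (bdry C) (genus C) (fun _ : unit => i) (fun _ : unit => j).

(* Disjoint union with a closed connected surface of genus [g]. *)
Definition add_closed (S T : finType) (g : nat) (C : cob S T) : cob S T :=
  cob_of (fun x => Some (bdry C x)) (fun k => oapp (genus C) g k).

Definition euler_char (S T : finType) (C : cob S T) : int :=
  \sum_(i < ncomp C) (2 - (2 * genus C i)%:Z) - (#|S| + #|T|)%:Z.

Definition lin (S T : finType) := {freeg (cob S T) / int}.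

(* The subgroup of relations.  [null_4TU] places the four disks [D_1 .. D_4] in
   the components [c1 .. c4], which need not be distinct: up to homeomorphism
   the position of a disk inside a component is irrelevant. *)
Inductive null (S T : finType) : lin S T -> Prop :=
| null_0 : null 0
| null_B f g : null f -> null g -> null (f - g)
| null_homeo C C' : homeo C C' -> null (<< C >> - << C' >>)
| null_4TU (C : cob S T) (c1 c2 c3 c4 : 'I_(ncomp C)) :
    null (<< add_tube c1 c2 >> + << add_tube c3 c4 >>
          - (<< add_tube c1 c3 >> + << add_tube c2 c4 >>))
| null_S (C : cob S T) : null << add_closed 0 C >>
| null_T (C : cob S T) : null (<< add_closed 1 C >> - << 2 *g C >>).

(* Equality of morphisms; [lin] itself consists of representatives. *)
Definition lin_eq (S T : finType) (f g : lin S T) : Prop := null (f - g).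

Definition lin_comp (S T U : finType) (f : lin S T) (g : lin T U) : lin S U :=
  fglift (fun C => fglift (fun C' => << cob_comp C C' >> : lin S U) g) f.

(* The formal direct sum over [i : idx] of [circles i] with degree shift
   [shift i]. *)
Record matobj := MatObj {
  idx : finType;
  circles : idx -> finType;
  shift : idx -> int
}.
Arguments circles {m} i.
Arguments shift {m} i.

Definition mor (A B : matobj) : Type :=
  forall (i : idx A) (j : idx B), lin (circles i) (circles j).

Definition mor_eq (A B : matobj) (f g : mor A B) : Prop :=
  forall i j, lin_eq (f i j) (g i j).

Definition mor_add (A B : matobj) (f g : mor A B) : mor A B :=
  fun i j => f i j + g i j.

Definition mor_sub (A B : matobj) (f g : mor A B) : mor A B :=
  fun i j => f i j - g i j.

(* [mor_comp f g] is [f] followed by [g]. *)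
Definition mor_comp (A B C : matobj) (f : mor A B) (g : mor B C) : mor A C :=
  fun i k => \sum_(j : idx B) lin_comp (f i j) (g j k).

Definition mor_id (A : matobj) : mor A A := fun i j =>
  match i =P j with
  | ReflectT eq_ij =>
      ecast j (lin (circles i) (circles j)) eq_ij << cob_id (circles i) >>
  | ReflectF _ => 0
  end.
Arguments mor_id A : clear implicits.

(* Since morphisms are classes modulo [lin_eq], being of degree 0 means having
   a representative which is a combination of cobordisms of degree 0. *)
Definition mor_deg0 (A B : matobj) (f : mor A B) : Prop :=
  forall i j, exists2 f' : lin (circles i) (circles j), lin_eq (f i j) f' &
    forall C, C \in dom f' -> euler_char C + shift j - shift i = 0.

Record precomplex := PreComplex {
  obj : int -> matobj;
  diff : forall r, mor (obj r) (obj (r + 1))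
}.
Arguments diff p r : clear implicits.

Definition is_complex (A : precomplex) : Prop :=
  [/\ exists N : int, forall r, N < `|r| -> #|idx (obj A r)| = 0%N,
      forall r, mor_deg0 (diff A r) &
      forall r, mor_eq (mor_comp (diff A r) (diff A (r + 1))) (fun _ _ => 0)].

Definition family (A B : precomplex) : Type :=
  forall r, mor (obj A r) (obj B r).

Definition chain_map (A B : precomplex) (f : family A B) : Prop :=
  (forall r, mor_deg0 (f r)) /\
  (forall r, mor_eq (mor_comp (f r) (diff B r))
                    (mor_comp (diff A r) (f (r + 1)))).

(* The homotopy is indexed by its target degree, so that the formula
   [f - g = h d + d h] is written in degree [r + 1], [r] being arbitrary. *)
Definition homotopic (A B : precomplex) (f g : family A B) : Prop :=
  exists h : forall r, mor (obj A (r + 1)) (obj B r),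
    (forall r, mor_deg0 (h r)) /\
    (forall r, mor_eq (mor_sub (f (r + 1)) (g (r + 1)))
                      (mor_add (mor_comp (h r) (diff B r))
                               (mor_comp (diff A (r + 1)) (h (r + 1))))).

(* [A] and [B] are objects of the homotopy category, isomorphic in it. *)
Definition kom_iso (A B : precomplex) : Prop :=
  [/\ is_complex A, is_complex B &
      exists (f : family A B) (g : family B A),
        [/\ chain_map f, chain_map g,
            homotopic (fun r => mor_comp (f r) (g r)) (fun r => mor_id _) &
            homotopic (fun r => mor_comp (g r) (f r)) (fun r => mor_id _)]].

(* A diagram is encoded by its underlying planar map.  The half-edges at a crossing
[c] are the [(c, k)], numbered counterclockwise starting from the incoming end of
the lower strand: the lower strand runs from 0 to 2, the upper one from 3 to 1 at
a positive crossing and from 1 to 3 at a negative one.  [arc] pairs the two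
half-edges of each arc.  Components of the diagram without crossings are not seen
by the half-edges and are counted by [nloop]; their orientation plays no role. *)

Definition half_edge (n : nat) := ('I_n * 'I_4)%type.

Definition incoming (n : nat) (pos : 'I_n -> bool) (h : half_edge n) : bool :=
  if odd h.2 then pos h.1 == (h.2 == 3%N :> nat) else (h.2 == 0%N :> nat).

Definition rotate (n : nat) (h : half_edge n) : half_edge n := (h.1, h.2 + 1).

(* Euler's formula V - E + F = 2 K, where E = 2 V, the faces are the orbits of
   [rotate \o arc] and K is the number of connected components of the map.  As
   V - E + F <= 2 for each component, this says that each of them has genus 0. *)
Definition planar (n : nat) (arc : half_edge n -> half_edge n) : Prop :=
  (fcard (@rotate n \o arc) {: half_edge n} =
   n + 2 * n_comp [rel x y | (y == arc x) || (y == rotate x)] {: half_edge n})%N.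

Record link_diagram := LinkDiagram {
  ncross : nat;
  nloop : nat;
  positive : 'I_ncross -> bool;
  arc : half_edge ncross -> half_edge ncross;
  arcK : involutive arc;
  arc_oriented : forall h, incoming positive (arc h) = ~~ incoming positive h;
  arc_planar : planar arc
}.
Arguments positive : clear implicits.
Arguments arc : clear implicits.

Section Khovanov.
Variable D : link_diagram.
Local Notation n := (ncross D).

(* Positions on the diagram away from the crossings: a half-edge stands for a
   point of the arc to which it belongs, the other points are on the
   crossingless components. *)
Definition point : finType := (half_edge n + 'I_(nloop D))%type.

Definition npos : nat := #|[set i | positive D i]|.
Definition nneg : nat := #|[set i | ~~ positive D i]|.

Definition state : finType := {ffun 'I_n -> bool}.
Definition weight (a : state) : nat := (\sum_i a i)%N.

(* At each crossing the 0-smoothing joins 0 to 1 and 2 to 3, and the 1-smoothing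
   joins 0 to 3 and 1 to 2; so the 0-smoothing is the oriented one precisely at
   the positive crossings. *)
Definition smooth (a : state) (h : half_edge n) : half_edge n :=
  (h.1, if odd h.2 (+) a h.1 then h.2 - 1 else h.2 + 1).

Definition smooth_rel (a : state) : rel point := fun x y =>
  match x, y with
  | inl h, inl h' => (h' == arc D h) || (h' == smooth a h)
  | _, _ => false
  end.

(* The circles of [D_a], each given as its set of points. *)
Definition circle (a : state) : finType := component (smooth_rel a).

(* When [a'] changes the entry [j] of [a], both smoothings lie on the saddle
   surface, whose components are the classes of points connected through either
   of them: the component of the crossing [j] is a pair of pants and the other
   ones are cylinders, hence they all have genus 0. *)
Definition saddle_rel (a a' : state) : rel point :=
  [rel x y | smooth_rel a x y || smooth_rel a' x y].

Definition saddle (a a' : state) : cob (circle a) (circle a') :=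
  cob_of (fun x : circle a + circle a' => component_of (saddle_rel a a')
            match x with inl A => component_repr A | inr A => component_repr A end)
         (fun=> 0%N).

Definition flips (j : 'I_n) (a a' : state) : bool :=
  ~~ a j && (a' == [ffun i => if i == j then true else a i]).

Definition Kh_obj (r : int) : matobj :=
  MatObj (idx := {a : state | (weight a)%:Z == r + nneg%:Z})
         (fun a => circle (val a)) (fun=> r + npos%:Z - nneg%:Z).

(* The sum has at most one term. *)
Definition Kh_diff (r : int) : mor (Kh_obj r) (Kh_obj (r + 1)) := fun a a' =>
  \sum_(j | flips j (val a) (val a'))
     << (-1) ^+ (\sum_(i < n | (i < j)%N) val a i)%N *g saddle (val a) (val a') >>.

Definition Kh : precomplex := PreComplex Kh_diff.

End Khovanov.

(* The special circles of the various [D_a], i.e. those containing the marked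
   point, are all the same object of the category. *)
Definition special_circle : finType := unit.

Definition special_sum (I : finType) (s : I -> int) : matobj :=
  MatObj (fun=> special_circle) s.

Definition tube (g : nat) : cob special_circle special_circle :=
  @Cob _ _ 1 [ffun=> ord0] [ffun=> g].

Definition connected (S T : finType) (C : cob S T) : bool := ncomp C == 1%N.

Definition connected_lin (f : lin special_circle special_circle) : Prop :=
  exists2 f' : lin special_circle special_circle,
    lin_eq f f' & forall C, C \in dom f' -> connected C.

(* [phi] is an isomorphism from the ring Z[H] onto the subring [connected_lin]
   of the endomorphism ring of the special circle, mapping H to [tube 1]. *)
Definition tube_ring_iso
    (phi : {poly int} -> lin special_circle special_circle) : Prop :=
  [/\ forall p q, lin_eq (phi (p + q)) (phi p + phi q),
      forall p q, lin_eq (phi (p * q)) (lin_comp (phi p) (phi q)) &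
      lin_eq (phi 1) << cob_id special_circle >>] /\
  [/\ lin_eq (phi 'X) << tube 1 >>,
      forall p q, lin_eq (phi p) (phi q) -> p = q,
      forall p, connected_lin (phi p) &
      forall f, connected_lin f -> exists p, lin_eq f (phi p)].

(* Main.v *)
Require Import Defs.
From HB Require Import structures.
From mathcomp Require Import all_boot all_order all_algebra.
From mathcomp Require Import all_fingroup.
From mathcomp Require Import freeg zify ring.

Set Implicit Arguments.
Unset Strict Implicit.
Unset Printing Implicit Defensive.

Import Order.TTheory GRing.Theory Num.Theory.
Local Open Scope ring_scope.

(* Specialise Bar-Natan's theory to the Frobenius algebra Z[H][X]/(X^2 - H X) and
H to a transcendental element h of a field.  There the algebra is diagonal, so a
cobordism is evaluated by a state sum over the colourings of its components by
two idempotents.  By 4TU all the tubes of a cobordism can be made to start at the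
component of the special circle; hence a cobordism joining the special circles is
a combination of normal forms, in which every other boundary circle either lies
on the special component or bounds a disk.  The state sums of normal forms are
linearly independent, so any identity between combinations of cobordisms joining
the special circles can be checked on state sums, that is, on matrices over the
field.  Delooping then identifies each D_a with a sum of shifted special circles,
a dot being a tube to the special component, and this isomorphism transports the
differential of Kh(D).

Planarity is needed for the squares of the cube to commute and for the saddles to
have Euler characteristic -1.  The underlying map of a planar diagram has a
checkerboard colouring: otherwise its parity double cover would be connected over
some component, which violates Euler's inequality as the cover has twice as many
vertices, edges and faces.  The circles of a smoothing are then the cycles of a
permutation of the half-edges of one colour, and changing the smoothing at a
crossing multiplies this permutation by a transposition, which merges or splits
cycles. *)

(** * Surfaces glued from pieces *)

(** The idempotents are X/h and 1 - X/h, and the handle operator 2X - h takes the opposite values h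
    and -h on them. Hence the sphere has value 1/h - 1/h = 0 and the torus 1 + 1 = 2. The obstacle
    is [lin_eq], membership in a subgroup given only by generators: an identity between composites
    cannot be tested directly on cobordisms. It can once there is a distinguished component that
    absorbs handles and tubes, because normal forms are then indexed by a set of circles and a
    genus. Their independence over the integers makes the evaluation faithful, so that inverting h
    in the field loses nothing. The evaluation is restricted to the colour [true] of the special
    component. There a handle is multiplication by h, so the genus is read off as an exponent of h,
    while each other circle contributes one of two independent vectors indexed by its colour,
    according to whether it lies on the special component or bounds a disk. This restriction is
    multiplicative because both special circles lie on one component and so have the same colour. *)

Lemma count_lt (A : eqType) (P Q : pred A) (s : seq A) (x : A) :
  subpred P Q -> x \in s -> Q x -> ~~ P x -> (count P s < count Q s)%N.
Proof.
move=> sPQ; elim: s => //= y s IH; rewrite inE => /orP[/eqP <-|xs] Qx nPx.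
  by rewrite Qx (negbTE nPx) ltnS; apply: sub_count.
by rewrite -addnS; apply: leq_add (IH xs Qx nPx); case Py: (P y); rewrite ?(sPQ _ Py).
Qed.

Section ComponentTheory.
Variables (V : finType) (e : rel V).
Hypothesis sym_e : connect_sym e.

Lemma component_of_eq x y : (component_of e x == component_of e y) = connect e x y.
Proof.
apply/eqP/idP => [/(congr1 val)/setP/(_ y)|xy].
  by rewrite !inE connect0.
by apply/val_inj/setP => z; rewrite !inE (same_connect sym_e xy).
Qed.

Lemma mem_component (A : component e) x : (x \in val A) = (component_of e x == A).
Proof.
case: A => A HA /=; have /imsetP[y _ defA] := HA.
have -> : exist _ A HA = component_of e y by apply: val_inj.
by rewrite component_of_eq sym_e defA inE.
Qed.

Lemma component_reprK (A : component e) : component_of e (component_repr A) = A.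
Proof. by apply/eqP; rewrite -mem_component; apply: xchooseP. Qed.

Lemma component_repr_connect x : connect e x (component_repr (component_of e x)).
Proof. by rewrite -component_of_eq component_reprK. Qed.

End ComponentTheory.

Definition edge_rel (K : eqType) (E : seq (K * K)) : rel K :=
  [rel x y | ((x, y) \in E) || ((y, x) \in E)].

Lemma edge_rel_sym (K : eqType) (E : seq (K * K)) : symmetric (edge_rel E).
Proof. by move=> x y; rewrite /edge_rel /= orbC. Qed.

Lemma connect_edge_sym (K : finType) (E : seq (K * K)) : connect_sym (edge_rel E).
Proof. exact/sym_connect_sym/edge_rel_sym. Qed.

Lemma connect_mem (K : finType) (E : seq (K * K)) x y :
  (x, y) \in E -> connect (edge_rel E) x y.
Proof. by move=> xyE; apply: connect1; rewrite /edge_rel /= xyE. Qed.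

(* A maximal set of vertices that spans enough edges is the whole component,
since otherwise it could absorb the far end of an edge leaving it. *)
Lemma betti_number_ge0 (K : finType) (E : seq (K * K)) (x0 : K)
    (A := [set y | connect (edge_rel E) x0 y]) :
  (#|A| <= (count (fun e => e.1 \in A) E).+1)%N.
Proof.
pose inside (B : {set K}) (e : K * K) := (e.1 \in B) && (e.2 \in B).
pose P (B : {set K}) := [&& B \subset A, x0 \in B & (#|B| <= (count (inside B) E).+1)%N].
have P0 : P [set x0].
  by rewrite /P sub1set !inE connect0 eqxx cards1.
case: (arg_maxnP (fun B : {set K} => #|B|) P0) => B /and3P[sBA Bx0 leB] maxB.
suff sAB : A \subset B.
  apply: leq_trans (subset_leq_card sAB) _; apply: leq_trans leB _; rewrite ltnS.
  by apply: sub_count => e /andP[/(subsetP sBA)].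
have clB x y : edge_rel E x y -> x \in B -> y \in B.
  move=> xy Bx; apply/negPn/negP => nBy.
  have [e [eE e1 e2]] : exists e, [/\ e \in E, inside (y |: B) e & ~~ inside B e].
    case/orP: xy => xyE; [exists (x, y)|exists (y, x)]; split => //;
      by rewrite /inside /= ?in_setU1 ?eqxx ?Bx ?orbT //= (negbTE nBy) ?andbF.
  have /maxB : P (y |: B).
    apply/and3P; split; last 2 first.
    - by rewrite in_setU Bx0 orbT.
    - rewrite cardsU1 nBy add1n ltnS; apply: leq_trans leB _.
      apply: count_lt eE e1 e2 => f /andP[f1 f2].
      by rewrite /inside !inE f1 f2 !orbT.
    rewrite subUset sBA andbT sub1set inE.
    have := subsetP sBA x Bx; rewrite inE => /connect_trans -> //; exact: connect1.
  by rewrite /= cardsU1 nBy add1n ltnn.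
have cl : closed (edge_rel E) (mem B) by apply: (intro_closed (@connect_edge_sym _ E)) => x y /clB.
by apply/subsetP => y; rewrite inE => /(closed_connect cl) <-.
Qed.

(* [C] is, up to homeomorphism, the surface obtained from connected pieces [K]
of genera [g] with boundary placed by [b] by inserting a tube for each element
of [E]; [f] is the quotient map from the pieces to the components of [C]. *)
Definition glued (S T K : finType) (b : S + T -> K) (g : K -> nat)
    (E : seq (K * K)) (C : cob S T) (f : K -> 'I_(ncomp C)) : Prop :=
  [/\ forall i, exists k, f k == i,
      forall x y, (f x == f y) = connect (edge_rel E) x y,
      forall v, bdry C v = f (b v) &
      forall i, (genus C i)%:Z - 1 =
        \sum_(k | f k == i) ((g k)%:Z - 1) + (count (fun e => f e.1 == i) E)%:Z].

Section GluedTheory.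
Variables (S T K : finType) (b : S + T -> K) (g : K -> nat).

(** The genus in [glue] uses truncated subtraction. By [betti_number_ge0] nothing is truncated, so
    genus minus 1 is an exact sum over pieces and tubes. *)
Lemma glue_glued (L : finType) (src tgt : L -> K) :
  glued b g [seq (src l, tgt l) | l <- enum L] (C := glue b g src tgt)
    (fun k => enum_rank (component_of (glue_rel src tgt) k)).
Proof.
set E := map _ _.
have eqr : glue_rel src tgt =2 edge_rel E.
  move=> x y /=; apply/existsP/orP => [[l /orP[] /eqP[-> ->]]|].
  - by left; apply/mapP; exists l; rewrite ?mem_enum.
  - by right; apply/mapP; exists l; rewrite ?mem_enum.
  by case=> /mapP[l _ [-> ->]]; exists l; rewrite eqxx ?orbT.
have symr : connect_sym (glue_rel src tgt).
  by move=> x y; rewrite !(eq_connect eqr) connect_edge_sym.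
split=> [i|x y|v|i].
- exists (component_repr (enum_val i)).
  by rewrite component_reprK // enum_valK eqxx.
- by rewrite (inj_eq enum_rank_inj) component_of_eq // (eq_connect eqr).
- by rewrite ffunE.
rewrite ffunE; set A := enum_val i.
have mA k : (enum_rank (component_of (glue_rel src tgt) k) == i) = (k \in val A).
  by rewrite (can2_eq enum_rankK enum_valK) mem_component.
rewrite (eq_bigl _ _ mA) sumrB sumr_const.
rewrite (eq_count (a2 := fun e => e.1 \in val A)) => [|e]; last exact: mA.
have cE : count (fun e => e.1 \in val A) E = #|[set e | src e \in val A]|.
  rewrite count_map -sum1_count -sum1_card big_enum_cond.
  by apply: eq_bigl => l; rewrite inE.
have /= := @betti_number_ge0 _ E (component_repr A).
have -> : [set y | connect (edge_rel E) (component_repr A) y] = val A.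
  apply/setP => y; rewrite inE mem_component // -[in RHS](component_reprK symr A).
  by rewrite component_of_eq // symr (eq_connect eqr).
rewrite cE.
have -> : (\sum_(k in val A) (g k)%:Z) = (\sum_(k in val A) g k)%N%:Z.
  by rewrite (big_morph Posz PoszD erefl).
have -> : (1 *+ #|val A| : int) = #|val A|%:Z by rewrite natz.
move: #|[set e | src e \in val A]| (#|val A|) (\sum_(k in val A) g k)%N => a c s.
lia.
Qed.

(** The two quotient maps have the same fibres, which identifies the components; the genera then
    agree because both are given by the same sum over a fibre. *)
Lemma glued_homeo E (C C' : cob S T) f f' :
  glued b g E (C := C) f -> glued b g E (C := C') f' -> homeo C C'.
Proof.
case=> surj ker bd gen [surj' ker' bd' gen'].
pose r i := xchoose (surj i); pose r' i := xchoose (surj' i).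
have rK i : f (r i) = i by apply/eqP/(xchooseP (surj i)).
have rK' i : f' (r' i) = i by apply/eqP/(xchooseP (surj' i)).
have ff' x y : (f x == f y) = (f' x == f' y) by rewrite ker ker'.
have sf x : f' (r (f x)) = f' x by apply/eqP; rewrite -ff' rK.
have sf' x : f (r' (f' x)) = f x by apply/eqP; rewrite ff' rK'.
exists (fun i => f' (r i)).
  by exists (fun i => f (r' i)) => i; rewrite ?sf ?sf' ?rK ?rK'.
split=> [v|i]; first by rewrite bd bd' sf.
apply/eqP; rewrite -eqz_nat; apply/eqP; apply: (addIr (- 1)); rewrite gen gen'.
have e x : (f' x == f' (r i)) = (f x == i) by rewrite -ff' rK.
by under eq_bigl do rewrite e; under eq_count do rewrite e.
Qed.

Lemma glued_perm E E' (C : cob S T) f :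
  perm_eq E E' -> glued b g E (C := C) f -> glued b g E' (C := C) f.
Proof.
move=> EE' [surj ker bd gen]; split=> // [x y|i].
  rewrite ker; apply: eq_connect => u v.
  by rewrite /edge_rel /= !(perm_mem EE').
by rewrite gen (seq.permP EE').
Qed.

End GluedTheory.

Lemma connect_const (V : finType) (U : Type) (e : rel V) (phi : V -> U) x y :
  (forall u v, e u v -> phi u = phi v) -> connect e x y -> phi x = phi y.
Proof.
move=> ephi /connectP[p xp ->]; elim: p x xp => //= z p IH x /andP[xz pz].
by rewrite (ephi _ _ xz) IH.
Qed.

Lemma sum_count_fiber (I J : finType) (L : Type) (q : I -> J) (h : L -> I) (E : seq L) (j : J) :
  \sum_(i | q i == j) (count (fun e => h e == i) E)%:Z =
  (count (fun e => q (h e) == j) E)%:Z.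
Proof.
elim: E => [|e E IH] /=; first by rewrite big1.
under eq_bigr do rewrite PoszD; rewrite big_split /= IH PoszD; congr (_ + _).
case: eqP => qe.
  rewrite (bigD1 (h e)) /= ?qe ?eqxx // big1 ?addr0 // => i /andP[_ /negbTE].
  by rewrite eq_sym => ->.
by rewrite big1 // => i /eqP qi; case: eqP => // hi; case: qe; rewrite hi.
Qed.

Section GluedComposition.
Variables (S T K : finType) (b : S + T -> K) (g : K -> nat).

(** Genus minus 1 is additive over pieces and tubes, so inserting the tubes in two stages gives the
    same surface as inserting them at once. *)
Lemma glued_trans (E1 E : seq (K * K)) (C : cob S T) f (C' : cob S T) q :
  glued b g E (C := C) f ->
  glued (bdry C) (genus C) [seq (f e.1, f e.2) | e <- E1] (C := C') q ->
  glued b g (E1 ++ E) (C := C') (q \o f).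
Proof.
move=> [surj ker bd gen] [surj' ker' bd' gen'].
pose r i := xchoose (surj i).
have rK i : f (r i) = i by apply/eqP/(xchooseP (surj i)).
split=> [i|x y|v|i] /=.
- have [k /eqP <-] := surj' i; have [l /eqP <-] := surj k.
  by exists l.
- apply/idP/idP => [|xy].
    rewrite ker'; pose psi u := component_of (edge_rel (E1 ++ E)) (r u).
    have symE := @connect_edge_sym _ (E1 ++ E).
    have psif z : psi (f z) = component_of (edge_rel (E1 ++ E)) z.
      apply/eqP; rewrite component_of_eq //.
      have : connect (edge_rel E) (r (f z)) z by rewrite -ker rK.
      apply: connect_sub => u v; rewrite /edge_rel /= => uv; apply: connect1.
      by rewrite /= !mem_cat orbACA uv orbT.
    have cst u v : edge_rel [seq (f e.1, f e.2) | e <- E1] u v -> psi u = psi v.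
      case/orP => /mapP[[k l] /= klE [-> ->]]; rewrite !psif; apply/eqP;
        rewrite component_of_eq //; [|rewrite symE]; apply: connect_mem;
        by rewrite mem_cat klE.
    by move/(connect_const cst)/eqP; rewrite !psif component_of_eq.
  apply/eqP; apply: (connect_const (phi := q \o f) _ xy) => u v /=.
  have E2 u' v' : (u', v') \in E1 ++ E -> q (f u') = q (f v').
    rewrite mem_cat => /orP[uvE|uvE]; apply/eqP; last first.
      by have := connect_mem uvE; rewrite -ker => /eqP ->.
    by rewrite ker'; apply: connect_mem; apply: (map_f (fun e => (f e.1, f e.2)) uvE).
  by case/orP => /E2.
- by rewrite bd' bd.
rewrite gen' (eq_bigr _ (fun k _ => gen k)) big_split /= sum_count_fiber.
rewrite count_map count_cat PoszD -addrA [_%:Z + _%:Z]addrC; congr (_ + _).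
rewrite [RHS](partition_big f (fun k => q k == i)) //=.
apply: eq_bigr => k /eqP qk; apply: eq_bigl => l /=.
by case: eqP => [->|]; rewrite ?qk ?eqxx ?andbF.
Qed.

Lemma glued_exists (E : seq (K * K)) : exists C f, glued b g E (C := C) f.
Proof.
have := @glue_glued S T K b g _ (fun l => (tnth (in_tuple E) l).1)
  (fun l => (tnth (in_tuple E) l).2).
have -> : [seq ((tnth (in_tuple E) l).1, (tnth (in_tuple E) l).2) |
            l <- enum 'I_(size E)] = E.
  rewrite (eq_map (g := tnth (in_tuple E))) => [|l]; last by rewrite -surjective_pairing.
  by rewrite map_tnth_enum.
by eexists; eexists; eassumption.
Qed.

Lemma add_tube_glued E (C : cob S T) f i j : glued b g E (C := C) f ->
  exists f', glued b g ((i, j) :: E) (C := add_tube (f i) (f j)) f'.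
Proof.
move=> gC; eexists; apply: (glued_trans (E1 := [:: (i, j)]) gC) => /=.
have := @glue_glued _ _ _ (bdry C) (genus C) unit (fun=> f i) (fun=> f j).
by rewrite enumT unlock; apply.
Qed.

(** Up to the number of boundary circles, the Euler characteristic is -2 times the sum of genus
    minus 1; thus every tube lowers it by 2, wherever it is attached. *)
Lemma euler_char_glued E (C : cob S T) f : glued b g E (C := C) f ->
  euler_char C =
  \sum_k (2 - 2 * (g k)%:Z) - (2 * size E)%:Z - (#|S| + #|T|)%:Z.
Proof.
case=> _ _ _ gen; rewrite /euler_char; congr (_ - _).
rewrite (eq_bigr (fun i => - 2 * ((genus C i)%:Z - 1))) => [|i _]; last by rewrite PoszM; ring.
rewrite -mulr_sumr (eq_bigr _ (fun i _ => gen i)) big_split /= mulrDr.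
have -> : \sum_i (count (fun e => f e.1 == i) E)%:Z = (size E)%:Z.
  rewrite -(eq_bigl _ _ (fun i => eqxx tt)).
  rewrite (sum_count_fiber (fun=> tt) (fun e => f e.1) E tt).
  by rewrite -[size E]count_predT.
have <- : \sum_k ((g k)%:Z - 1) = \sum_i \sum_(k | f k == i) ((g k)%:Z - 1).
  by rewrite (partition_big f predT).
rewrite PoszM [-2 * (size E)%:Z]mulNr mulr_sumr; congr (_ - _).
by apply: eq_bigr => k _; ring.
Qed.

End GluedComposition.

Lemma homeo_euler_char (S T : finType) (C C' : cob S T) :
  homeo C C' -> euler_char C = euler_char C'.
Proof.
case=> s bs [_ gs]; rewrite /euler_char; congr (_ - _).
rewrite [RHS](reindex s) /=; last exact: onW_bij.
by apply: eq_bigr => i _; rewrite gs.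
Qed.

(** * Cutting a surface into spheres and tubes *)

Section Spheres.
Variables (S T : finType) (C : cob S T).
Local Notation K := ((S + T) + 'I_(ncomp C))%type.

(** One sphere is cut off around each boundary circle, and each handle becomes a loop at the sphere
    of its component. All topology is then carried by tubes, to which 4TU applies. *)
Definition sphere_edges : seq (K * K) :=
  [seq (inl v, inr (bdry C v)) | v <- enum {: S + T}] ++
  flatten [seq nseq (genus C i) (inr i, inr i) | i <- enum 'I_(ncomp C)].

Definition sphere_map (k : K) : 'I_(ncomp C) :=
  match k with inl v => bdry C v | inr i => i end.

Lemma spheres_glued : glued inl (fun=> 0%N) sphere_edges sphere_map.
Proof.
have symE := @connect_edge_sym _ sphere_edges.
have toC k : connect (edge_rel sphere_edges) k (inr (sphere_map k)).
  case: k => [v|i] //=; apply: connect_mem.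
  rewrite mem_cat; apply/orP; left; apply/mapP; exists v => //.
  by rewrite mem_enum.
split=> [i|x y|v|i] //.
- by exists (inr i) => /=.
- apply/eqP/idP => [xy|].
    by apply: connect_trans (toC x) _; rewrite symE xy.
  apply: connect_const => u v /orP[]; rewrite mem_cat.
    by case/orP => [/mapP[w _ [-> ->]]//|/flattenP[_ /mapP[j _ ->] /nseqP[[-> ->]]]].
  by case/orP => [/mapP[w _ [-> ->]]//|/flattenP[_ /mapP[j _ ->] /nseqP[[-> ->]]]].
rewrite count_cat count_map count_flatten -map_comp /=.
rewrite big_sumType /= big_pred1_eq.
rewrite (eq_bigr (fun=> -1)) // sumr_const.
rewrite -sum1_count big_enum_cond /= sum1_card.
rewrite sumnE big_map big_enum /= (bigD1 i) //= count_nseq /= eqxx mul1n.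
rewrite big1 ?addn0 => [|j /negbTE ji]; last by rewrite count_nseq /= ji.
rewrite (eq_card (B := fun v => bdry C v == i)) // PoszD mulNrn.
by rewrite natz; ring.
Qed.

End Spheres.

(** * Reduction to normal forms *)

Section Null.
Variables S T : finType.
Implicit Types f g : lin S T.

Lemma null_opp f : null f -> null (- f).
Proof. by move=> nf; rewrite -sub0r; apply: null_B nf; apply: null_0. Qed.

Lemma null_add f g : null f -> null g -> null (f + g).
Proof. by move=> nf /null_opp ng; rewrite -[g]opprK; apply: null_B. Qed.

Lemma lin_eq_refl f : lin_eq f f.
Proof. by rewrite /lin_eq subrr; apply: null_0. Qed.

Lemma lin_eq_trans g f k : lin_eq f g -> lin_eq g k -> lin_eq f k.
Proof. by move=> fg /(null_add fg); rewrite addrA subrK. Qed.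

Lemma lin_eq_add f f' g g' : lin_eq f f' -> lin_eq g g' -> lin_eq (f + g) (f' + g').
Proof. by move=> ff gg; rewrite /lin_eq opprD addrACA; apply: null_add. Qed.

Lemma lin_eq_sub f f' g g' : lin_eq f f' -> lin_eq g g' -> lin_eq (f - g) (f' - g').
Proof.
move=> ff gg; apply: lin_eq_add ff _.
by rewrite /lin_eq -opprD; apply: null_opp.
Qed.

Lemma lin_eq_homeo (C C' : cob S T) : homeo C C' -> lin_eq << C >> << C' >>.
Proof. exact: null_homeo. Qed.

End Null.

Definition supported (S T : finType) (P : cob S T -> Prop) (f : lin S T) : Prop :=
  forall C, C \in dom f -> P C.

Section Supported.
Variables (S T : finType) (P : cob S T -> Prop).
Implicit Types f g : lin S T.

Lemma supported0 : supported P 0.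
Proof. by move=> C; rewrite dom0. Qed.

Lemma supportedU c C : P C -> supported P << c *g C >>.
Proof.
move=> PC C'; have [->|c0] := eqVneq c 0; first by rewrite freegU0 dom0.
by rewrite domU // inE => /eqP ->.
Qed.

Lemma supportedD f g : supported P f -> supported P g -> supported P (f + g).
Proof. by move=> Pf Pg C /domD_subset; rewrite mem_cat => /orP[/Pf|/Pg]. Qed.

Lemma supportedB f g : supported P f -> supported P g -> supported P (f - g).
Proof. by move=> Pf Pg C /domB; rewrite mem_cat => /orP[/Pf|/Pg]. Qed.

Lemma supported_sum (I : Type) (r : seq I) (Q : pred I) (F : I -> lin S T) :
  (forall i, Q i -> supported P (F i)) -> supported P (\sum_(i <- r | Q i) F i).
Proof. by move=> PF; elim/big_ind: _ => //; [exact: supported0|exact: supportedD]. Qed.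

Lemma supportedZ c f : supported P f -> supported P (c *: f).
Proof. by move=> Pf C /domZ_subset /Pf. Qed.

Lemma supported_ind (R : lin S T -> Prop) :
  R 0 -> (forall c C f, P C -> R f -> R (<< c *g C >> + f)) ->
  forall f, supported P f -> R f.
Proof.
move=> R0 RS f; rewrite -{2}[f]freeg_sumE /supported; move: (fun C => coeff C f) => c.
by elim: (dom f) => [|C s IH] Ps; rewrite ?big_nil // big_cons; apply: RS;
  [apply: Ps; rewrite mem_head|apply: IH => C' C's; apply: Ps; rewrite inE C's orbT].
Qed.

End Supported.

Lemma cob_of_homeo (S T K : finType) (C : cob S T) (b : S + T -> K) (g : K -> nat)
    (s : 'I_(ncomp C) -> K) :
  bijective s -> (forall v, b v = s (bdry C v)) -> (forall i, g (s i) = genus C i) ->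
  homeo C (cob_of b g).
Proof.
move=> [t sK tK] sb sg; exists (fun i => enum_rank (s i)).
  by exists (fun i => t (enum_val i)) => i; rewrite ?enum_rankK ?sK ?tK ?enum_valK.
by split=> [v|i]; rewrite !ffunE ?enum_rankK ?sb ?sg.
Qed.

Lemma closed_sphere_null (S T : finType) (C : cob S T) (c d : 'I_(ncomp C)) :
  d != c -> genus C c = 0%N -> (forall v, bdry C v != c) -> null (<< C >> : lin S T).
Proof.
move=> dc gc bc.
(* [d'] is the default of [insubd]; it is never returned by default, as no boundary circle lies on
   [c]. *)
pose d' : {i | i != c} := Sub d dc.
pose C0 := cob_of (fun v => insubd d' (bdry C v)) (fun i => genus C (val i)).
suff /null_homeo nC : homeo C (add_closed 0 C0).
  by rewrite -[<< C >>](subrK << add_closed 0 C0 >>); apply: null_add nC (null_S _).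
apply: (@cob_of_homeo _ _ _ _ _ _ (fun i => omap enum_rank (insub i : option {i | i != c}))).
- pose inv (o : option 'I_#|{: {i | i != c}}|) := oapp (fun j => val (enum_val j)) c o.
  apply: (@Bijective _ _ _ inv) => [i|[j|]]; rewrite /inv /=.
  + by case: insubP => [j _ <-|] /=; rewrite ?enum_rankK // negbK => /eqP.
  + by rewrite valK /= enum_valK.
  + by rewrite insubN ?eqxx.
- move=> v; rewrite ffunE.
  have -> // : insub (bdry C v) = Some (insubd d' (bdry C v)).
  by rewrite /insubd; case: insubP => //; rewrite bc.
move=> i; case: insubP => [j _ <-|] /=; rewrite ?ffunE ?enum_rankK //.
by rewrite negbK => /eqP ->.
Qed.

(* The component of genus [k] carries the boundary circles in [D], the other
boundary circles bound disks. *)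
Definition normal_cob (S T : finType) (D : {set S + T}) (k : nat) : cob S T :=
  cob_of (K := option {v | v \notin D}) (fun v => insub v)
    (fun o => if o is Some _ then 0%N else k).

Definition is_normal (S T : finType) (v0 v1 : S + T) (C : cob S T) : Prop :=
  exists D k, [/\ C = normal_cob D k, v0 \in D & v1 \in D].

(** The Euler characteristic is recorded because the reduced differential has to be of degree 0. *)
Definition reducible (S T : finType) (v0 v1 : S + T) (C : cob S T) : Prop :=
  exists2 f : lin S T, lin_eq << C >> f &
    supported (fun C' => euler_char C' = euler_char C /\ is_normal v0 v1 C') f.

Section Reduction.
Variables (S T : finType) (v0 v1 : S + T) (n : nat) (c : 'I_n).
Local Notation K := ((S + T) + 'I_n)%type.
Local Notation s := (inr c : K).
Let b : S + T -> K := inl.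
Let g : K -> nat := fun=> 0%N.

Section Star.
Variables (E : seq (K * K)) (C : cob S T) (f : K -> 'I_(ncomp C)).
Hypotheses (glC : glued b g E f) (allE : all (fun e => e.2 == s) E).

Definition star : seq K := s :: unzip1 E.

Lemma star_edge x y : (x, y) \in E -> (x \in star) /\ y = s.
Proof.
move=> xyE; split; last by apply/eqP/(allP allE _ xyE).
by rewrite inE; apply/orP; right; apply/mapP; exists (x, y).
Qed.

Lemma star_map x : x \in star -> f x = f s.
Proof.
rewrite inE => /orP[/eqP -> //|/mapP[[y z] yzE /= ->]].
have [_ zs] := star_edge yzE; case: glC => _ ker _ _; apply/eqP.
by rewrite ker; apply: connect_mem; rewrite -zs.
Qed.

(** Contracting the star to its centre is constant along every tube, so a piece outside the star is
    a component by itself. *)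
Lemma star_inj x y : x \notin star -> f x = f y -> x = y.
Proof.
case: glC => _ ker _ _ xs /eqP; rewrite ker => xy.
pose phi z := if z \in star then s else z.
have edge u v : (u, v) \in E -> phi u = phi v.
  by case/star_edge => us ->; rewrite /phi us mem_head.
have : phi x = phi y.
  by apply: connect_const xy => u v /orP[] /edge.
rewrite /phi (negbTE xs); case: ifP => // _ xE.
by rewrite xE mem_head in xs.
Qed.

Lemma star_genus x : x \notin star -> genus C (f x) = 0%N.
Proof.
move=> xs; case: glC => _ _ _ /(_ (f x)).
rewrite (eq_bigl (pred1 x)) => [|y]; last first.
  by rewrite eq_sym /=; apply/eqP/eqP => [/(star_inj xs)|->].
rewrite big_pred1_eq.
have -> : count (fun e => f e.1 == f x) E = 0%N.
  apply/eqP; rewrite -leqn0 leqNgt -has_count; apply/hasPn => -[y z] /star_edge[ys _].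
  by apply/negP => /eqP/esym /(star_inj xs) xy; rewrite xy ys in xs.
by rewrite /g; lia.
Qed.

(** Pieces outside the star are untouched spheres. If one of them is the sphere of a component, it
    is closed and relation S kills the whole surface. Otherwise each of them has exactly one
    boundary circle, hence is a disk, and the surface is a normal form. *)
Lemma star_reducible : inl v0 \in star -> inl v1 \in star -> reducible v0 v1 C.
Proof.
move=> sv0 sv1; have [ker bd] : (forall x y, (f x == f y) = connect (edge_rel E) x y) /\
  (forall v, bdry C v = f (inl v)) by case: glC.
have [/existsP[i nsi]|/existsPn allc] := boolP [exists i, inr i \notin star].
  exists 0; last exact: supported0.
  rewrite /lin_eq subr0; apply: (@closed_sphere_null _ _ _ (f (inr i)) (f s)).
  - by apply/negP => /eqP/esym /(star_inj nsi) xy; rewrite xy mem_head in nsi.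
  - exact: star_genus.
  - by move=> v; rewrite bd eq_sym; apply/eqP => /(star_inj nsi).
pose D := [set v | inl v \in star].
pose code (x : K) : option {v | v \notin D} := if x is inl v then insub v else None.
have codeN x : x \in star -> code x = None.
  by case: x => // v xs; rewrite /= insubN // negbK inE.
suff glN : glued b g E (C := normal_cob D (genus C (f s))) (fun x => enum_rank (code x)).
  have hC := glued_homeo glC glN.
  exists << normal_cob D (genus C (f s)) >>; first exact: lin_eq_homeo.
  apply: supportedU; split; first by rewrite (homeo_euler_char hC).
  by exists D, (genus C (f s)); rewrite !inE.
have kerE x y : (code x == code y) = (f x == f y).
  apply/eqP/idP => [|].
    case: (boolP (x \in star)) => [xs|].
      rewrite (codeN x xs) (star_map xs); case: y => [v|i] /=.
        by case: insubP => // /negPn; rewrite inE => /star_map ->.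
      by have /negPn/star_map -> := allc i.
    case: x => [v|i] xs; last by have := allc i; rewrite xs.
    have vD : v \notin D by rewrite inE.
    rewrite /= insubT; case: y => [w|] //=; case: insubP => // w' _ <- [<-].
    by rewrite /=.
  rewrite ker; apply: connect_const => u v.
  by case/orP => /star_edge[us ->]; rewrite (codeN _ us).
split=> [i|x y|v|i].
- case ei: (enum_val i) => [v|].
    by exists (inl (val v)); rewrite /= valK -ei enum_valK.
  by exists s; rewrite /= -ei enum_valK.
- by rewrite (inj_eq enum_rank_inj) kerE ker.
- by rewrite ffunE.
have [x fx] : exists x, i = enum_rank (code x).
  case ei: (enum_val i) => [v|].
    by exists (inl (val v)); rewrite /= valK -ei enum_valK.
  by exists s; rewrite /= -ei enum_valK.
have fxE y : (enum_rank (code y) == i) = (f y == f x).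
  by rewrite fx (inj_eq enum_rank_inj) kerE.
under eq_bigl do rewrite fxE; under eq_count do rewrite fxE.
case: glC => _ _ _ <-; congr (Posz _ - 1).
rewrite ffunE fx enum_rankK; case: (boolP (x \in star)) => xs.
  by rewrite codeN // star_map.
rewrite [RHS]star_genus //; case: x {fx fxE} xs => [v|j] xs /=; last by have := allc j; rewrite xs.
by rewrite insubT // inE.
Qed.

End Star.

Lemma four_term (V : zmodType) (x y z t : V) : x + t - (y + z) = x - (y + z - t).
Proof. by rewrite opprB addrA. Qed.

(** This is 4TU with the third and fourth disks both in the component [k]. *)
Lemma four_tube (C : cob S T) (i j k : 'I_(ncomp C)) :
  lin_eq << add_tube i j >>
    (<< add_tube i k >> + << add_tube j k >> - << add_tube k k >> : lin S T).
Proof.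
rewrite /lin_eq; have := null_4TU i j k k; congr null; exact: four_term.
Qed.

(* The 4TU relation trades a tube between pieces [i] and [j] for tubes from
[i], [j] and [s] to [s]. *)
Lemma glued_reducible (B G : seq (K * K)) (C : cob S T) f :
  glued b g (B ++ G) (C := C) f -> all (fun e => e.2 == s) G ->
  (inl v0, s) \in G -> (inl v1, s) \in G -> reducible v0 v1 C.
Proof.
elim: B G C f => [|[i j] B IH] G C f glC allG G0 G1.
  apply: (star_reducible glC allG).
    by rewrite inE; apply/orP; right; apply/mapP; exists (inl v0, s).
  by rewrite inE; apply/orP; right; apply/mapP; exists (inl v1, s).
(* [C0] lacks the tube from [i] to [j]. Each of the three surfaces built from it has as many tubes
   as [C], hence the same Euler characteristic, and one tube fewer that does not end at [s]. *)
have [C0 [f0 glC0]] := @glued_exists S T K b g (B ++ G).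
have tube_red k : exists2 F : lin S T, lin_eq << add_tube (f0 k) (f0 s) >> F &
    supported (fun C' => euler_char C' = euler_char C /\ is_normal v0 v1 C') F.
  have [f' gl'] := add_tube_glued k s glC0.
  have gl'' : glued b g (B ++ (k, s) :: G) (C := add_tube (f0 k) (f0 s)) f'.
    by apply: glued_perm gl'; rewrite -cat1s -[(k, s) :: G]cat1s perm_catCA.
  have [|||F CF PF] := IH _ _ _ gl''; rewrite /= ?eqxx // ?inE ?G0 ?G1 ?orbT //.
  exists F => // C' /PF[-> nC']; split=> //.
  by rewrite (euler_char_glued gl') (euler_char_glued glC).
have [f1 gl1] := add_tube_glued i j glC0.
have [Fi Ci Pi] := tube_red i; have [Fj Cj Pj] := tube_red j.
have [Fs Cs Ps] := tube_red s.
exists (Fi + Fj - Fs); last by apply: supportedB => //; apply: supportedD.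
apply: lin_eq_trans (lin_eq_homeo (glued_homeo glC gl1)) _.
apply: lin_eq_trans (four_tube _ _ (f0 s)) _.
by apply: lin_eq_sub => //; apply: lin_eq_add.
Qed.

End Reduction.

(** The sphere of the common component of [v0] and [v1] serves as centre: its tubes to both of these
    circles are already present among the [sphere_edges]. *)
Lemma marked_reducible (S T : finType) (v0 v1 : S + T) (C : cob S T) :
  bdry C v0 = bdry C v1 -> reducible v0 v1 C.
Proof.
move=> C01; pose s : ((S + T) + 'I_(ncomp C))%type := inr (bdry C v0).
pose good := fun e : ((S + T) + 'I_(ncomp C)) * ((S + T) + 'I_(ncomp C)) => e.2 == s.
have mem_sphere v : (inl v, inr (bdry C v)) \in sphere_edges C.
  by rewrite mem_cat; apply/orP; left; apply/mapP; exists v; rewrite ?mem_enum.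
apply: (@glued_reducible _ _ _ _ _ (bdry C v0)
  (filter (predC good) (sphere_edges C)) (filter good (sphere_edges C))).
- apply: glued_perm (spheres_glued C); rewrite perm_sym perm_catC.
  by rewrite perm_filterC.
- exact: filter_all.
- by rewrite mem_filter /good eqxx mem_sphere.
- by rewrite mem_filter /good eqxx /= C01 mem_sphere.
Qed.

(** * State sums *)

Lemma fgliftB (R : nzRingType) (K : choiceType) (M : lmodType R) (f : K -> M) :
  {morph fglift f : D1 D2 / D1 - D2}.
Proof. exact: lift_is_additive. Qed.

Lemma fglift0 (R : nzRingType) (K : choiceType) (M : lmodType R) (f : K -> M) :
  fglift f 0 = 0.
Proof. by rewrite -(subrr 0) fgliftB subrr. Qed.

Lemma fgliftD (R : nzRingType) (K : choiceType) (M : lmodType R) (f : K -> M) :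
  {morph fglift f : D1 D2 / D1 + D2}.
Proof.
by move=> D1 D2; rewrite -[D2 in LHS]opprK -[- D2]sub0r !fgliftB fglift0 sub0r opprK.
Qed.

Lemma lin_ind (S T : finType) (R : lin S T -> Prop) :
  R 0 -> (forall c C f, R f -> R (<< c *g C >> + f)) -> forall f, R f.
Proof.
by move=> R0 RS f; apply: (@supported_ind _ _ (fun=> True)) => // c C f' _; apply: RS.
Qed.

Section LinComp.
Variables S T U : finType.

Lemma lin_comp0l (g : lin T U) : lin_comp (0 : lin S T) g = 0.
Proof. exact: fglift0. Qed.

Lemma lin_compDl (f1 f2 : lin S T) (g : lin T U) :
  lin_comp (f1 + f2) g = lin_comp f1 g + lin_comp f2 g.
Proof. exact: fgliftD. Qed.

Lemma lin_compUl c (C : cob S T) (g : lin T U) :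
  lin_comp << c *g C >> g = c *: lin_comp << C >> g.
Proof. by rewrite /lin_comp !liftU scale1r. Qed.

Lemma lin_comp0r (f : lin S T) : lin_comp f (0 : lin T U) = 0.
Proof.
elim/lin_ind: f => [|c C f IH]; first exact: lin_comp0l.
by rewrite lin_compDl lin_compUl IH addr0 /lin_comp liftU fglift0 !scaler0.
Qed.

Lemma lin_compDr (C : cob S T) (g1 g2 : lin T U) :
  lin_comp << C >> (g1 + g2) = lin_comp << C >> g1 + lin_comp << C >> g2.
Proof. by rewrite /lin_comp !liftU !scale1r fgliftD. Qed.

Lemma lin_compUr (C : cob S T) c (C' : cob T U) :
  lin_comp << C >> << c *g C' >> = c *: << cob_comp C C' >>.
Proof. by rewrite /lin_comp !liftU scale1r. Qed.

End LinComp.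

Definition boundary_colour (S T : Type) (x : S -> bool) (y : T -> bool) (v : S + T) : bool :=
  match v with inl s => x s | inr t => y t end.

Section StateSum.
Variables (F : fieldType) (h : F).
Hypothesis h_neq0 : h != 0.

(* The Frobenius algebra Z[H][X]/(X^2 - H X) becomes diagonal once [H] is
inverted; [handle c] is the value of the handle operator on the idempotent
where [X = H] (for [c = true]) or [X = 0] (for [c = false]). *)
Definition handle (c : bool) : F := if c then h else - h.

Lemma handle_neq0 c : handle c != 0.
Proof. by case: c; rewrite /handle ?oppr_eq0. Qed.

Lemma handle_sum (I : Type) (r : seq I) (P : pred I) (c : bool) (k : I -> int) :
  handle c ^ (\sum_(i <- r | P i) k i) = \prod_(i <- r | P i) handle c ^ k i.
Proof.
apply: (big_morph (fun k => handle c ^ k)); last exact: expr0z.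
by move=> m n; rewrite expfzDr // handle_neq0.
Qed.

(** In a diagonal Frobenius algebra a closed connected surface has as value the sum over the
    idempotents of the handle value to the power genus minus 1. This is why [g] is instantiated by
    genus minus 1 and why a tube contributes one handle value. *)
Definition colouring_sum (V K : finType) (b : V -> K) (g : K -> int)
    (E : seq (K * K)) (z : V -> bool) : F :=
  \sum_(col : {ffun K -> bool} |
          all (fun e => col e.1 == col e.2) E && [forall v, col (b v) == z v])
    (\prod_k handle (col k) ^ g k) * \prod_(e <- E) handle (col e.1).

(** The factor over the target circles raises indices by the inverse of the Frobenius form: with it
    cylinders give identity matrices and gluing gives the matrix product. *)
Definition state_sum (S T : finType) (C : cob S T)
    (x : {ffun S -> bool}) (y : {ffun T -> bool}) : F :=
  (\prod_t handle (y t)) *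
  colouring_sum (bdry C) (fun i => (genus C i)%:Z - 1) [::] (boundary_colour x y).

(** Colourings of the pieces that agree along the tubes are the colourings of the components, and
    the exponents over a component add up by the genus formula of [glued]. *)
Lemma glued_colouring_sum (S T K : finType) (b : S + T -> K) (g : K -> nat) E
    (C : cob S T) f (z : S + T -> bool) :
  glued b g E (C := C) f ->
  colouring_sum (bdry C) (fun i => (genus C i)%:Z - 1) [::] z =
  colouring_sum b (fun k => (g k)%:Z - 1) E z.
Proof.
case=> surj ker bd gen.
pose r i := xchoose (surj i).
have rK i : f (r i) = i by apply/eqP/(xchooseP (surj i)).
pose pull (col : {ffun 'I_(ncomp C) -> bool}) := [ffun k => col (f k)].
pose push (col : {ffun K -> bool}) := [ffun i => col (r i)].
rewrite /colouring_sum [RHS](reindex_onto pull push) /=; last first.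
  move=> col /andP[/allP colE _]; apply/ffunP => k; rewrite !ffunE.
  have : connect (edge_rel E) (r (f k)) k by rewrite -ker rK.
  by apply: connect_const => u v /orP[] /colE /eqP.
have pushK col : push (pull col) = col by apply/ffunP => i; rewrite !ffunE rK.
apply: eq_big => [col|col _].
  rewrite pushK eqxx andbT; have -> : all (fun e => pull col e.1 == pull col e.2) E.
    apply/allP => -[k l] klE; rewrite !ffunE /=; apply/eqP; congr (col _).
    by apply/eqP; rewrite ker; apply: connect_mem.
  by apply: eq_forallb => v; rewrite ffunE bd.
rewrite big_nil mulr1.
have -> : \prod_k handle (pull col k) ^ ((g k)%:Z - 1) =
    \prod_i \prod_(k | f k == i) handle (col i) ^ ((g k)%:Z - 1).
  rewrite (partition_big f predT) //=; apply: eq_bigr => i _.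
  by apply: eq_bigr => k /eqP fk; rewrite ffunE fk.
have -> : \prod_(e <- E) handle (pull col e.1) =
    \prod_i handle (col i) ^ (count (fun e => f e.1 == i) E)%:Z.
  elim: E {ker gen} => [|e E IH]; first by rewrite big_nil big1 // => i _; rewrite expr0z.
  rewrite big_cons IH (bigD1 (f e.1)) //= [in RHS](bigD1 (f e.1)) //=.
  rewrite ffunE eqxx /= add1n exprSz -mulrA; congr (_ * (_ * _)).
  by apply: eq_bigr => i /negbTE; rewrite eq_sym => ->.
rewrite -big_split /=; apply: eq_bigr => i _.
by rewrite gen expfzDr ?handle_neq0 // handle_sum.
Qed.

Lemma cob_of_glued (S T K : finType) (b : S + T -> K) (g : K -> nat) :
  glued b g [::] (C := cob_of b g) (fun k => enum_rank k).
Proof.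
split=> [i|x y|v|i] /=; first by exists (enum_val i); rewrite enum_valK.
- rewrite (inj_eq enum_rank_inj); apply/eqP/idP => [->|]; first exact: connect0.
  exact: connect_const.
- by rewrite ffunE.
by rewrite ffunE addr0 (eq_bigl (pred1 (enum_val i))) ?big_pred1_eq // => k;
  rewrite (can2_eq enum_rankK enum_valK).
Qed.

Lemma state_sum_cob_of (S T K : finType) (b : S + T -> K) (g : K -> nat) x y :
  state_sum (cob_of b g) x y = (\prod_t handle (y t)) *
  colouring_sum b (fun k => (g k)%:Z - 1) [::] (boundary_colour x y).
Proof. by congr (_ * _); apply: glued_colouring_sum; apply: cob_of_glued. Qed.

Lemma state_sum_homeo (S T : finType) (C C' : cob S T) x y :
  homeo C C' -> state_sum C x y = state_sum C' x y.
Proof.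
case=> s bs [bd gs]; congr (_ * _).
symmetry; apply: (@glued_colouring_sum _ _ _ _ _ _ _ s).
case: bs => t sK tK; split=> [i|i j|v|i].
- by exists (t i); rewrite tK.
- rewrite (can_eq sK); apply/eqP/idP => [->|]; first exact: connect0.
  exact: connect_const.
- exact: bd.
rewrite addr0 (eq_bigl (pred1 (t i))) => [|k].
  by rewrite big_pred1_eq -gs tK.
by rewrite /= (can2_eq sK tK).
Qed.

Lemma state_sum_id (S : finType) (x y : {ffun S -> bool}) :
  state_sum (cob_id S) x y = (x == y)%:R.
Proof.
rewrite state_sum_cob_of /colouring_sum.
have [<-|/eqP xy] := eqVneq x y.
  rewrite (big_pred1 x) => [|col] /=; last first.
    apply/forallP/eqP => [colx|-> [s|s]] //=.
    by apply/ffunP => s; have /eqP := colx (inl s).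
  rewrite big_nil mulr1 -big_split /= big1 // => s _.
  by rewrite sub0r exprN1 divff // handle_neq0.
rewrite [X in _ * X]big_pred0 ?mulr0 // => col /=; apply/negP => /forallP cxy; apply: xy.
apply/ffunP => s; have /eqP /= <- := cxy (inl s).
by have /eqP /= <- := cxy (inr s).
Qed.

Lemma state_sum_comp (S T U : finType) (C : cob S T) (C' : cob T U) x z :
  state_sum (cob_comp C C') x z = \sum_y state_sum C x y * state_sum C' y z.
Proof.
rewrite /state_sum (glued_colouring_sum _ (glue_glued _ _ _ _)).
pose joint (p : {ffun 'I_(ncomp C) -> bool} * {ffun 'I_(ncomp C') -> bool}) :
  {ffun 'I_(ncomp C) + 'I_(ncomp C') -> bool} :=
  [ffun k => match k with inl i => p.1 i | inr i => p.2 i end].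
have bij_joint : bijective joint.
  exists (fun col : {ffun 'I_(ncomp C) + 'I_(ncomp C') -> bool} =>
    ([ffun i => col (inl i)], [ffun i => col (inr i)])).
    by case=> c1 c2; congr (_, _); apply/ffunP => i; rewrite !ffunE.
  by move=> col; apply/ffunP => -[i|i]; rewrite !ffunE.
(* Joint colourings are sorted by the colours [y] that they induce on the circles of [T]; the tubes
   along these circles supply the normalising factor of the first state sum. *)
rewrite {1}/colouring_sum (partition_big
  (fun col : {ffun 'I_(ncomp C) + 'I_(ncomp C') -> bool} =>
     [ffun t => col (inl (bdry C (inr t)))]) predT) //= mulr_sumr.
apply: eq_bigr => y _; rewrite mulrCA -mulrA; congr (_ * _).
rewrite /colouring_sum big_distrlr /= (reindex joint) /=; last exact: onW_bij.
rewrite pair_big /= mulr_sumr; apply: eq_big => [[c1 c2]|[c1 c2] /andP[_ /eqP cy]] /=.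
  apply/idP/idP.
    case/andP => /andP[/allP cE /forallP cb] /eqP cy.
    apply/andP; split; apply/forallP => -[s|t]; apply/eqP => /=.
    - by have /eqP := cb (inl s); rewrite ffunE.
    - by rewrite -cy !ffunE.
    - rewrite -cy !ffunE; symmetry; apply/eqP.
      have := cE _ (map_f (fun t => (inl (bdry C (inr t)), inr (bdry C' (inl t))))
        (mem_enum T s)).
      by rewrite !ffunE.
    - by have /eqP := cb (inr t); rewrite ffunE.
  case/andP => /forallP c1b /forallP c2b.
  have c1y t : c1 (bdry C (inr t)) = y t by have /eqP := c1b (inr t).
  have c2y t : c2 (bdry C' (inl t)) = y t by have /eqP := c2b (inl t).
  apply/andP; split; last by apply/eqP/ffunP => t; rewrite !ffunE c1y.
  apply/andP; split.
    by apply/allP => _ /mapP[t _ ->]; rewrite /= !ffunE c1y c2y.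
  apply/forallP => -[s|t]; rewrite !ffunE /=; [exact: (c1b (inl s))|exact: (c2b (inr t))].
rewrite !big_nil !mulr1 big_map big_enum /= big_sumType /=.
rewrite (eq_bigr (fun t => handle (y t))) => [|t _]; last by rewrite -cy !ffunE.
rewrite [_ * \prod_t _]mulrC; congr (_ * (_ * _));
  apply: eq_bigr => i _; by rewrite ffunE.
Qed.

Lemma state_sum_add_tube (S T : finType) (C : cob S T) (i j : 'I_(ncomp C)) x y :
  state_sum (add_tube i j) x y = (\prod_t handle (y t)) *
  \sum_(col : {ffun 'I_(ncomp C) -> bool} |
      [forall v, col (bdry C v) == boundary_colour x y v])
    (\prod_k handle (col k) ^ ((genus C k)%:Z - 1)) *
    (if col i == col j then handle (col i) else 0).
Proof.
rewrite /state_sum (glued_colouring_sum _ (glue_glued _ _ _ _)).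
have -> : enum {: unit} = [:: tt] by rewrite enumT unlock.
congr (_ * _); rewrite /colouring_sum /= big_mkcond [RHS]big_mkcond /=.
apply: eq_bigr => col _; rewrite big_seq1 /= andbT.
by case: (col i == col j); case: [forall v, _]; rewrite //= mulr0.
Qed.

(** As the two handle values are opposite, a tube between pieces of colours c and d contributes half
    the sum of their handle values, which is 0 when they differ. Both sides thus involve half the
    sum over all four pieces. *)
Lemma state_sum_4TU (S T : finType) (C : cob S T) (i j k l : 'I_(ncomp C)) x y :
  state_sum (add_tube i j) x y + state_sum (add_tube k l) x y =
  state_sum (add_tube i k) x y + state_sum (add_tube j l) x y.
Proof.
apply: etrans (congr2 +%R (state_sum_add_tube i j x y) (state_sum_add_tube k l x y)) _.
apply: etrans _ (esym (congr2 +%R (state_sum_add_tube i k x y) (state_sum_add_tube j l x y))).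
rewrite -!mulrDr -!big_split /=; congr (_ * _).
apply: eq_bigr => col _; rewrite -!mulrDr; congr (_ * _).
case: (col i) (col j) (col k) (col l) => [] [] [] [] //=;
  by rewrite ?addr0 ?add0r ?subrr ?addNr.
Qed.

Lemma state_sum_add_closed (S T : finType) (g : nat) (C : cob S T) x y :
  state_sum (add_closed g C) x y =
  (\sum_c handle c ^ (g%:Z - 1)) * state_sum C x y.
Proof.
rewrite state_sum_cob_of /state_sum mulrCA; congr (_ * _).
pose joint (p : bool * {ffun 'I_(ncomp C) -> bool}) :
  {ffun option 'I_(ncomp C) -> bool} := [ffun k => oapp p.2 p.1 k].
have bij_joint : bijective joint.
  exists (fun col : {ffun option 'I_(ncomp C) -> bool} =>
    (col None, [ffun i => col (Some i)])).
    by case=> c1 c2; rewrite ffunE; congr (_, _); apply/ffunP => i; rewrite !ffunE.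
  by move=> col; apply/ffunP => -[i|]; rewrite ffunE //= ffunE.
rewrite /colouring_sum (reindex joint) /=; last exact: onW_bij.
rewrite big_distrlr /= pair_big; apply: eq_big => [[c col]|[c col] _] /=.
  by apply: eq_forallb => v; rewrite ffunE.
rewrite !big_nil !mulr1 (bigD1 None) //= ffunE /=; congr (_ * _).
rewrite (reindex_omap Some id) => [|[]] //=; apply: eq_big => [i|i _]; first by rewrite eqxx.
by rewrite ffunE.
Qed.

Definition lin_sum (S T : finType) (f : lin S T) (x : {ffun S -> bool})
    (y : {ffun T -> bool}) : F :=
  fglift (M := zmodule F) (fun C => state_sum C x y) f.

Section LinSum.
Variables S T : finType.
Implicit Types (f g : lin S T) (x : {ffun S -> bool}) (y : {ffun T -> bool}).

Lemma lin_sumB f g x y : lin_sum (f - g) x y = lin_sum f x y - lin_sum g x y.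
Proof. exact: (lift_is_additive (M := zmodule F)). Qed.

Lemma lin_sum0 x y : lin_sum (0 : lin S T) x y = 0.
Proof. by rewrite -(subrr 0) lin_sumB subrr. Qed.

Lemma lin_sumD f g x y : lin_sum (f + g) x y = lin_sum f x y + lin_sum g x y.
Proof. by rewrite -[g in LHS]opprK -[- g in LHS]sub0r !lin_sumB lin_sum0 sub0r opprK. Qed.

Lemma lin_sumU c C x y : lin_sum << c *g C >> x y = state_sum C x y *~ c.
Proof. exact: (liftU (M := zmodule F)). Qed.

Lemma lin_sum1 C x y : lin_sum << C >> x y = state_sum C x y.
Proof. by rewrite lin_sumU mulr1z. Qed.

Lemma lin_sum_sum (I : Type) (r : seq I) (P : pred I) (f : I -> lin S T) x y :
  lin_sum (\sum_(i <- r | P i) f i) x y = \sum_(i <- r | P i) lin_sum (f i) x y.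
Proof.
apply: (big_morph (fun f => lin_sum f x y)); last exact: lin_sum0.
by move=> f1 f2; apply: lin_sumD.
Qed.

Lemma lin_sum_four_term (C1 C2 C3 C4 : cob S T) x y :
  lin_sum (<< C1 >> + << C2 >> - (<< C3 >> + << C4 >>)) x y =
  state_sum C1 x y + state_sum C2 x y - (state_sum C3 x y + state_sum C4 x y).
Proof. by rewrite lin_sumB !lin_sumD !lin_sum1. Qed.

Lemma lin_sumZ c f x y : lin_sum (c *: f) x y = lin_sum f x y *~ c.
Proof.
rewrite -[c]intz scaler_int !intz; case: c => n.
  by rewrite -!pmulrn; elim: n => [|n IH]; rewrite ?lin_sum0 // !mulrS lin_sumD IH.
rewrite NegzE !mulrNz -!pmulrn -[- _ in LHS]sub0r lin_sumB lin_sum0 sub0r; congr (- _).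
by elim: n.+1 => [|m IH]; rewrite ?lin_sum0 // !mulrS lin_sumD IH.
Qed.

(** A closed sphere contributes the sum of the inverse handle values, which cancel, and a torus
    counts the two colours. *)
Lemma null_lin_sum f x y : null f -> lin_sum f x y = 0.
Proof.
elim=> [|f1 f2 _ IH1 _ IH2|C C' CC|C i j k l|C|C].
- exact: lin_sum0.
- by rewrite lin_sumB IH1 IH2 subrr.
- by rewrite lin_sumB !lin_sum1 (state_sum_homeo _ _ CC) subrr.
- apply: etrans (lin_sum_four_term _ _ _ _ _ _) _; apply/eqP; rewrite subr_eq0.
  by apply/eqP; apply: state_sum_4TU.
- rewrite lin_sum1 state_sum_add_closed big_bool /= sub0r !exprN1.
  by rewrite /handle invrN subrr mul0r.
- rewrite lin_sumB lin_sum1 lin_sumU state_sum_add_closed big_bool /= subrr !expr0z.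
  by rewrite mulrDl !mul1r -mulr2n subrr.
Qed.

Lemma lin_eq_lin_sum f g x y : lin_eq f g -> lin_sum f x y = lin_sum g x y.
Proof. by move/(@null_lin_sum _ x y)/eqP; rewrite lin_sumB subr_eq0 => /eqP. Qed.

End LinSum.

Lemma lin_sum_comp (S T U : finType) (f : lin S T) (g : lin T U) x z :
  lin_sum (lin_comp f g) x z = \sum_y lin_sum f x y * lin_sum g y z.
Proof.
elim/lin_ind: f => [|c C f IH].
  by rewrite lin_comp0l lin_sum0 big1 // => y _; rewrite lin_sum0 mul0r.
rewrite lin_compDl lin_compUl lin_sumD lin_sumZ IH.
under [RHS]eq_bigr do rewrite lin_sumD lin_sumU mulrDl.
rewrite big_split /=; congr (_ + _).
under [RHS]eq_bigr do rewrite mulrzAl.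
rewrite -mulrz_suml; congr (_ *~ _).
elim/lin_ind: g {f IH} => [|d C' g IH].
  by rewrite lin_comp0r lin_sum0 big1 // => y _; rewrite lin_sum0 mulr0.
rewrite lin_compDr lin_compUr lin_sumD lin_sumZ IH.
under [RHS]eq_bigr do rewrite lin_sumD lin_sumU mulrDr.
rewrite big_split /=; congr (_ + _).
under [RHS]eq_bigr do rewrite mulrzAr.
by rewrite -mulrz_suml; congr (_ *~ _); rewrite lin_sum1 state_sum_comp.
Qed.

Lemma lin_sum_id (S : finType) (x y : {ffun S -> bool}) :
  lin_sum << cob_id S >> x y = (x == y)%:R.
Proof. by rewrite lin_sum1 state_sum_id. Qed.

End StateSum.

(** * Faithfulness of the state sums *)

Lemma freegZ (R : nzRingType) (K : choiceType) (c : R) (x : K) :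
  << c *g x >> = c *: << x >> :> {freeg K / R}.
Proof. by apply/eqP/freeg_eqP => y; rewrite coeffZ !coeffU mul1r. Qed.

Lemma null_scale (S T : finType) c (f : lin S T) : null f -> null (c *: f).
Proof.
move=> nf; rewrite -[c]intz scaler_int.
have nfn n : null (f *+ n).
  elim: n => [|n IH]; first exact: null_0.
  by rewrite mulrS; apply: null_add.
by case: c => n; rewrite ?NegzE ?mulrNz -pmulrn //; apply: null_opp.
Qed.

Section NormalForms.
Variables (S T : finType) (v0 : S + T).

Definition special_genus (C : cob S T) : nat := genus C (bdry C v0).
Definition special_boundary (C : cob S T) : {set S + T} :=
  [set v | bdry C v == bdry C v0].

Lemma special_genus_normal (D : {set S + T}) k :
  v0 \in D -> special_genus (normal_cob D k) = k.
Proof. by move=> Dv0; rewrite /special_genus !ffunE enum_rankK insubN // negbK. Qed.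

Lemma special_boundary_normal (D : {set S + T}) k :
  v0 \in D -> special_boundary (normal_cob D k) = D.
Proof.
move=> Dv0; apply/setP => v; rewrite inE !ffunE (inj_eq enum_rank_inj).
rewrite [in X in _ == X]insubN ?negbK //.
by case: insubP => [_ /negbTE -> //|]; rewrite negbK => ->.
Qed.

End NormalForms.

Section Faithful.
Variables (F : fieldType) (h : F).
Hypothesis h_transcendental : forall p : {poly int}, (map_poly intr p).[h] = 0 -> p = 0.

Lemma transcendental_neq0 : h != 0.
Proof.
apply/eqP => h0; have := @h_transcendental 'X.
by rewrite map_polyX hornerX => /(_ h0)/eqP; rewrite polyX_eq0.
Qed.

Let h_neq0 := transcendental_neq0.

Section Normal.
Variables (S T : finType) (v0 : S + T).

(** A tensor product over the boundary circles. With entries listed for [true] and then [false], the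
    factor is (1, 0) for a circle on the special component and (1/h, -1/h) for one that bounds a
    disk; these two vectors form a basis. *)
Definition normal_weight (D : {set S + T}) (z : S + T -> bool) : F :=
  \prod_v (if v \in D then (z v)%:R else (handle h (z v))^-1).

Lemma state_sum_normal (D : {set S + T}) k (x : {ffun S -> bool}) (y : {ffun T -> bool}) :
  v0 \in D -> boundary_colour x y v0 ->
  state_sum h (normal_cob D k) x y =
  (\prod_t handle h (y t)) * (h ^ (k%:Z - 1) * normal_weight D (boundary_colour x y)).
Proof.
move=> Dv0 z0; rewrite state_sum_cob_of //; congr (_ * _).
set z := boundary_colour x y in z0 *; rewrite /colouring_sum /=.
(* If a circle of [D] has colour [false], the special component would need two colours, and both
   sides vanish. *)
have [/forallP zD|] := boolP [forall v, (v \in D) ==> z v]; last first.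
  rewrite negb_forall => /existsP[v]; rewrite negb_imply => /andP[Dv /negbTE zv].
  rewrite /normal_weight (bigD1 v) //= Dv zv mul0r mulr0.
  apply: big_pred0 => col; apply/negP => /forallP cz.
  have /eqP := cz v; have /eqP := cz v0; rewrite !insubN ?negbK // => ->.
  by rewrite z0 zv.
pose col0 : {ffun option {v | v \notin D} -> bool} := [ffun o => oapp (fun v => z (val v)) true o].
rewrite (big_pred1 col0) => [|col] /=; last first.
  apply/forallP/eqP => [cz|-> v].
    apply/ffunP => -[v|]; rewrite ffunE /=.
      by have /eqP := cz (val v); rewrite valK.
    by have /eqP := cz v0; rewrite insubN ?negbK // => ->.
  rewrite ffunE; case: insubP => [v' _ <-|/negPn] //= Dv.
  by have := zD v; rewrite Dv /= => ->.
rewrite big_nil mulr1 (bigD1 None) //= ffunE /=; congr (_ * _).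
rewrite (reindex_omap Some id) => [|[]] //=.
rewrite /normal_weight (bigID (mem D)) /= [X in _ = X * _]big1 => [|v Dv]; last first.
  by have := zD v; rewrite Dv /= => ->.
rewrite mul1r (eq_bigl (fun v => v \notin D)) //.
rewrite [RHS](reindex_omap (val : {v | v \notin D} -> S + T) insub) => [|v Dv].
  apply: eq_big => [v|v _]; first by rewrite (valP v) valK !eqxx.
  by rewrite ffunE /= (negbTE (valP v)) sub0r exprN1.
by rewrite insubT.
Qed.

(** The dual basis, circle by circle: (1, 1) and (0, -h) are dual to (1, 0) and (1/h, -1/h). *)
Definition dual_weight (D : {set S + T}) (z : S + T -> bool) : F :=
  \prod_v (if v \in D then 1 else if z v then 0 else - h).

Lemma dual_normal_weight (D D' : {set S + T}) :
  \sum_(z : {ffun S + T -> bool}) dual_weight D z * normal_weight D' z = (D' == D)%:R.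
Proof.
under eq_bigr do rewrite -big_split /=.
rewrite -(bigA_distr_bigA (fun v c => (if v \in D then 1 else if c then 0 else - h) *
  (if v \in D' then c%:R else (handle h c)^-1))).
have -> : (D' == D) = [forall v, (v \in D') == (v \in D)].
  apply/eqP/forallP => [-> v|DD]; first exact: eqxx.
  by apply/setP => v; apply/eqP.
rewrite (eq_bigr (fun v => ((v \in D') == (v \in D))%:R)) => [|v _]; last first.
  rewrite big_bool /handle /=; case: (v \in D); case: (v \in D') => /=.
  - by rewrite mulr1 mulr0 addr0.
  - by rewrite !mul1r invrN subrr.
  - by rewrite mul0r mulr0 addr0.
  - by rewrite mul0r add0r divff // oppr_eq0.
have [/forallP DD|] := boolP [forall v, (v \in D') == (v \in D)].
  by rewrite big1 // => v _; rewrite (eqP (DD v)) eqxx.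
by rewrite negb_forall => /existsP[v /negbTE DD]; rewrite (bigD1 v) //= DD mul0r.
Qed.

Lemma lin_sumE (f : lin S T) x y :
  lin_sum h f x y = \sum_(C <- dom f) state_sum h C x y *~ coeff C f.
Proof.
rewrite -{1}[f]freeg_sumE lin_sum_sum; apply: eq_bigr => C _.
exact: lin_sumU.
Qed.

(** Pairing with [dual_weight] isolates the normal forms with a given set of circles on the special
    component. What is left is an integer polynomial in h, up to a factor h, whose coefficients are
    those of [f]; transcendence makes them vanish. *)
Lemma normal_independent v1 (f : lin S T) :
  supported (is_normal v0 v1) f ->
  (forall (x : {ffun S -> bool}) (y : {ffun T -> bool}),
     boundary_colour x y v0 -> boundary_colour x y v1 -> lin_sum h f x y = 0) ->
  f = 0.
Proof.
move=> nf f0; apply/eqP; rewrite -dom_eq0; apply/eqP.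
case domf: (dom f) => [//|C0 s].
have C0f : C0 \in dom f by rewrite domf mem_head.
suff : coeff C0 f = 0 by move/eqP; rewrite -[_ == 0]negbK -mem_dom C0f.
have normE C : C \in dom f -> [/\ C = normal_cob (special_boundary v0 C) (special_genus v0 C),
    v0 \in special_boundary v0 C & v1 \in special_boundary v0 C].
  move=> /nf[D [k [-> Dv0 Dv1]]].
  by rewrite special_boundary_normal // special_genus_normal.
pose G (z : {ffun S + T -> bool}) := \sum_(C <- dom f)
  (h ^ ((special_genus v0 C)%:Z - 1) * normal_weight (special_boundary v0 C) z) *~ coeff C f.
(* The pairing runs over all colourings, whereas the hypothesis covers those that are [true] at [v0]
   and [v1]. At the others every weight vanishes, because both circles lie on the special
   component. *)
have G0 z : G z = 0.
  have [/andP[z0 z1]|z01] := boolP (z v0 && z v1).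
    pose x := [ffun s => z (inl s)]; pose y := [ffun t => z (inr t)].
    have zE v : boundary_colour x y v = z v by case: v => v; rewrite /= ffunE.
    have := f0 x y; rewrite !zE => /(_ z0 z1) /eqP.
    have -> : lin_sum h f x y = (\prod_t handle h (y t)) * G z.
      rewrite lin_sumE mulr_sumr big_seq [RHS]big_seq; apply: eq_bigr => C Cf.
      have [eC Dv0 Dv1] := normE C Cf; rewrite {1}eC.
      rewrite state_sum_normal ?zE // mulrzAr; congr (_ * (_ * _) *~ _).
      by apply: eq_bigr => v _; rewrite zE.
    rewrite mulf_eq0 => /orP[|/eqP //]; rewrite prodf_seq_eq0 => /hasP[t _].
    by rewrite (negbTE (handle_neq0 h_neq0 _)).
  rewrite /G big_seq big1 // => C /normE[_ Dv0 Dv1].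
  suff -> : normal_weight (special_boundary v0 C) z = 0 by rewrite mulr0 mul0rz.
  case/nandP: z01 => /negbTE zv; rewrite /normal_weight.
    by rewrite (bigD1 v0) //= Dv0 zv mul0r.
  by rewrite (bigD1 v1) //= Dv1 zv mul0r.
pose D0 := special_boundary v0 C0.
pose p : {poly int} := \sum_(C <- dom f | special_boundary v0 C == D0)
  coeff C f *: 'X^(special_genus v0 C).
have p0 : p = 0.
  apply: h_transcendental.
  have : \sum_(z : {ffun S + T -> bool}) dual_weight D0 z * G z = 0.
    by rewrite big1 // => z _; rewrite G0 mulr0.
  under eq_bigr do rewrite mulr_sumr; rewrite exchange_big /=.
  (* The exponents are genus minus 1; multiplying by h makes them exponents of a polynomial. *)
  move/(congr1 (fun a => h * a)); rewrite mulr0 => <-.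
  rewrite /p rmorph_sum horner_sum mulr_sumr big_mkcond /=; apply: eq_bigr => C _.
  under [in RHS]eq_bigr do rewrite mulrzAr mulrCA.
  rewrite -mulrz_suml -mulr_sumr dual_normal_weight.
  case: eqP => _; last by rewrite mulr0 mul0rz mulr0.
  rewrite mulr1 map_polyZ /= map_polyXn hornerZ hornerXn mulrzl mulrzAr.
  by rewrite -[X in X * _](expr1z h) -expfzDr // addrC subrK.
have := congr1 (fun q : {poly int} => q`_(special_genus v0 C0)) p0.
rewrite coef0 /p coef_sum big_mkcond (bigD1_seq C0) ?uniq_dom //= eqxx.
rewrite coefZ coefXn eqxx mulr1 big_seq_cond big1 ?addr0 // => C /andP[Cf CC0].
case: eqP => // CD.
rewrite coefZ coefXn; case: eqP => [kk|_]; last by rewrite mulr0.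
have [eC _ _] := normE C Cf; have [eC0 _ _] := normE C0 C0f.
by case/eqP: CC0; rewrite eC eC0 CD kk.
Qed.

End Normal.

Definition marked (S T : finType) (s0 : S) (t0 : T) (C : cob S T) : Prop :=
  bdry C (inl s0) = bdry C (inr t0).

(** Reduction to normal forms does not change state sums, and a combination of normal forms whose
    state sums vanish is literally 0. *)
Theorem state_sum_faithful (S T : finType) (s0 : S) (t0 : T) (f : lin S T) :
  supported (marked s0 t0) f ->
  (forall (x : {ffun S -> bool}) (y : {ffun T -> bool}), x s0 -> y t0 ->
     lin_sum h f x y = 0) -> null f.
Proof.
move=> mf f0.
have [f' ff' nf'] : exists2 f' : lin S T, lin_eq f f' &
    supported (is_normal (inl s0) (inr t0)) f'.
  move: f mf {f0}; apply: supported_ind.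
    by exists 0; [exact: lin_eq_refl|exact: supported0].
  move=> c C f /marked_reducible[g Cg ng] [f' ff' nf'].
  exists (c *: g + f'); last first.
    by apply: supportedD => //; apply: supportedZ => C' /ng[].
  apply: lin_eq_add => //.
  by rewrite /lin_eq freegZ -scalerBr; apply: null_scale.
suff f'0 : f' = 0 by move: ff'; rewrite f'0 /lin_eq subr0.
apply: normal_independent nf' _ => x y xs yt.
by rewrite -(lin_eq_lin_sum h_neq0 _ _ ff'); apply: f0.
Qed.

End Faithful.

Lemma supported_comp (S T U : finType) (P : cob S T -> Prop) (Q : cob T U -> Prop)
    (R : cob S U -> Prop) (f : lin S T) (g : lin T U) :
  (forall C C', P C -> Q C' -> R (cob_comp C C')) ->
  supported P f -> supported Q g -> supported R (lin_comp f g).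
Proof.
move=> PQR Pf Qg; move: f Pf; apply: supported_ind.
  by rewrite lin_comp0l; apply: supported0.
move=> c C f PC Rf; rewrite lin_compDl lin_compUl; apply: supportedD => //.
apply: supportedZ; move: g Qg {Rf}; apply: supported_ind.
  by rewrite lin_comp0r; apply: supported0.
move=> d C' g QC' Rg; rewrite lin_compDr lin_compUr; apply: supportedD => //.
by apply: supportedZ; apply: supportedU; apply: PQR.
Qed.

Lemma supported_weaken (S T : finType) (P Q : cob S T -> Prop) (f : lin S T) :
  (forall C, P C -> Q C) -> supported P f -> supported Q f.
Proof. by move=> PQ Pf C /Pf /PQ. Qed.

Lemma euler_char_comp (S T U : finType) (C : cob S T) (C' : cob T U) :
  euler_char (cob_comp C C') = euler_char C + euler_char C'.
Proof.
rewrite (euler_char_glued (glue_glued _ _ _ _)) size_map -cardT /euler_char.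
rewrite big_sumType /=.
rewrite (eq_bigr (fun i => 2 - (2 * genus C i)%N%:Z)) => [|i _]; last by rewrite PoszM.
rewrite [X in _ + X - _ - _](eq_bigr (fun i => 2 - (2 * genus C' i)%N%:Z)) => [|i _];
  last by rewrite PoszM.
set a := \sum_(_ < ncomp C) _; set b := \sum_(_ < ncomp C') _.
lia.
Qed.

Lemma cob_comp_marked (S T U : finType) (s0 : S) (t0 : T) (u0 : U)
    (C : cob S T) (C' : cob T U) :
  marked s0 t0 C -> marked t0 u0 C' -> marked s0 u0 (cob_comp C C').
Proof.
rewrite /marked => C0 C'0.
have [_ ker bd _] := glue_glued (S := S) (T := U)
  (fun x => match x with inl s => inl (bdry C (inl s)) | inr u => inr (bdry C' (inr u)) end)
  (fun k => match k with inl i => genus C i | inr i => genus C' i end)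
  (fun t : T => inl (bdry C (inr t)) : 'I_(ncomp C) + 'I_(ncomp C'))
  (fun t : T => inr (bdry C' (inl t))).
rewrite !bd C0 -C'0; apply/eqP; rewrite ker; apply: connect_mem.
by apply/mapP; exists t0; rewrite ?mem_enum.
Qed.

Lemma cob_id_marked (S : finType) (s0 : S) : marked s0 s0 (cob_id S).
Proof. by rewrite /marked !ffunE. Qed.

Definition homogeneous (S T : finType) (s0 : S) (t0 : T) (m : int) (C : cob S T) : Prop :=
  marked s0 t0 C /\ euler_char C = m.

Lemma homogeneous_comp (S T U : finType) (s0 : S) (t0 : T) (u0 : U) m n
    (f : lin S T) (g : lin T U) :
  supported (homogeneous s0 t0 m) f -> supported (homogeneous t0 u0 n) g ->
  supported (homogeneous s0 u0 (m + n)) (lin_comp f g).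
Proof.
apply: supported_comp => C C' [mC <-] [mC' <-]; split; last exact: euler_char_comp.
exact: cob_comp_marked mC mC'.
Qed.

Lemma homogeneous_marked (S T : finType) (s0 : S) (t0 : T) m (f : lin S T) :
  supported (homogeneous s0 t0 m) f -> supported (marked s0 t0) f.
Proof. by apply: supported_weaken => C []. Qed.

Section Colours.
Variables (S : finType) (s0 : S).

Definition others : finType := {s | s != s0}.

Definition lift_colour (c : {ffun others -> bool}) : {ffun S -> bool} :=
  [ffun s => oapp c true (insub s)].

Lemma lift_colour_special c : lift_colour c s0.
Proof. by rewrite ffunE insubN // negbK. Qed.

Lemma lift_colour_val c (s : others) : lift_colour c (val s) = c s.
Proof. by rewrite ffunE valK. Qed.

Lemma lift_colour_onto (x : {ffun S -> bool}) :
  x s0 -> lift_colour [ffun s => x (val s)] = x.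
Proof.
move=> xs; apply/ffunP => s; rewrite ffunE; case: insubP => [s' _ <-|] /=.
  by rewrite ffunE.
by rewrite negbK => /eqP ->.
Qed.

Lemma big_special (R : Type) (idx : R) (op : Monoid.com_law idx) (phi : S -> R) :
  \big[op/idx]_s phi s = op (phi s0) (\big[op/idx]_(s : others) phi (val s)).
Proof.
rewrite (bigD1 s0) //=; congr (op _ _).
rewrite (reindex_omap (val : others -> S) insub) => [|s sn]; last by rewrite insubT.
by apply: eq_bigl => s; rewrite valK eqxx (valP s).
Qed.

Lemma sum_lift_colour (V : nmodType) (phi : {ffun S -> bool} -> V) :
  \sum_(x : {ffun S -> bool} | x s0) phi x = \sum_c phi (lift_colour c).
Proof.
rewrite (reindex_onto lift_colour (fun x => [ffun s => x (val s)])) /=; last first.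
  by move=> x; apply: lift_colour_onto.
apply: eq_bigl => c; rewrite lift_colour_special; apply/eqP/ffunP => s.
by rewrite ffunE lift_colour_val.
Qed.

End Colours.

(** * Matrices of cobordisms joining the special circles *)

Section Matrices.
Variables (F : fieldType) (h : F).
Hypothesis h_transcendental : forall p : {poly int}, (map_poly intr p).[h] = 0 -> p = 0.

Let h_neq0 := transcendental_neq0 h_transcendental.

(** The block of the state-sum matrix in which both special circles have colour [true]. Marked
    cobordisms have no entries between different special colours, so passing to this block respects
    composition. *)
Definition matrix_of (S T : finType) (s0 : S) (t0 : T) (f : lin S T)
    (c : {ffun others s0 -> bool}) (d : {ffun others t0 -> bool}) : F :=
  lin_sum h f (lift_colour c) (lift_colour d).

Lemma state_sum_marked (S T : finType) (s0 : S) (t0 : T) (C : cob S T)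
    (x : {ffun S -> bool}) (y : {ffun T -> bool}) :
  marked s0 t0 C -> x s0 != y t0 -> state_sum h C x y = 0.
Proof.
move=> mC xy; rewrite /state_sum /colouring_sum [X in _ * X]big_pred0 ?mulr0 // => col.
apply/negP => /= /forallP cz; case/eqP: xy.
by have /eqP /= <- := cz (inl s0); have /eqP /= <- := cz (inr t0); rewrite mC.
Qed.

Lemma lin_sum_marked (S T : finType) (s0 : S) (t0 : T) (f : lin S T)
    (x : {ffun S -> bool}) (y : {ffun T -> bool}) :
  supported (marked s0 t0) f -> x s0 != y t0 -> lin_sum h f x y = 0.
Proof.
move=> mf xy; rewrite lin_sumE big_seq big1 // => C /mf mC.
by rewrite (state_sum_marked mC xy) mul0rz.
Qed.

Lemma matrix_of_faithful (S T : finType) (s0 : S) (t0 : T) (f g : lin S T) :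
  supported (marked s0 t0) f -> supported (marked s0 t0) g ->
  (forall (c : {ffun others s0 -> bool}) (d : {ffun others t0 -> bool}),
     matrix_of f c d = matrix_of g c d) -> lin_eq f g.
Proof.
move=> mf mg fg; apply: (state_sum_faithful h_transcendental (s0 := s0) (t0 := t0)).
  exact: supportedB.
move=> x y xs yt; rewrite lin_sumB -(lift_colour_onto xs) -(lift_colour_onto yt).
by apply/eqP; rewrite subr_eq0; apply/eqP/fg.
Qed.

Lemma lin_eq_matrix_of (S T : finType) (s0 : S) (t0 : T) (f g : lin S T)
    (c : {ffun others s0 -> bool}) (d : {ffun others t0 -> bool}) :
  lin_eq f g -> matrix_of f c d = matrix_of g c d.
Proof. exact: lin_eq_lin_sum. Qed.

Lemma matrix_of_comp (S T U : finType) (s0 : S) (t0 : T) (u0 : U)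
    (f : lin S T) (g : lin T U) (c : {ffun others s0 -> bool}) (d : {ffun others u0 -> bool}) :
  supported (marked s0 t0) f ->
  matrix_of (lin_comp f g) c d =
  \sum_(e : {ffun others t0 -> bool}) matrix_of f c e * matrix_of g e d.
Proof.
move=> mf; rewrite /matrix_of lin_sum_comp // (bigID (fun y : {ffun T -> bool} => y t0)) /=.
rewrite [X in _ + X]big1 ?addr0 => [|y yt]; first exact: sum_lift_colour.
by rewrite (lin_sum_marked mf) ?mul0r // lift_colour_special (negbTE yt).
Qed.

Lemma matrix_of_id (S : finType) (s0 : S) (c d : {ffun others s0 -> bool}) :
  matrix_of << cob_id S >> c d = (c == d)%:R.
Proof.
rewrite /matrix_of lin_sum_id //; congr (_ %:R); congr nat_of_bool.
apply/eqP/eqP => [|-> //] /ffunP cd; apply/ffunP => s.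
by rewrite -!lift_colour_val cd.
Qed.

Lemma matrix_of_sum (S T : finType) (s0 : S) (t0 : T) (I : Type) (r : seq I) (P : pred I)
    (f : I -> lin S T) (c : {ffun others s0 -> bool}) (d : {ffun others t0 -> bool}) :
  matrix_of (\sum_(i <- r | P i) f i) c d = \sum_(i <- r | P i) matrix_of (f i) c d.
Proof. exact: lin_sum_sum. Qed.

Lemma matrix_of0 (S T : finType) (s0 : S) (t0 : T)
    (c : {ffun others s0 -> bool}) (d : {ffun others t0 -> bool}) :
  matrix_of (0 : lin S T) c d = 0.
Proof. exact: lin_sum0. Qed.

End Matrices.

(** * Delooping *)

Lemma supportedU_neq0 (S T : finType) (P : cob S T -> Prop) c (C : cob S T) :
  (c != 0 -> P C) -> supported P << c *g C >>.
Proof.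
move=> PC; have [->|/PC] := eqVneq c 0; first by rewrite freegU0; apply: supported0.
exact: supportedU.
Qed.

Lemma prod_ffun_eq (R : comNzRingType) (I : finType) (a b : {ffun I -> bool}) :
  \prod_i (a i == b i)%:R = (a == b)%:R :> R.
Proof.
have [->|/eqP ab] := eqVneq a b; first by rewrite big1 // => i _; rewrite eqxx.
have [/forallP abE|] := boolP [forall i, a i == b i].
  by case: ab; apply/ffunP => i; apply/eqP.
by rewrite negb_forall => /existsP[i /negbTE abi]; rewrite (bigD1 i) //= abi mul0r.
Qed.

Lemma normal_marked (S T : finType) (s0 : S) (t0 : T) (D : {set S + T}) k :
  inl s0 \in D -> inr t0 \in D -> marked s0 t0 (normal_cob D k).
Proof. by move=> Ds Dt; rewrite /marked !ffunE !insubN // negbK. Qed.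

Lemma euler_char_normal (S T : finType) (D : {set S + T}) k :
  euler_char (normal_cob D k) =
  2 - 2 * k%:Z + 2 * (\sum_v (v \notin D))%N%:Z - (#|S| + #|T|)%:Z.
Proof.
rewrite (euler_char_glued (cob_of_glued _ _)) muln0 subr0; congr (_ - _).
rewrite (bigD1 None) //=; congr (_ + _).
rewrite (reindex_omap Some id) => [|[]] //=.
rewrite (eq_bigl predT) => [|v]; last by rewrite /= eqxx.
rewrite (eq_bigr (fun=> 2)) // sumr_const card_sig -sum1_card.
rewrite -[in RHS](big_mkcond (fun v => v \notin D) (fun=> 1%N)).
by rewrite -[LHS]mulr_natr [X in _ * X]natz; congr (_ * Posz _).
Qed.

Section Deloop.
Variables (S : finType) (s0 : S).
Local Notation colours := {ffun others s0 -> bool}.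

Definition cap_set (D : colours) : {set S + special_circle} :=
  [set v | boundary_colour (lift_colour D) (fun=> true) v].

Definition cup_set (D : colours) : {set special_circle + S} :=
  [set v | boundary_colour (fun=> true) (lift_colour D) v].

(* The inclusions and projections of Bar-Natan's delooping: the circle [s] is
capped by the dotted disk minus [H] times the disk if [E s], by the disk
otherwise, a dot being a tube to the special component. *)
Definition cap_coeff (E D : colours) : int :=
  \prod_s (if E s then (if D s then 1 else -1) else (~~ D s)%:R).
Definition cap_genus (E D : colours) : nat := (\sum_s (E s && ~~ D s))%N.

Definition cap (E : colours) : lin S special_circle :=
  \sum_D << cap_coeff E D *g normal_cob (cap_set D) (cap_genus E D) >>.

(** Dual to [cap]: a plain disk if [E s] and a dotted one otherwise. A dot squared is H times a dot,
    so a dotted disk pairs to 0 with the dotted disk minus H times the disk, while the plain disk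
    pairs to 1 with it. *)
Definition cup (E : colours) : lin special_circle S :=
  << normal_cob (cup_set [ffun s => ~~ E s]) 0 >>.

Lemma card_others : #|S| = #|others s0|.+1.
Proof. by rewrite -sum1_card (big_special s0) /= sum1_card. Qed.

Definition deloop_degree (E : colours) : int :=
  #|others s0|%:Z - 2 * (\sum_s E s)%N%:Z.

Lemma sum_compl (E : colours) : (\sum_s E s + \sum_s ~~ E s)%N = #|others s0|.
Proof. by rewrite -big_split -sum1_card; apply: eq_bigr => s _; case: (E s). Qed.

Lemma cap_homogeneous (E : colours) :
  supported (homogeneous s0 (tt : special_circle) (deloop_degree E)) (cap E).
Proof.
apply: supported_sum => D _; apply: supportedU_neq0 => coeff0; split.
  by apply: normal_marked; rewrite inE //= lift_colour_special.
(* Terms violating this have coefficient 0. In the others, each disk replacing a dotted one comes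
   with a handle on the special component, so all have the same Euler characteristic. *)
have ED s : D s -> E s.
  apply: contraTT => nEs; apply/negP => Ds; case/eqP: coeff0.
  by rewrite /cap_coeff (bigD1 s) //= (negbTE nEs) Ds mul0r.
rewrite euler_char_normal card_others card_unit big_sumType /=.
rewrite [X in (_ + X)%N]big1 => [|[] _]; last by rewrite inE.
rewrite (big_special s0) /= inE /= lift_colour_special add0n addn0.
rewrite (eq_bigr (fun s => (E s && ~~ D s) + ~~ E s)%N) => [|s _]; last first.
  by rewrite inE /= lift_colour_val; move: (ED s); case: (D s); case: (E s) => // /(_ isT).
rewrite big_split /= -/(cap_genus E D) /deloop_degree -(sum_compl E).
by move: (cap_genus E D) (\sum_s E s)%N (\sum_s ~~ E s)%N => a b c; lia.
Qed.

Lemma cup_homogeneous (E : colours) :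
  supported (homogeneous (tt : special_circle) s0 (- deloop_degree E)) (cup E).
Proof.
apply: supportedU; split.
  by apply: normal_marked; rewrite inE //= lift_colour_special.
rewrite euler_char_normal card_others card_unit big_sumType /=.
rewrite [X in (X + _)%N]big1 => [|[] _]; last by rewrite inE.
rewrite (big_special s0) /= inE /= lift_colour_special !add0n.
rewrite (eq_bigr (fun s => E s : nat)) => [|s _]; last first.
  by rewrite inE /= lift_colour_val ffunE negbK.
rewrite /deloop_degree -(sum_compl E).
by move: (\sum_s E s)%N (\sum_s ~~ E s)%N => a b; lia.
Qed.

End Deloop.

Section DeloopMatrices.
Variables (F : fieldType) (h : F).
Hypothesis h_transcendental : forall p : {poly int}, (map_poly intr p).[h] = 0 -> p = 0.
Variables (S : finType) (s0 : S).
Local Notation colours := {ffun others s0 -> bool}.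
Local Notation pt := {ffun others (tt : special_circle) -> bool}.

Let h_neq0 := transcendental_neq0 h_transcendental.

Lemma matrix_of_cap_set (D c : colours) (d : pt) k :
  matrix_of h << normal_cob (cap_set D) k >> c d =
  h ^+ k * \prod_s (if D s then (c s)%:R else (handle h (c s))^-1).
Proof.
rewrite /matrix_of lin_sum1 (state_sum_normal h_transcendental (v0 := inl s0)).
- rewrite (bigD1 tt) //= big1 => [|[]] //; rewrite lift_colour_special mulr1.
  have -> a : handle h true * (h ^ (k%:Z - 1) * a) = h ^+ k * a.
    by rewrite mulrA -[handle h true](expr1z h) -expfzDr // addrC subrK.
  congr (_ * _).
  rewrite /normal_weight big_sumType /= [X in _ * X]big1 ?mulr1 => [|[] _]; last first.
    by rewrite inE /= (lift_colour_special d).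
  rewrite (big_special s0) /= inE /= !lift_colour_special mul1r.
  by apply: eq_bigr => s _; rewrite inE /= !lift_colour_val.
- by rewrite inE /= lift_colour_special.
- by rewrite /= lift_colour_special.
Qed.

Lemma matrix_of_cup_set (D c : colours) (d : pt) :
  matrix_of h << normal_cob (cup_set D) 0 >> d c =
  \prod_s (if D s then h * (c s)%:R else 1).
Proof.
rewrite /matrix_of lin_sum1 (state_sum_normal h_transcendental (v0 := inl tt)).
- rewrite (big_special s0) /= lift_colour_special /= sub0r exprN1 mulrCA -mulrA mulrA.
  rewrite mulrA mulVf // mul1r.
  rewrite /normal_weight big_sumType /= [X in _ * (X * _)]big1 => [|[] _]; last first.
    by rewrite inE /= (lift_colour_special d).
  rewrite mul1r (big_special s0) /= inE /= !lift_colour_special mul1r -big_split /=.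
  apply: eq_bigr => s _; rewrite inE /= !lift_colour_val.
  case: (D s); last by rewrite divff // handle_neq0.
  by case: (c s); rewrite //= !mulr0.
- by rewrite inE.
- by rewrite /= (lift_colour_special d).
Qed.

(** The sum over [D] is an expanded product over the circles. In one factor, the dotted disk minus H
    times the disk is (1, 0) - (1, -1), the indicator of the colour [false]. *)
Lemma matrix_of_cap (E c : colours) (d : pt) :
  matrix_of h (cap E) c d = \prod_s (if E s then (~~ c s)%:R else (handle h (c s))^-1).
Proof.
rewrite matrix_of_sum.
rewrite (eq_bigr (fun D : colours => \prod_s
  ((if E s then (if D s then 1 else -1) else (~~ D s)%:R) * h ^+ (E s && ~~ D s) *
   (if D s then (c s)%:R else (handle h (c s))^-1)))) => [|D _]; last first.
  have -> : matrix_of h << cap_coeff E D *g normal_cob (cap_set D) (cap_genus E D) >> c d =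
      matrix_of h << normal_cob (cap_set D) (cap_genus E D) >> c d *~ cap_coeff E D.
    by rewrite /matrix_of lin_sumU lin_sum1.
  rewrite matrix_of_cap_set -mulrzl mulrA !big_split /=; congr (_ * _ * _).
    rewrite /cap_coeff (big_morph intr (intrM _) (erefl _)); apply: eq_bigr => s _.
    by case: (E s); case: (D s).
  by rewrite /cap_genus (big_morph (fun n => h ^+ n) (exprD h) (erefl _)).
rewrite -(bigA_distr_bigA (fun s e =>
  ((if E s then (if e then 1 else -1) else (~~ e)%:R) * h ^+ (E s && ~~ e) *
   (if e then (c s)%:R else (handle h (c s))^-1)))).
apply: eq_bigr => s _; rewrite big_bool /= andbF andbT expr0.
case: (E s) => /=; last by rewrite !mul0r add0r expr0 !mul1r.
rewrite expr1 !mul1r mulN1r; case: (c s) => /=.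
  by rewrite mulNr divff // subrr.
by rewrite add0r divff // oppr_eq0.
Qed.

Lemma matrix_of_cup (E c : colours) (d : pt) :
  matrix_of h (cup E) d c = \prod_s (if E s then 1 else h * (c s)%:R).
Proof.
rewrite matrix_of_cup_set; apply: eq_bigr => s _; rewrite ffunE.
by case: (E s).
Qed.

(** Both matrices are tensor products over the circles, and for one circle they are 2 by 2 matrices
    inverse to each other; [cup_cap] is the product in the other order. *)
Lemma cap_cup (c c' : colours) (d d' : pt) :
  \sum_(E : colours) matrix_of h (cap E) c d * matrix_of h (cup E) d' c' = (c == c')%:R.
Proof.
under eq_bigr do rewrite matrix_of_cap matrix_of_cup -big_split /=.
rewrite -(bigA_distr_bigA (fun s e =>
  (if e then (~~ c s)%:R else (handle h (c s))^-1) * (if e then 1 else h * (c' s)%:R))).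
rewrite -prod_ffun_eq; apply: eq_bigr => s _; rewrite big_bool /= mulr1 mulrA.
case: (c s) (c' s) => [] [] /=; rewrite ?mulr1 ?mulr0 ?addr0 ?add0r ?invrN ?mulNr ?mulVf //.
by rewrite subrr.
Qed.

Lemma cup_cap (E E' : colours) (d d' : pt) :
  \sum_(c : colours) matrix_of h (cup E) d c * matrix_of (s0 := s0) h (cap E') c d' = (E == E')%:R.
Proof.
under eq_bigr do rewrite matrix_of_cap matrix_of_cup -big_split /=.
rewrite -(bigA_distr_bigA (fun s (e : bool) => (if E s then 1 else h * e%:R) *
  (if E' s then (~~ e)%:R else (handle h e)^-1))).
rewrite -prod_ffun_eq; apply: eq_bigr => s _; rewrite big_bool /=.
case: (E s) (E' s) => [] [] /=;
  rewrite ?mulr1 ?mul1r ?mulr0 ?mul0r ?addr0 ?add0r ?invrN ?subrr ?divff //.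
Qed.

End DeloopMatrices.

Lemma untag_Tagged (I : eqType) (T_ : I -> Type) (R : Type) (idx : R) (i : I)
    (phi : T_ i -> R) (x : T_ i) : untag idx phi (Tagged T_ x) = phi x.
Proof. by rewrite (untagE idx phi (u := Tagged T_ x) erefl). Qed.

Lemma big_tagged (I : finType) (T_ : I -> finType) (V : nmodType)
    (phi : {i : I & T_ i} -> V) :
  \sum_p phi p = \sum_i \sum_(x : T_ i) phi (Tagged T_ x).
Proof. by rewrite sig_big_dep /=; apply: eq_bigr => -[]. Qed.

Lemma mor_id_diag (X : matobj) (i : idx X) : mor_id X i i = << cob_id (circles i) >>.
Proof. by rewrite /mor_id; case: eqP => // e; rewrite (eq_irrelevance e erefl). Qed.

Lemma mor_id_neq (X : matobj) (i j : idx X) : i != j -> mor_id X i j = 0.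
Proof. by rewrite /mor_id; case: eqP. Qed.

Lemma mor_deg0_supported (X Y : matobj) (f : mor X Y) :
  (forall i j, supported (fun C => euler_char C + shift j - shift i = 0) (f i j)) ->
  mor_deg0 f.
Proof. by move=> fP i j; exists (f i j); [exact: lin_eq_refl|exact: fP]. Qed.

(** * Transport of a complex along the delooping isomorphisms *)

Section Complexes.
Variables (F : fieldType) (h : F).
Hypothesis h_transcendental : forall p : {poly int}, (map_poly intr p).[h] = 0 -> p = 0.

Let h_neq0 := transcendental_neq0 h_transcendental.
Local Notation M := (matrix_of h).
Local Notation pt := {ffun others (tt : special_circle) -> bool}.

(** A normal form has one component besides its disks, and here there is no boundary circle left to
    bound a disk. *)
Lemma connected_form (m : int) (f : lin special_circle special_circle) :
  supported (homogeneous tt tt m) f ->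
  exists2 g, lin_eq f g & supported (fun C => connected C /\ homogeneous tt tt m C) g.
Proof.
move: f; apply: supported_ind.
  by exists 0; [exact: lin_eq_refl|exact: supported0].
move=> c C f [mC eC] [g fg Pg].
have [k Ck Pk] := marked_reducible mC.
exists (c *: k + g).
  apply: lin_eq_add => //.
  by rewrite /lin_eq freegZ -scalerBr; apply: null_scale.
apply: supportedD => //; apply: supportedZ => C' /Pk[eC' [D [n [defC' D0 D1]]]].
split; last first.
  by split; [rewrite defC'; apply: normal_marked|rewrite eC'].
rewrite defC' /connected /= card_option card_sig eq_card0 // => -[[]|[]];
  by rewrite !inE ?D0 ?D1.
Qed.

Definition pt0 : {ffun others (tt : special_circle) -> bool} := [ffun=> true].

Lemma pt_unique (c : {ffun others (tt : special_circle) -> bool}) : c = pt0.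
Proof. by apply/ffunP => -[[]]. Qed.

Lemma matrix_of_comp_special (S U : finType) (s0 : S) (u0 : U) (f : lin S special_circle)
    (g : lin special_circle U) (c : {ffun others s0 -> bool}) (d : {ffun others u0 -> bool}) :
  supported (marked s0 tt) f -> M (lin_comp f g) c d = M f c pt0 * M g pt0 d.
Proof.
move=> mf; rewrite (matrix_of_comp h_transcendental _ _ _ mf).
by rewrite (bigD1 pt0) //= big1 ?addr0 // => e /eqP[]; apply: pt_unique.
Qed.

Variables (A : precomplex) (sp : forall r (i : idx (obj A r)), circles i).
Hypothesis complexA : is_complex A.
Hypothesis diff_homogeneous : forall r i j,
  supported (homogeneous (sp i) (sp j) (shift i - shift j)) (diff A r i j).

Definition deloop_idx r : finType :=
  {i : idx (obj A r) & {ffun others (sp i) -> bool}}.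

Definition deloop_tag r (i : idx (obj A r)) (E : {ffun others (sp i) -> bool}) :
  deloop_idx r := Tagged (fun i => {ffun others (sp i) -> bool}) E.

Definition deloop_shift r (j : deloop_idx r) : int :=
  shift (tag j) - deloop_degree (tagged j).

Local Notation B := (fun r => special_sum (@deloop_shift r)).

(** Block diagonal: [untag] falls back on 0 when the summand [j] does not come from [i]. *)
Definition deloop_to r : mor (obj A r) (B r) :=
  fun i j => untag (0 : lin (circles i) special_circle) (@cap _ (sp i)) j.

Definition deloop_from r : mor (B r) (obj A r) :=
  fun j i => untag (0 : lin special_circle (circles i)) (@cup _ (sp i)) j.

(** The transported differential before reduction: its terms join the two special circles but may
    have further, closed components. *)
Definition raw_diff r (j : deloop_idx r) (l : deloop_idx (r + 1)) :
    lin special_circle special_circle :=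
  lin_comp (lin_comp (cup (tagged j)) (diff A r (tag j) (tag l))) (cap (tagged l)).

Lemma raw_diff_homogeneous r (j : deloop_idx r) l :
  supported (homogeneous tt tt (deloop_shift j - deloop_shift l)) (raw_diff j l).
Proof.
have -> : deloop_shift j - deloop_shift l = - deloop_degree (tagged j) +
    (shift (tag j) - shift (tag l)) + deloop_degree (tagged l).
  by rewrite /deloop_shift; ring.
apply: homogeneous_comp (homogeneous_comp _ _) _.
- exact: cup_homogeneous.
- exact: diff_homogeneous.
- exact: cap_homogeneous.
Qed.

Lemma to_comp r (U : finType) (phi : deloop_idx r -> lin special_circle U) (i : idx (obj A r)) :
  \sum_j lin_comp (deloop_to i j) (phi j) =
  \sum_E lin_comp (cap E) (phi (deloop_tag E)).
Proof.
rewrite big_tagged (bigD1 i) //= [X in _ + X]big1 ?addr0 => [|k ki]; last first.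
  by rewrite big1 // => E _; rewrite /deloop_to untag_dflt // lin_comp0l.
by apply: eq_bigr => E _; rewrite /deloop_to untag_Tagged.
Qed.

Lemma comp_from r (U : finType) (phi : deloop_idx r -> lin U special_circle) (i : idx (obj A r)) :
  \sum_j lin_comp (phi j) (deloop_from j i) =
  \sum_E lin_comp (phi (deloop_tag E)) (cup E).
Proof.
rewrite big_tagged (bigD1 i) //= [X in _ + X]big1 ?addr0 => [|k ki]; last first.
  by rewrite big1 // => E _; rewrite /deloop_from untag_dflt // lin_comp0r.
by apply: eq_bigr => E _; rewrite /deloop_from untag_Tagged.
Qed.

Lemma comp_to r (U : finType) (phi : forall i : idx (obj A r), lin U (circles i))
    (j : deloop_idx r) :
  \sum_i lin_comp (phi i) (deloop_to i j) = lin_comp (phi (tag j)) (cap (tagged j)).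
Proof.
rewrite (bigD1 (tag j)) //= big1 ?addr0 => [|k kj]; last first.
  by rewrite /deloop_to untag_dflt 1?eq_sym // lin_comp0r.
by case: j => i E; rewrite /deloop_to untag_Tagged.
Qed.

Lemma from_comp r (U : finType) (phi : forall i : idx (obj A r), lin (circles i) U)
    (j : deloop_idx r) :
  \sum_i lin_comp (deloop_from j i) (phi i) = lin_comp (cup (tagged j)) (phi (tag j)).
Proof.
rewrite (bigD1 (tag j)) //= big1 ?addr0 => [|k kj]; last first.
  by rewrite /deloop_from untag_dflt 1?eq_sym // lin_comp0l.
by case: j => i E; rewrite /deloop_from untag_Tagged.
Qed.

Lemma cap_marked (S : finType) (s0 : S) (E : {ffun others s0 -> bool}) :
  supported (marked s0 (tt : special_circle)) (cap E).
Proof. by move=> C /cap_homogeneous[]. Qed.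

Lemma cup_marked (S : finType) (s0 : S) (E : {ffun others s0 -> bool}) :
  supported (marked (tt : special_circle) s0) (cup E).
Proof. by move=> C /cup_homogeneous[]. Qed.

Lemma diff_marked r i j : supported (marked (sp i) (sp j)) (diff A r i j).
Proof. by move=> C /diff_homogeneous[]. Qed.

Lemma marked_comp (S T U : finType) (s0 : S) (t0 : T) (u0 : U)
    (f : lin S T) (g : lin T U) :
  supported (marked s0 t0) f -> supported (marked t0 u0) g ->
  supported (marked s0 u0) (lin_comp f g).
Proof. by apply: supported_comp => C C'; apply: cob_comp_marked. Qed.

Lemma to_from r : mor_eq (mor_comp (@deloop_to r) (@deloop_from r)) (mor_id _).
Proof.
move=> i i'; rewrite /mor_comp to_comp.
have [<-|ii'] := eqVneq i i'; last first.
  rewrite mor_id_neq // big1; first exact: lin_eq_refl.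
  by move=> E _; rewrite /deloop_from untag_dflt // lin_comp0r.
rewrite mor_id_diag.
rewrite (eq_bigr (fun E => lin_comp (cap E) (cup E))) => [|E _]; last first.
  by rewrite /deloop_from untag_Tagged.
apply: (matrix_of_faithful h_transcendental (s0 := sp i) (t0 := sp i)).
- by apply: supported_sum => E _; apply: marked_comp; [exact: cap_marked|exact: cup_marked].
- by apply: supportedU; apply: cob_id_marked.
move=> c d; rewrite matrix_of_id // matrix_of_sum -(cap_cup h_transcendental c d pt0 pt0).
by apply: eq_bigr => E _; rewrite matrix_of_comp_special //; apply: cap_marked.
Qed.

Lemma from_to r : mor_eq (mor_comp (@deloop_from r) (@deloop_to r)) (mor_id (B r)).
Proof.
move=> [i E] [i' E']; rewrite /mor_comp from_comp /=.
have [ii'|ii'] := eqVneq i' i; last first.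
  rewrite mor_id_neq; last first.
    by apply: contraNneq ii' => /(congr1 tag) /= ->.
  by rewrite /deloop_to untag_dflt // lin_comp0r; apply: lin_eq_refl.
case: _ / ii' in E *.
rewrite -/(deloop_tag E) -/(deloop_tag E').
have -> : deloop_to i' (deloop_tag E') = cap E' by exact: untag_Tagged.
have [{E'}<-|EE'] := eqVneq E E'; last first.
  rewrite mor_id_neq; last first.
    by apply: contraNneq EE' => /eqP; rewrite eq_Tagged => /eqP /= ->.
  apply: (matrix_of_faithful h_transcendental (s0 := tt) (t0 := tt)).
  - by apply: marked_comp; [exact: cup_marked|exact: cap_marked].
  - exact: supported0.
  move=> c d; rewrite (matrix_of_comp h_transcendental _ _ _ (@cup_marked _ _ E)).
  by rewrite cup_cap // (negbTE EE') matrix_of0.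
rewrite mor_id_diag; apply: (matrix_of_faithful h_transcendental (s0 := tt) (t0 := tt)).
- by apply: marked_comp; [exact: cup_marked|exact: cap_marked].
- by apply: supportedU; apply: cob_id_marked.
move=> c d; rewrite (matrix_of_comp h_transcendental _ _ _ (@cup_marked _ _ E)).
by rewrite cup_cap // matrix_of_id // (pt_unique c) (pt_unique d) !eqxx.
Qed.

Lemma matrix_of_raw_diff r (j : deloop_idx r) l
    (c d : {ffun others (tt : special_circle) -> bool}) :
  M (raw_diff j l) c d = \sum_(b : {ffun others (sp (tag l)) -> bool})
    M (lin_comp (cup (tagged j)) (diff A r (tag j) (tag l))) c b * M (cap (tagged l)) b d.
Proof.
apply: matrix_of_comp => //.
by apply: marked_comp; [exact: cup_marked|exact: diff_marked].
Qed.

(** The other bracketing of the triple composite; reassociation is carried out on matrix entries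
    instead of glued surfaces. *)
Lemma matrix_of_raw_diff_left r (j : deloop_idx r) l
    (c d : {ffun others (tt : special_circle) -> bool}) :
  M (raw_diff j l) c d = \sum_(a : {ffun others (sp (tag j)) -> bool})
    M (cup (tagged j)) c a * M (lin_comp (diff A r (tag j) (tag l)) (cap (tagged l))) a d.
Proof.
rewrite matrix_of_raw_diff.
under eq_bigr => b _.
  rewrite (matrix_of_comp h_transcendental (t0 := sp (tag j))); last exact: cup_marked.
  rewrite mulr_suml; over.
rewrite exchange_big; apply: eq_bigr => a _ /=.
rewrite (matrix_of_comp h_transcendental (t0 := sp (tag l))); last exact: diff_marked.
by rewrite mulr_sumr; apply: eq_bigr => b _; rewrite mulrA.
Qed.

Lemma cap_cup_left (S : finType) (s0 : S) (phi : {ffun others s0 -> bool} -> F)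
    (c : {ffun others s0 -> bool}) (p p' : pt) :
  \sum_(E : {ffun others s0 -> bool})
    M (cap E) c p * (\sum_(a : {ffun others s0 -> bool}) M (cup E) p' a * phi a) = phi c.
Proof.
under eq_bigr do rewrite mulr_sumr; rewrite exchange_big (bigD1 c) //=.
rewrite [X in _ + X]big1 => [|a ac].
  under eq_bigr do rewrite mulrA.
  by rewrite -mulr_suml cap_cup // eqxx mul1r addr0.
under eq_bigr do rewrite mulrA.
by rewrite -mulr_suml cap_cup // eq_sym (negbTE ac) mul0r.
Qed.

Lemma cap_cup_right (S : finType) (s0 : S) (phi : {ffun others s0 -> bool} -> F)
    (d : {ffun others s0 -> bool}) (p p' : pt) :
  \sum_(E : {ffun others s0 -> bool})
    (\sum_(a : {ffun others s0 -> bool}) phi a * M (cap E) a p) * M (cup E) p' d = phi d.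
Proof.
under eq_bigr do rewrite mulr_suml; rewrite exchange_big (bigD1 d) //=.
rewrite [X in _ + X]big1 => [|a ad].
  under eq_bigr do rewrite -mulrA.
  by rewrite -mulr_sumr cap_cup // eqxx mulr1 addr0.
under eq_bigr do rewrite -mulrA.
by rewrite -mulr_sumr cap_cup // (negbTE ad) mulr0.
Qed.

Lemma diff_diff r i m (a : {ffun others (sp i) -> bool}) (b : {ffun others (sp m) -> bool}) :
  \sum_k \sum_(e : {ffun others (sp k) -> bool})
    M (diff A r i k) a e * M (diff A (r + 1) k m) e b = 0.
Proof.
have [_ _ dd] := complexA.
have := lin_eq_matrix_of h_transcendental a b (dd r i m).
rewrite matrix_of0 /mor_comp matrix_of_sum => /(etrans _); apply; apply: eq_bigr => k _.
by rewrite (matrix_of_comp h_transcendental (t0 := sp k)) //; apply: diff_marked.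
Qed.

(** In the middle, the sum over [E] of a cap followed by a cup is the identity matrix. The delooping
    of the intermediate object thus cancels, leaving the square of the differential of [A] between
    the outer maps. *)
Lemma raw_diff_diff r (j : deloop_idx r) (m : deloop_idx (r + 1 + 1)) (c e : pt) :
  \sum_l M (raw_diff j l) c pt0 * M (raw_diff l m) pt0 e = 0.
Proof.
rewrite big_tagged.
pose psi k (a : {ffun others (sp k) -> bool}) :=
  M (lin_comp (diff A (r + 1) k (tag m)) (cap (tagged m))) a e.
have -> : \sum_k \sum_(E : {ffun others (sp k) -> bool})
    M (raw_diff j (deloop_tag E)) c pt0 * M (raw_diff (deloop_tag E) m) pt0 e =
  \sum_k \sum_a M (lin_comp (cup (tagged j)) (diff A r (tag j) k)) c a * psi k a.
  apply: eq_bigr => k _.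
  have step (E : {ffun others (sp k) -> bool}) :
      M (raw_diff j (deloop_tag E)) c pt0 * M (raw_diff (deloop_tag E) m) pt0 e =
      \sum_(a : {ffun others (sp k) -> bool})
        (\sum_(b : {ffun others (sp k) -> bool})
           M (lin_comp (cup (tagged j)) (diff A r (tag j) k)) c b * M (cap E) b pt0) *
        (M (cup E) pt0 a * psi k a).
    by rewrite matrix_of_raw_diff matrix_of_raw_diff_left mulr_sumr.
  rewrite (eq_bigr _ (fun E _ => step E)) exchange_big; apply: eq_bigr => a _ /=.
  under eq_bigr do rewrite mulrA.
  by rewrite -mulr_suml cap_cup_right.
pose C (a : {ffun others (sp (tag j)) -> bool}) := M (cup (tagged j)) c a.
have -> : \sum_k \sum_a M (lin_comp (cup (tagged j)) (diff A r (tag j) k)) c a * psi k a =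
   \sum_k \sum_a \sum_(b : {ffun others (sp k) -> bool})
     \sum_(f : {ffun others (sp (tag m)) -> bool}) C a * (M (diff A r (tag j) k) a b *
       M (diff A (r + 1) k (tag m)) b f) * M (cap (tagged m)) f e.
  apply: eq_bigr => k _.
  under eq_bigr => b _.
    rewrite (matrix_of_comp h_transcendental (t0 := sp (tag j))); last exact: cup_marked.
    rewrite /psi (matrix_of_comp h_transcendental (t0 := sp (tag m))); last exact: diff_marked.
    rewrite mulr_suml; under eq_bigr do rewrite mulr_sumr.
    over.
  rewrite exchange_big; apply: eq_bigr => a _; apply: eq_bigr => b _; apply: eq_bigr => f _.
  by rewrite /C !mulrA.
rewrite exchange_big big1 // => a _; under eq_bigr do rewrite exchange_big /=.
rewrite exchange_big big1 // => f _.
under eq_bigr do rewrite -mulr_suml -mulr_sumr.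
by rewrite -mulr_suml -mulr_sumr diff_diff mulr0 mul0r.
Qed.

Lemma deloop_complex :
  exists (I : int -> finType) (s : forall r, I r -> int)
         (d : forall r, mor (special_sum (s r)) (special_sum (s (r + 1)))),
    (forall r i j, connected_lin (d r i j)) /\ kom_iso A (PreComplex d).
Proof.
(* The differential must be a function, so connected representatives have to be chosen. [xchoose]
   asks for a boolean property: [lin_eq] is replaced by equality of state sums at the only relevant
   colouring, which by faithfulness amounts to the same. *)
have diffE r (j : deloop_idx r) (l : deloop_idx (r + 1)) :
    exists g : lin special_circle special_circle,
    (lin_sum h g [ffun=> true] [ffun=> true] ==
       lin_sum h (raw_diff j l) [ffun=> true] [ffun=> true]) &&
    all (fun C => [&& connected C, bdry C (inl tt) == bdry C (inr tt) &
           euler_char C == deloop_shift j - deloop_shift l]) (dom g).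
  have [g fg Pg] := connected_form (@raw_diff_homogeneous r j l).
  exists g; rewrite (lin_eq_lin_sum h_neq0 _ _ fg) eqxx; apply/allP => C /Pg[-> [+ ->]].
  by rewrite /marked => ->; rewrite !eqxx.
pose d r : mor (B r) (B (r + 1)) := fun j l => xchoose (diffE r j l).
have dP r j l C : C \in dom (d r j l) ->
    [&& connected C, bdry C (inl tt) == bdry C (inr tt) &
       euler_char C == deloop_shift j - deloop_shift l].
  by have /andP[_ /allP dP] := xchooseP (diffE r j l); apply: dP.
have d_marked r j l : supported (marked tt tt) (d r j l).
  by move=> C /dP /and3P[_ /eqP mC _].
have dM r (j : deloop_idx r) (l : deloop_idx (r + 1)) (c e : pt) :
    M (d r j l) c e = M (raw_diff j l) c e.
  have /andP[/eqP dE _] := xchooseP (diffE r j l).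
  have liftE c' : lift_colour (c' : {ffun others (tt : special_circle) -> bool}) = [ffun=> true].
    by apply/ffunP => -[]; rewrite !ffunE; case: insub => // -[[]].
  by rewrite /matrix_of !liftE.
have d_conn r j l : connected_lin (d r j l).
  by exists (d r j l) => [|C /dP /and3P[]]; first exact: lin_eq_refl.
exists deloop_idx, deloop_shift, d; split=> //.
have chain_to r : mor_eq (mor_comp (@deloop_to r) (d r))
    (mor_comp (diff A r) (@deloop_to (r + 1))).
  move=> i l; rewrite /mor_comp to_comp comp_to.
  apply: (matrix_of_faithful h_transcendental (s0 := sp i) (t0 := tt)).
  - by apply: supported_sum => E _; apply: marked_comp; [exact: cap_marked|exact: d_marked].
  - by apply: marked_comp; [exact: diff_marked|exact: cap_marked].
  move=> c e; rewrite matrix_of_sum.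
  rewrite -[RHS](cap_cup_left (fun a =>
    M (lin_comp (diff A r i (tag l)) (cap (tagged l))) a e) c pt0 pt0); apply: eq_bigr => E _.
  rewrite matrix_of_comp_special; last exact: cap_marked.
  by rewrite dM matrix_of_raw_diff_left.
have chain_from r : mor_eq (mor_comp (@deloop_from r) (diff A r))
    (mor_comp (d r) (@deloop_from (r + 1))).
  move=> j k; rewrite /mor_comp from_comp comp_from.
  apply: (matrix_of_faithful h_transcendental (s0 := tt) (t0 := sp k)).
  - by apply: marked_comp; [exact: cup_marked|exact: diff_marked].
  - by apply: supported_sum => E _; apply: marked_comp; [exact: d_marked|exact: cup_marked].
  move=> c e; rewrite matrix_of_sum.
  rewrite -[LHS](cap_cup_right (fun a =>
    M (lin_comp (cup (tagged j)) (diff A r (tag j) k)) c a) e pt0 pt0); apply: eq_bigr => E _.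
  rewrite matrix_of_comp_special; last exact: d_marked.
  by rewrite dM matrix_of_raw_diff.
have [[N bound] deg0 dd] := complexA.
(* The zero homotopy is enough: both composites equal the identity already before passing to
   homotopy classes. *)
have homotopic0 (X Y : precomplex) (f g : Defs.family X Y) :
    (forall r, mor_eq (f r) (g r)) -> homotopic f g.
  move=> fg; exists (fun r i j => 0); split=> r i j.
    by exists 0 => [|C]; [exact: lin_eq_refl|rewrite dom0].
  rewrite /mor_add /mor_sub /mor_comp big1 => [|k _]; last exact: lin_comp0l.
  rewrite big1 => [|k _]; last exact: lin_comp0r.
  by rewrite addr0 /lin_eq subr0; apply: fg.
split=> //.
  split.
  - exists N => r /bound A0; apply: eq_card0 => -[i E].
    by have := card0_eq A0 i.
  - move=> r; apply: mor_deg0_supported => j l C /dP/and3P[_ _ /eqP ->] /=.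
    by ring.
  - move=> r j m; apply: (matrix_of_faithful h_transcendental (s0 := tt) (t0 := tt)).
    + by apply: supported_sum => l _; apply: marked_comp; exact: d_marked.
    + exact: supported0.
    move=> c e; rewrite matrix_of0 matrix_of_sum -[RHS](raw_diff_diff j m c e).
    apply: eq_bigr => l _; rewrite matrix_of_comp_special ?dM //.
exists deloop_to, deloop_from; split.
- split=> [r|//]; apply: mor_deg0_supported => i [k E].
  have [ki|ki] := eqVneq k i; last by rewrite /deloop_to untag_dflt // => C; rewrite dom0.
  subst k => C; rewrite /deloop_to (untag_Tagged _ (@cap _ (sp i)) E).
  by move=> /cap_homogeneous[_ ->]; rewrite /= /deloop_shift /=; ring.
- split=> [r|//]; apply: mor_deg0_supported => -[k E] i.
  have [ki|ki] := eqVneq k i; last by rewrite /deloop_from untag_dflt // => C; rewrite dom0.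
  subst k => C; rewrite /deloop_from (untag_Tagged _ (@cup _ (sp i)) E).
  by move=> /cup_homogeneous[_ ->]; rewrite /= /deloop_shift /=; ring.
- by apply: homotopic0 => r; apply: to_from.
- by apply: homotopic0 => r; apply: from_to.
Qed.

End Complexes.

(** * The ring of tubes *)

Section TubeRing.
Variables (F : fieldType) (h : F).
Hypothesis h_transcendental : forall p : {poly int}, (map_poly intr p).[h] = 0 -> p = 0.

Let h_neq0 := transcendental_neq0 h_transcendental.
Local Notation "'[ f ]" := (matrix_of h f pt0 pt0) (at level 0).

Lemma lift_pt0 : lift_colour pt0 = [ffun=> true].
Proof. by apply/ffunP => -[]; rewrite !ffunE; case: insub => // -[[]]. Qed.

Lemma special_faithful (f g : lin special_circle special_circle) :
  supported (marked tt tt) f -> supported (marked tt tt) g -> '[f] = '[g] -> lin_eq f g.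
Proof.
move=> mf mg fg; apply: (matrix_of_faithful h_transcendental mf mg) => c d.
by rewrite (pt_unique c) (pt_unique d).
Qed.

Lemma connected_bdry (S T : finType) (C : cob S T) v w : connected C -> bdry C v = bdry C w.
Proof.
case: C => n b g; rewrite /connected /= => /eqP n1; subst n.
by rewrite [b v]ord1 [b w]ord1.
Qed.

Lemma connected_marked (f : lin special_circle special_circle) :
  supported (fun C => connected C) f -> supported (marked tt tt) f.
Proof. by apply: supported_weaken => C; apply: connected_bdry. Qed.

(** The single component has colour [true] and contributes h to the genus minus 1; the normalising
    factor of the target circle supplies the missing h. *)
Lemma matrix_of_connected (C : cob special_circle special_circle) :
  connected C -> '[<< C >>] = h ^+ genus C (bdry C (inl tt)).
Proof.
move=> cC; rewrite /matrix_of lift_pt0 lin_sum1 /state_sum.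
case: C cC => n b g; rewrite /connected /= => /eqP n1; subst n.
rewrite (big_pred1 tt) => [|[]] //; rewrite ffunE /colouring_sum.
rewrite (big_pred1 [ffun=> true]) => [|col] /=; last first.
  apply/forallP/eqP => [/(_ (inl tt))|-> v].
    rewrite [b _]ord1 /= ffunE => /eqP c0.
    by apply/ffunP => i; rewrite [i]ord1 c0 ffunE.
  by rewrite ffunE; case: v => v; rewrite /= ffunE.
rewrite big_nil mulr1 big_ord1 ffunE [b _]ord1 /handle.
by rewrite -[X in X * _](expr1z h) -expfzDr // addrC subrK.
Qed.

Definition tube_poly (p : {poly int}) : lin special_circle special_circle :=
  \sum_(i < size p) << p`_i *g tube i >>.

Lemma tube_poly_connected p : supported (fun C => connected C) (tube_poly p).
Proof. by apply: supported_sum => i _; apply: supportedU. Qed.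

Lemma tube_poly_marked p : supported (marked tt tt) (tube_poly p).
Proof. exact/connected_marked/tube_poly_connected. Qed.

Lemma matrix_of_scale (S T : finType) (s0 : S) (t0 : T) a (C : cob S T)
    (c : {ffun others s0 -> bool}) (d : {ffun others t0 -> bool}) :
  matrix_of h << a *g C >> c d = a%:~R * matrix_of h << C >> c d.
Proof. by rewrite /matrix_of lin_sumU lin_sum1 mulrzl. Qed.

Lemma matrix_of_tube_poly p : '[tube_poly p] = (map_poly intr p).[h].
Proof.
rewrite matrix_of_sum horner_poly; apply: eq_bigr => i _.
by rewrite matrix_of_scale matrix_of_connected //= ffunE.
Qed.

(** On the endomorphisms of the special circle the matrix is a single scalar, and for [tube_poly p]
    it is the value of [p] at h. Faithfulness turns ring identities into identities of such values,
    and transcendence gives injectivity. *)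
Lemma tube_poly_iso : tube_ring_iso tube_poly.
Proof.
have mid : supported (marked tt tt) << cob_id special_circle >>.
  by apply: supportedU; apply: cob_id_marked.
split; split.
- move=> p q; apply: special_faithful.
  + exact: tube_poly_marked.
  + by apply: supportedD; apply: tube_poly_marked.
  rewrite /matrix_of lin_sumD -!/(matrix_of _ _ _ _) !matrix_of_tube_poly.
  by rewrite rmorphD hornerD.
- move=> p q; apply: special_faithful.
  + exact: tube_poly_marked.
  + by apply: marked_comp; apply: tube_poly_marked.
  rewrite matrix_of_comp_special //; last exact: tube_poly_marked.
  by rewrite !matrix_of_tube_poly rmorphM hornerM.
- apply: special_faithful => //; first exact: tube_poly_marked.
  by rewrite matrix_of_tube_poly matrix_of_id // rmorph1 hornerC eqxx.
- apply: special_faithful; first exact: tube_poly_marked.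
    by apply: connected_marked; apply: supportedU.
  by rewrite matrix_of_tube_poly map_polyX hornerX matrix_of_connected //= ffunE expr1.
- move=> p q /(lin_eq_matrix_of h_transcendental pt0 pt0).
  rewrite !matrix_of_tube_poly => /eqP; rewrite -subr_eq0 -hornerN -hornerD -rmorphB.
  by move/eqP/h_transcendental/eqP; rewrite subr_eq0 => /eqP.
- by move=> p; exists (tube_poly p); [exact: lin_eq_refl|exact: tube_poly_connected].
move=> f [g fg cg].
pose p := \sum_(C <- dom g) coeff C g *: 'X^(genus C (bdry C (inl tt))) : {poly int}.
exists p; apply: lin_eq_trans fg _; apply: special_faithful.
- exact: connected_marked.
- exact: tube_poly_marked.
rewrite matrix_of_tube_poly /matrix_of lin_sumE /p rmorph_sum horner_sum big_seq [RHS]big_seq.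
apply: eq_bigr => C /cg cC; rewrite /= map_polyZ /= map_polyXn hornerZ hornerXn.
by rewrite -(matrix_of_connected cC) /matrix_of lin_sum1 mulrzl.
Qed.

End TubeRing.

(** The field is the fraction field of the integer polynomials and h is the variable, at which
    evaluation is the canonical inclusion. *)
Lemma tofrac_horner (p : {poly int}) :
  (map_poly intr p).[tofrac ('X : {poly int})] = tofrac p.
Proof.
rewrite -[in RHS](coefK p) poly_def horner_poly rmorph_sum; apply: eq_bigr => i _.
rewrite -mul_polyC rmorphM rmorphXn /=; congr (_ * _).
by rewrite -[in RHS](intz p`_i) rmorph_int rmorph_int.
Qed.

Lemma polyX_transcendental (p : {poly int}) :
  (map_poly intr p).[tofrac ('X : {poly int})] = 0 -> p = 0.
Proof. by rewrite tofrac_horner => /eqP; rewrite tofrac_eq0 => /eqP. Qed.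

(** * Checkerboard colourings of planar maps *)

Section CountComponents.
Variable V : finType.
Implicit Types e : rel V.

Lemma card_component e : #|{: component e}| = #|[set [set y | connect e x y] | x in V]|.
Proof. by rewrite card_sig; apply: eq_card. Qed.

Lemma n_comp_component e : connect_sym e -> n_comp e V = #|{: component e}|.
Proof.
move=> sym; have inj : {in predI (roots e) (mem V) &, injective (fun x => [set y | connect e x y])}.
  move=> x y /andP[/eqP rx _] /andP[/eqP ry _] /setP/(_ y); rewrite !inE connect0.
  by move/(fingraph.rootP sym); rewrite rx ry.
rewrite card_component.
transitivity #|[set [set y | connect e x y] | x in predI (roots e) (mem V)]|.
  by rewrite (card_in_imset inj).
apply: eq_card => A; apply/imsetP/imsetP => [[x _ ->]|[x _ ->]]; first by exists x.
exists (fingraph.root e x); first by rewrite inE /= roots_root.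
by apply/setP => y; rewrite !inE (same_connect sym (connect_root e x)).
Qed.

Lemma eq_card_component e e' : connect e =2 connect e' -> #|{: component e}| = #|{: component e'}|.
Proof.
move=> ee; rewrite !card_component; congr #|pred_of_set _|.
by apply: eq_imset => x; apply/setP => y; rewrite !inE ee.
Qed.

Lemma card_component_invariant (J : finType) e (phi : V -> J) :
  connect_sym e -> (forall x y, e x y -> phi x = phi y) ->
  (#|[set phi x | x in V]| <= #|{: component e}|)%N.
Proof.
move=> sym ephi; rewrite -cardsT.
suff -> : [set phi x | x in V] = [set phi (component_repr A) | A in [set: component e]].
  exact: leq_imset_card.
apply/setP => j; apply/imsetP/imsetP => [[x _ ->]|[A _ ->]]; last by exists (component_repr A).
by exists (component_of e x) => //; apply: (connect_const ephi); apply: component_repr_connect.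
Qed.

(** Outside the [e']-component of [x] both relations have the same classes. Inside it the
    [e]-classes are those of [x] and [y], since a path can leave one of them only for the other. *)
Lemma card_component_add_edge e e' x y :
  connect_sym e -> connect_sym e' -> subrel e (connect e') -> connect e' x y ->
  (forall u v, e' u v ->
     [|| connect e u v, connect e u x && connect e y v | connect e u y && connect e x v]) ->
  (#|{: component e'}| + ~~ connect e x y)%N = #|{: component e}|.
Proof.
move=> sym sym' sub xy ee'; rewrite -!n_comp_component //.
have subc : subrel (connect e) (connect e') by apply: connect_sub.
pose a := connect e' x.
have cl' : closed e' a by apply: connect_closed.
have cl : closed e a.
  by move=> u v /sub uv; rewrite !inE; apply: (same_connect_r sym' uv).
rewrite (n_compC a) [in RHS](n_compC a).
have in_a u : u \in a -> connect e x u || connect e y u.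
  rewrite inE => /connectP[p xp ->] {u}; elim/last_ind: p xp => [|p u IH] /=.
    by rewrite connect0.
  rewrite rcons_path last_rcons => /andP[/IH cu /ee'].
  case/or3P => [wu|/andP[_ ->]|/andP[_ ->]]; rewrite ?orbT //.
  case/orP: cu.
  - by move=> xw; rewrite (connect_trans xw wu).
  - by move=> yw; rewrite (connect_trans yw wu) orbT.
have -> : n_comp e' a = 1%N.
  exact: n_comp_connect.
have -> : n_comp e a = (~~ connect e x y).+1.
  rewrite -(n_comp_closure2 sym); apply: eq_n_comp_r => u.
  apply/idP/existsP => [/in_a|[v /andP[/= vu]]].
    case/orP => xu; rewrite sym in xu; [exists x|exists y]; apply/andP; split=> //.
      exact: predU1l.
    exact: predU1r (eqxx y).
  have {}vu : connect e u v by exact: vu.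
  rewrite !inE => /orP[] /eqP ev; subst v; rewrite sym in vu; first exact: subc.
  exact: connect_trans xy (subc _ _ vu).
suff -> : n_comp e [predC a] = n_comp e' [predC a] by rewrite add1n !addSn addnC.
apply: eq_card => u; rewrite !inE; case ua: (~~ _); rewrite ?andbF ?andbT //.
have conE : connect e' u =1 connect e u.
  move=> v; apply/idP/idP; last exact: subc.
  case/connectP => p up ->; elim/last_ind: p up => [|p w IH] /=; first by rewrite connect0.
  rewrite rcons_path last_rcons => /andP[up /ee']; move/IH: (up) => cu.
  have nl : last u p \notin a.
    apply: contra ua; rewrite !inE => xl; apply: connect_trans xl _.
    by rewrite sym'; apply: subc.
  case/or3P => [wu|/andP[lx _]|/andP[ly _]].
  - exact: connect_trans cu wu.
  - by case/negP: nl; apply: subc; rewrite sym.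
  - by case/negP: nl; apply: connect_trans xy _; apply: subc; rewrite sym.
by rewrite /roots /fingraph.root (eq_pick conE).
Qed.

End CountComponents.

(** * Euler's inequality for maps given by permutations *)

Lemma mem_porbit_connect (V : finType) (s : {perm V}) x y :
  (y \in porbit s x) = connect (frel s) x y.
Proof.
apply/porbitP/idP => [[i ->]|xy].
  by rewrite permX; apply: fconnect_iter.
by exists (findex s x y); rewrite permX iter_findex.
Qed.

Lemma frel_perm_sym (V : finType) (s : {perm V}) : connect_sym (frel s).
Proof. by apply: fconnect_sym; apply: perm_inj. Qed.

Lemma card_porbits (V : finType) (s : {perm V}) : #|porbits s| = #|{: component (frel s)}|.
Proof.
rewrite card_component; congr #|pred_of_set _|; apply: eq_imset => x.
by apply/setP => y; rewrite inE mem_porbit_connect.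
Qed.

Definition map_rel (V : finType) (s : {perm V}) (E : seq (V * V)) : rel V :=
  fun x y => [|| s x == y, s y == x | edge_rel E x y].

(* Inserting the edges of [E] one at a time into the map with vertex permutation
[s] merges two faces exactly when it cannot split one. *)
Lemma euler_inequality (V : finType) (s : {perm V}) (E : seq (V * V)) :
  all (fun e => e.1 != e.2) E ->
  (#|porbits s| + #|porbits (foldr (fun e t => tperm e.1 e.2 * t)%g s E)| <=
   2 * #|{: component (map_rel s E)}| + size E)%N.
Proof.
have symr E' : connect_sym (map_rel s E').
  apply: sym_connect_sym => x y; rewrite /map_rel edge_rel_sym.
  by rewrite orbCA.
elim: E => [|[x y] E IH] /=.
  (* Without edges, the vertices, the faces and the components are all the cycles of [s]. *)
  move=> _; suff <- : #|porbits s| = #|{: component (map_rel s [::])}|.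
    by rewrite addn0 mul2n addnn.
  rewrite card_porbits; apply: eq_card_component => x y; apply/idP/idP.
    by apply: connect_sub => u v uv; apply: connect1; rewrite /map_rel (uv : s u == v).
  apply: connect_sub => u v /or3P[uv|uv|] //; first exact: connect1.
  by rewrite frel_perm_sym; apply: connect1.
case/andP => xy /IH {}IH.
set t := foldr _ s E in IH *.
have := porbits_mul_tperm t x y; rewrite xy.
have tr z : connect (map_rel s E) z (t z).
  rewrite /t {IH t xy}; elim: E z => [|[u v] E IH] z /=.
    by apply: connect1; rewrite /map_rel eqxx.
  have sub : subrel (connect (map_rel s E)) (connect (map_rel s ((u, v) :: E))).
    apply: connect_sub => a b ab; apply: connect1; move: ab; rewrite /map_rel /edge_rel /= !inE.
    by case/or4P => ->; rewrite ?orbT.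
  rewrite permM; apply: connect_trans (sub _ _ (IH _)).
  have uv : connect (map_rel s ((u, v) :: E)) u v.
    by apply: connect1; rewrite /map_rel /edge_rel /= mem_head !orbT.
  by case: tpermP => [->|->|_ _] //; rewrite ?connect0 // symr.
(* A face stays inside a component. So an edge between two components merges two faces: faces drop
   by one, twice the components by two, edges rise by one. An edge within a component adds at most
   one face. *)
have nporb : ~~ connect (map_rel s E) x y -> x \notin porbit t y.
  apply: contraNN; rewrite mem_porbit_connect symr.
  by apply: connect_sub => u v /eqP <-.
have : (#|{: component (map_rel s ((x, y) :: E))}| + ~~ connect (map_rel s E) x y)%N =
       #|{: component (map_rel s E)}|.
  apply: card_component_add_edge => //.
  - move=> a b ab; apply: connect1; move: ab; rewrite /map_rel /edge_rel /= !inE.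
    by case/or4P => ->; rewrite ?orbT.
  - by apply: connect1; rewrite /map_rel /edge_rel /= mem_head !orbT.
  move=> a b; rewrite {1}/map_rel /edge_rel /= !inE !xpair_eqE.
  case/or4P => [ab|ab|/orP[/andP[/eqP -> /eqP ->]|ab]|/orP[/andP[/eqP -> /eqP ->]|ab]];
    rewrite ?connect0 ?orbT //;
    apply/orP; left; apply: connect1; by rewrite /map_rel /edge_rel /= ab ?orbT.
move=> cE /= aE; move: IH cE aE nporb.
move: #|porbits _| #|porbits _| #|porbits _| #|{: component _}| #|{: component _}|.
move=> a b c k k' IH cE aE np; case: (connect _ x y) np cE => /= [_|/(_ isT) np] cE.
  by move: aE; case: (x \notin _) => /=; lia.
by move: aE; rewrite np /=; lia.
Qed.

(** The transpositions have disjoint supports, so their product is [al] on the listed points. *)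
Lemma foldr_tpermE (V : finType) (s : {perm V}) (al : V -> V) (t : seq V) z :
  involutive al -> uniq (t ++ map al t) ->
  foldr (fun e u => tperm e.1 e.2 * u)%g s [seq (y, al y) | y <- t] z =
  s (if z \in t ++ map al t then al z else z).
Proof.
move=> alK; elim: t z => [//|x t IH] z /=.
rewrite mem_cat inE negb_or => /andP[/andP[xt xat]].
rewrite cat_uniq /= negb_or => /and4P[ut /andP[axt nh] axat uat].
have ax_x : al x != x.
  by apply: contraNneq xat => e; rewrite e eqxx.
have {}IH := IH _ _; rewrite permM IH; last by rewrite cat_uniq ut nh.
have memE u : (u \in x :: t ++ al x :: map al t) =
    [|| u == x, u \in t, u == al x | u \in map al t].
  by rewrite in_cons mem_cat in_cons.
rewrite memE mem_cat; move: xat; rewrite negb_or => /andP[xax xat].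
case: tpermP => [->|->|/eqP zx /eqP zax].
- by rewrite eqxx (negbTE axt) (negbTE axat).
- by rewrite eqxx /= !orbT alK (negbTE xt) (negbTE xat).
by rewrite (negbTE zx) (negbTE zax).
Qed.

Lemma connect_sym_edges (V : finType) (e : rel V) :
  (forall x y, e x y -> connect e y x) -> connect_sym e.
Proof.
move=> ee; suff sym x y : connect e x y -> connect e y x by move=> x y; apply/idP/idP; apply: sym.
case/connectP => p + ->; elim: p x => [|z p IH] x /=; first by rewrite connect0.
by case/andP => /ee zx /IH pz; apply: connect_trans pz zx.
Qed.

Section Checkerboard.
Variables (n : nat) (arc : half_edge n -> half_edge n).
Hypotheses (arcK : involutive arc) (arc_neq : forall x, arc x != x).
Local Notation X := (half_edge n).
Local Notation Y := (X * bool)%type.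

Lemma rotate4 : forall x : X, rotate (rotate (rotate (rotate x))) = x.
Proof.
case=> i k; rewrite /rotate /=; congr (_, _).
by case: k => [[|[|[|[|]]]] kP] //; apply: val_inj.
Qed.

Lemma odd_rotate (x : X) : odd (rotate x).2 = ~~ odd x.2.
Proof. by case: x => i [[|[|[|[|]]]] kP]. Qed.

Definition flat_rel : rel X := [rel x y | (y == arc x) || (y == rotate x)].

Lemma flat_sym : connect_sym flat_rel.
Proof.
apply: connect_sym_edges => x y /orP[] /eqP ->.
  by apply: connect1; rewrite /flat_rel /= arcK eqxx.
have rot z : connect flat_rel z (rotate z) by apply: connect1; rewrite /flat_rel /= eqxx orbT.
rewrite -[X in connect _ _ X]rotate4.
exact: connect_trans (rot _) (connect_trans (rot _) (rot _)).
Qed.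

(* The parity double cover of the map: a checkerboard colouring is a choice of
sheet over each component, provided that the two sheets are not connected. *)
Let cover_arc (y : Y) : Y := (arc y.1, ~~ y.2).
Let cover_rotate (y : Y) : Y := (rotate y.1, ~~ y.2).

Let cover_arcK : involutive cover_arc.
Proof. by case=> x b; rewrite /cover_arc /= arcK negbK. Qed.

Lemma cover_rotate_inj : injective cover_rotate.
Proof.
move=> [x b] [x' b'] /eqP; rewrite xpair_eqE /= => /andP[/eqP r /eqP/negb_inj ->].
by congr (_, _); rewrite -(rotate4 x) r rotate4.
Qed.

Let sigma : {perm Y} := perm cover_rotate_inj.
Let darts : seq Y := [seq y <- enum {: Y} | enum_rank y < enum_rank (cover_arc y)]%N.
Let edges := [seq (y, cover_arc y) | y <- darts].
Let cover_rel := map_rel sigma edges.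

Let darts_mem y : (y \in darts ++ map cover_arc darts).
Proof.
rewrite mem_cat; have [le|] := boolP (y \in darts); first by apply/orP; left.
rewrite mem_filter mem_enum andbT -leqNgt /= => le.
apply/mapP; exists (cover_arc y); last by rewrite cover_arcK.
rewrite mem_filter mem_enum andbT cover_arcK ltn_neqAle le andbT.
apply/negP => /eqP/val_inj/enum_rank_inj/(congr1 fst) /= /eqP.
by rewrite (negbTE (arc_neq _)).
Qed.

Let darts_uniq : uniq (darts ++ map cover_arc darts).
Proof.
have ud : uniq darts by rewrite filter_uniq // enum_uniq.
rewrite cat_uniq ud (map_inj_uniq (inv_inj cover_arcK)) ud andbT /=.
apply/hasPn => y /mapP[z]; rewrite !mem_filter => /andP[zP _] ->.
by rewrite cover_arcK negb_and -leqNgt ltnW.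
Qed.

Let edge_perm := foldr (fun e u => tperm e.1 e.2 * u)%g sigma edges.

(** Both the arc and the rotation change the sheet, so the face permutation preserves it. *)
Let edge_permE y : edge_perm y = (rotate (arc y.1), y.2).
Proof.
rewrite /edge_perm (foldr_tpermE sigma y cover_arcK darts_uniq) darts_mem permE.
by rewrite /cover_rotate /cover_arc /= negbK.
Qed.

Let size_edges : (size edges).*2 = (8 * n)%N.
Proof.
rewrite size_map -addnn -{2}(size_map cover_arc) -size_cat.
rewrite -(card_uniqP darts_uniq) (eq_card (B := predT)) => [|y]; last exact: darts_mem.
by rewrite !card_prod !card_ord card_bool; lia.
Qed.

Let cover_sym : connect_sym cover_rel.
Proof.
apply: sym_connect_sym => x y; rewrite /cover_rel /map_rel edge_rel_sym.
by rewrite orbCA.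
Qed.

Let lift x y b : flat_rel x y -> connect cover_rel (x, b) (y, ~~ b).
Proof.
case/orP => /eqP ->; last by apply: connect1; rewrite /cover_rel /map_rel permE eqxx.
apply: connect1; rewrite /cover_rel /map_rel /edge_rel /=; apply/or3P; apply: Or33.
have := darts_mem (x, b); rewrite mem_cat => /orP[xd|/mapP[z zd xz]]; apply/orP.
  by left; apply/mapP; exists (x, b).
right; apply/mapP; exists z => //.
have -> : z = cover_arc (x, b) by rewrite xz cover_arcK.
by rewrite cover_arcK.
Qed.

Let cover_edge u v : cover_rel u v -> (flat_rel u.1 v.1 || flat_rel v.1 u.1) /\ v.2 = ~~ u.2.
Proof.
have ed a b : (a, b) \in edges -> flat_rel a.1 b.1 /\ b.2 = ~~ a.2.
  by case/mapP => z _ [-> ->]; rewrite /flat_rel /= eqxx.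
case/or3P => [/eqP <-|/eqP <-|/orP[]/ed[fl ->]]; rewrite ?fl ?orbT ?negbK //;
  by rewrite permE /flat_rel /= eqxx !orbT ?negbK.
Qed.

Let connect_flip u v : connect cover_rel u v ->
  connect cover_rel (u.1, ~~ u.2) (v.1, ~~ v.2).
Proof.
case/connectP => p + ->; elim: p u => [|z p IH] u /=; first by rewrite connect0.
case/andP => /cover_edge[uz z2] /IH; apply: connect_trans; rewrite z2.
case/orP: uz => fl; first exact: lift.
by rewrite cover_sym -{2}[u.2]negbK; apply: lift.
Qed.

Let connect_lift x y b : connect flat_rel x y -> exists c, connect cover_rel (x, b) (y, c).
Proof.
case/connectP => p + ->; elim: p x b => [|z p IH] x b /=; first by exists b.
case/andP => xz /(IH _ (~~ b))[c zc]; exists c.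
exact: connect_trans (lift b xz) zc.
Qed.

Let sheet (Ab : component flat_rel * bool) : component cover_rel :=
  component_of cover_rel (component_repr Ab.1, Ab.2).

Lemma planar_checkerboard : planar arc ->
  exists w : X -> bool, (forall x, w (arc x) = ~~ w x) /\ (forall x, w (rotate x) = ~~ w x).
Proof.
move=> pl; have rot_inj : injective (@rotate n \o arc).
  move=> x y /= /(congr1 (fun z : X => rotate (rotate (rotate z)))).
  by rewrite !rotate4 => /(inv_inj arcK).
have F2 : (#|{: component (frel (@rotate n \o arc))}| * 2 <= #|porbits edge_perm|)%N.
  have -> : (#|{: component (frel (@rotate n \o arc))}| * 2 =
      #|{: component (frel (@rotate n \o arc)) * bool}|)%N by rewrite card_prod card_bool.
  rewrite card_porbits; pose phi (y : Y) := (component_of (frel (@rotate n \o arc)) y.1, y.2).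
  apply: leq_trans (@card_component_invariant _ _ _ phi (@frel_perm_sym _ _) _).
    rewrite -cardsT; apply: subset_leq_card; apply/subsetP => -[A b] _.
    apply/imsetP; exists (component_repr A, b) => //.
    by rewrite /phi /= component_reprK //; apply: fconnect_sym.
  move=> x y /eqP <-; rewrite /phi edge_permE /=; congr (_, _); apply/eqP.
  by rewrite component_of_eq ?connect1 //=; apply: fconnect_sym.
(* A rotation changes both the parity of the half-edge and the sheet, so their sum distinguishes two
   vertices of the cover over each crossing. *)
have V2 : (n * 2 <= #|porbits sigma|)%N.
  have -> : (n * 2 = #|{: 'I_n * bool}|)%N by rewrite card_prod card_ord card_bool.
  rewrite card_porbits; pose phi (y : Y) := (y.1.1, odd y.1.2 (+) y.2).
  apply: leq_trans (@card_component_invariant _ _ _ phi (@frel_perm_sym _ _) _).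
    rewrite -cardsT; apply: subset_leq_card; apply/subsetP => -[i b] _.
    by apply/imsetP; exists ((i, 0), b).
  move=> [x b] y /eqP <-; rewrite /phi permE /cover_rotate odd_rotate /=.
  by rewrite addbN addNb negbK.
have allE : all (fun e => e.1 != e.2) edges.
  apply/allP => _ /mapP[y _ ->] /=; apply/negP => /eqP/(congr1 fst) /= /eqP.
  by rewrite eq_sym (negbTE (arc_neq _)).
have := @euler_inequality _ sigma edges allE; rewrite -/edge_perm -/cover_rel => euler.
(* Planarity says that there are n + 2K faces. The cover has at least 2n vertices and 2n + 4K faces,
   and 4n edges, so Euler's inequality leaves it at least 2K components. *)
have K2 : (#|{: component flat_rel}| * 2 <= #|{: component cover_rel}|)%N.
  move: pl; rewrite /planar n_comp_component; last exact: fconnect_sym.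
  have -> : n_comp [rel x y : X | (y == arc x) || (y == rotate x)] {: X} =
      #|{: component flat_rel}| by exact: n_comp_component flat_sym.
  move: euler F2 V2 size_edges; rewrite -mul2n.
  move: #|porbits _| #|porbits _| (size edges) #|{: component cover_rel}|.
  move: #|{: component flat_rel}| #|{: component _}| => a b c d e f.
  lia.
have sheet_onto : sheet @: setT = setT.
  apply/eqP; rewrite eqEsubset subsetT; apply/subsetP => B _; apply/imsetP.
  case eB: (component_repr B) => [y c].
  have [c1 yc1] := connect_lift true (component_repr_connect flat_sym y).
  exists (component_of flat_rel y, if c then c1 else ~~ c1) => //.
  rewrite -(component_reprK cover_sym B) eB; apply/eqP; rewrite component_of_eq //=.
  by case: c {eB}; [exact: yc1|exact: connect_flip yc1].
(* A surjection onto a set at least as large as its source: the two sheets over a component are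
   therefore not connected, and [w] records on which of them a half-edge lies. *)
have sheet_inj : injective sheet.
  suff /imset_injP inj : #|sheet @: setT| == #|[set: component flat_rel * bool]|.
    by move=> a a'; apply: inj; rewrite inE.
  rewrite eqn_leq leq_imset_card sheet_onto !cardsT card_prod card_bool.
  exact: K2.
pose base y := component_repr (component_of flat_rel y).
have baseP y : connect flat_rel (base y) y.
  by rewrite flat_sym; apply: component_repr_connect flat_sym y.
have base_sheets y : ~~ connect cover_rel (base y, true) (base y, false).
  apply/negP => tf; suff : (component_of flat_rel y, true) = (component_of flat_rel y, false) by [].
  by apply: sheet_inj; apply/eqP; rewrite component_of_eq.
pose w y := connect cover_rel (base y, true) (y, true).
have wN y : connect cover_rel (base y, true) (y, false) = ~~ w y.
  apply/idP/idP => [yf|].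
    apply/negP => yt; case/negP: (base_sheets y).
    by apply: connect_trans yf _; rewrite cover_sym; apply: connect_flip yt.
  by have [[] //] := connect_lift true (baseP y); rewrite /w => ->.
have wE x y : flat_rel x y -> w y = ~~ w x.
  move=> xy; rewrite -wN /w.
  have -> : base y = base x.
    congr component_repr; apply/eqP; rewrite component_of_eq; last exact: flat_sym.
    by rewrite flat_sym; apply: connect1.
  apply/idP/idP => h; apply: connect_trans h _; last exact: lift false xy.
  by rewrite cover_sym; apply: lift false xy.
by exists w; split=> x; apply: wE; rewrite /flat_rel /= eqxx ?orbT.
Qed.

End Checkerboard.

(** * Counting circles *)

Lemma card_component_transversal (V V' : finType) (e : rel V) (e' : rel V') (f : V' -> V) :
  connect_sym e -> connect_sym e' ->
  (forall x y, connect e (f x) (f y) = connect e' x y) ->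
  (forall v, exists x, connect e v (f x)) -> #|{: component e}| = #|{: component e'}|.
Proof.
move=> sym sym' ee onto.
pose phi (A : component e') := component_of e (f (component_repr A)).
have phi_inj : injective phi.
  move=> A B /eqP; rewrite component_of_eq // ee => AB.
  rewrite -(component_reprK sym' A) -(component_reprK sym' B).
  by apply/eqP; rewrite component_of_eq.
apply/eqP; rewrite eqn_leq (leq_card phi phi_inj) andbT.
have phiT : phi @: setT = setT.
  apply/eqP; rewrite eqEsubset subsetT; apply/subsetP => B _; apply/imsetP.
  have [x Bx] := onto (component_repr B); exists (component_of e' x) => //.
  rewrite -(component_reprK sym B); apply/eqP; rewrite component_of_eq //.
  by apply: connect_trans Bx _; rewrite ee; apply: component_repr_connect.
by rewrite -[#|{: component e}|]cardsT -phiT; apply: leq_trans (leq_imset_card _ _) _;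
  rewrite cardsT.
Qed.

Section Smoothings.
Variable D : link_diagram.
Local Notation n := (ncross D).
Local Notation arc := (Defs.arc D).
Implicit Types (a b : state D) (h : half_edge n) (x y : point D).

Lemma smooth_cross a h : (smooth a h).1 = h.1.
Proof. by []. Qed.

Lemma smoothK a : involutive (smooth a).
Proof.
by case=> i k; rewrite /smooth /=; congr (_, _); case: (a i);
  case: k => [[|[|[|[|]]]] kP] //; apply: val_inj.
Qed.

Lemma eq_smooth a b h : a h.1 = b h.1 -> smooth a h = smooth b h.
Proof. by rewrite /smooth => ->. Qed.

(** The two smoothings of a crossing differ by a half-turn, which exchanges the two half-edges of
    each colour; this is the source of the transposition. *)
Lemma smooth_other a b h : ~~ a h.1 -> b h.1 -> smooth b h = smooth a (rotate (rotate h)).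
Proof.
case: h => i k; rewrite /smooth /= => /negbTE -> ->; congr (_, _).
by case: k => [[|[|[|[|]]]] kP] //; apply: val_inj.
Qed.

Lemma smooth_rel_sym a : connect_sym (smooth_rel a).
Proof.
apply: connect_sym_edges => -[h|i] [h'|i'] //= /orP[] /eqP ->; apply: connect1 => /=.
  by rewrite arcK eqxx.
by rewrite smoothK eqxx orbT.
Qed.

Lemma smooth_rel_arc a h : smooth_rel a (inl h) (inl (arc h)).
Proof. by rewrite /= eqxx. Qed.

Lemma smooth_rel_smooth a h : smooth_rel a (inl h) (inl (smooth a h)).
Proof. by rewrite /= eqxx orbT. Qed.

Lemma saddle_rel_sym a b : connect_sym (saddle_rel a b).
Proof.
have sub c : c = a \/ c = b -> subrel (connect (smooth_rel c)) (connect (saddle_rel a b)).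
  by move=> cab; apply: connect_sub => x y xy; apply: connect1;
    case: cab => <-; rewrite /saddle_rel /= xy ?orbT.
apply: connect_sym_edges => x y /orP[] /connect1; rewrite smooth_rel_sym; apply: sub; auto.
Qed.

Lemma sub_saddle_l a b : subrel (connect (smooth_rel a)) (connect (saddle_rel a b)).
Proof. by apply: connect_sub => x y xy; apply: connect1; rewrite /saddle_rel /= xy. Qed.

Lemma sub_saddle_r a b : subrel (connect (smooth_rel b)) (connect (saddle_rel a b)).
Proof. by apply: connect_sub => x y xy; apply: connect1; rewrite /saddle_rel /= xy orbT. Qed.

Section Chequered.
Variable w : half_edge n -> bool.
Hypotheses (w_arc : forall h, w (arc h) = ~~ w h) (w_rot : forall h, w (rotate h) = ~~ w h).

Lemma w_smooth a h : w (smooth a h) = ~~ w h.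
Proof.
rewrite /smooth; case: ifP => _; last exact: w_rot.
rewrite -[in RHS](_ : rotate (h.1, h.2 - 1) = h) ?w_rot ?negbK //.
by case: h => i k; rewrite /rotate /= subrK.
Qed.

Definition half_point : pred (point D) := fun x => if x is inl h then w h else true.
Local Notation W := {x : point D | half_point x}.

(* Following a circle of the smoothing from one half-edge of colour [true] to the
next one; crossingless components are fixed. *)
Definition turn a x : point D := if x is inl h then inl (arc (smooth a h)) else x.

Lemma turn_half a (x : W) : half_point (turn a (val x)).
Proof. by case: x => -[h|i] //= wh; rewrite w_arc w_smooth negbK. Qed.

Definition turnW a (x : W) : W := Sub (turn a (val x)) (turn_half a x).

Lemma turnW_inj a : injective (turnW a).
Proof.
have turn_inj : injective (turn a).
  case=> [h|i] [h'|i'] //=.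
  move/(congr1 (fun z : point D => if z is inl k then k else h)) => /=.
  by move=> /(inv_inj (@arcK D)) /(inv_inj (smoothK a)) ->.
by move=> x y /(congr1 val) /= xy; apply/val_inj/turn_inj.
Qed.

Lemma connect_turnW a (x y : W) :
  connect (smooth_rel a) (val x) (val y) = connect (frel (perm (@turnW_inj a))) x y.
Proof.
set s := perm _.
(* Each arc has exactly one end of colour [true]; [pi] retracts the arc to it. *)
pose pi x : point D := if x is inl h then (if w h then x else inl (arc h)) else x.
have pi_half z : half_point (pi z).
  by case: z => //= h; case: ifP => //= /negbT; rewrite w_arc.
pose piW z : W := Sub (pi z) (pi_half z).
have stepE (z : W) : connect (frel s) z (turnW a z) by apply: connect1; rewrite /= permE.
have sym := @frel_perm_sym _ s.
apply/idP/idP => xy.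
  have valK' z : piW (val z) = z.
    by apply: val_inj; rewrite /= /pi; case: z => -[h|i] //= ->.
  rewrite -[x]valK' -[y]valK' -component_of_eq //; apply/eqP.
  apply: (connect_const (phi := fun x => component_of (frel s) (piW x)) _ xy) => {x y xy} u v.
  move=> uv; apply/eqP; rewrite component_of_eq //.
  case: u v uv => [h|i] [h'|i'] //= /orP[] /eqP ->.
    have -> : piW (inl (arc h)) = piW (inl h).
      by apply: val_inj; rewrite /= w_arc arcK; case: (w h).
    exact: connect0.
  case wh: (w h).
    have -> : piW (inl (smooth a h)) = turnW a (piW (inl h)).
      by apply: val_inj; rewrite /= w_smooth wh.
    exact: stepE.
  have -> : piW (inl h) = turnW a (piW (inl (smooth a h))).
    by apply: val_inj; rewrite /= w_smooth wh /= smoothK.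
  by rewrite sym; apply: stepE.
rewrite -component_of_eq; last exact: smooth_rel_sym.
apply/eqP; apply: (connect_const (phi := fun x : W => component_of (smooth_rel a) (val x)) _ xy).
move=> {x y xy} x _ /eqP <-; rewrite permE; apply/eqP.
rewrite component_of_eq; last exact: smooth_rel_sym.
change (connect (smooth_rel a) (val x) (turn a (val x))).
case: (val x) => [h|i] /=; last exact: connect0.
exact: connect_trans (connect1 (smooth_rel_smooth a h)) (connect1 (smooth_rel_arc a _)).
Qed.

Lemma card_circle a : #|{: component (smooth_rel a)}| = #|porbits (perm (@turnW_inj a))|.
Proof.
rewrite card_porbits.
apply: (@card_component_transversal _ _ _ _ (val : W -> point D)) => //.
- exact: smooth_rel_sym.
- exact: frel_perm_sym.
- exact: connect_turnW.
case=> [h|i]; last by exists (Sub (inr i) isT); apply: connect0.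
case wh: (w h); first by exists (Sub (inl h) wh); apply: connect0.
have wah : w (arc h) by rewrite w_arc wh.
by exists (Sub (inl (arc h)) wah); apply: connect1; apply: smooth_rel_arc.
Qed.

Lemma w_parity (j : 'I_n) (k : 'I_4) : w (j, k) = w (j, 0) (+) odd k.
Proof.
have rot m (mP : (m < 4)%N) (mP1 : (m.+1 < 4)%N) :
    w (j, Ordinal mP1) = ~~ w (j, Ordinal mP).
  rewrite -w_rot; congr (w (_, _)); apply: val_inj.
  by case: m mP mP1 => [|[|[|]]].
have e0 (P : (0 < 4)%N) : w (j, Ordinal P) = w (j, 0).
  by congr (w (_, _)); apply: val_inj.
case: k => [[|[|[|[|]]]] kP] //=; rewrite ?addbT ?addbF.
- exact: e0.
- by rewrite (rot 0%N isT) e0.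
- by rewrite (rot 1%N isT) (rot 0%N isT) e0 negbK.
- by rewrite (rot 2%N isT) (rot 1%N isT) (rot 0%N isT) e0 negbK.
Qed.

Section Saddle.
Variables (j : 'I_n) (a b : state D).
Hypothesis flip : flips j a b.

Let aj : ~~ a j. Proof. by case/andP: flip. Qed.
Let bj : b j. Proof. by case/andP: flip => _ /eqP ->; rewrite ffunE eqxx. Qed.
Let abE i : i != j -> a i = b i.
Proof. by case/andP: flip => _ /eqP -> /negbTE ij; rewrite ffunE ij. Qed.

Definition opposite h : half_edge n := rotate (rotate h).

Let smooth_j h : h.1 = j -> smooth b h = smooth a (opposite h).
Proof. by move=> hj; apply: smooth_other; rewrite hj. Qed.

Let smooth_nj h : h.1 != j -> smooth b h = smooth a h.
Proof. by move=> hj; apply: eq_smooth; rewrite abE. Qed.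

Let p : half_edge n := if w (j, 0) then (j, 0) else (j, 1).
Let q := opposite p.

Let wp : w p.
Proof. by rewrite /p; case: ifP => // wj; rewrite w_parity wj. Qed.

Let wq : w q. Proof. by rewrite /q /opposite !w_rot negbK wp. Qed.

Let pj : p.1 = j. Proof. by rewrite /p; case: ifP. Qed.
Let qj : q.1 = j. Proof. exact: pj. Qed.

Let pq : p != q.
Proof. by rewrite /q /opposite /p; case: ifP => _; apply/eqP => /(congr1 (fun h => val h.2)). Qed.

Let qK : opposite q = p. Proof. exact: rotate4. Qed.

Let half_j h : h.1 = j -> w h -> h = p \/ h = q.
Proof.
case: h => i k /= ->; rewrite w_parity /q /opposite /p; case: ifP => _;
  case: k => [[|[|[|[|]]]] kP] //= _; (try by left; congr (_, _); apply: val_inj);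
  by right; congr (_, _); apply: val_inj.
Qed.

Let edgeE u v : saddle_rel a b u v ->
  [|| connect (smooth_rel a) u v,
      connect (smooth_rel a) u (inl p) && connect (smooth_rel a) (inl q) v |
      connect (smooth_rel a) u (inl q) && connect (smooth_rel a) (inl p) v].
Proof.
case/orP => [/connect1 -> //|]; case: u v => [h|i] [h'|i'] //= /orP[] /eqP ->.
  by rewrite connect1 //; apply: smooth_rel_arc.
have [hj|/smooth_nj ->] := eqVneq h.1 j; last first.
  by rewrite connect1 //; apply: smooth_rel_smooth.
have smE k : connect (smooth_rel a) (inl k) (inl (smooth a k)).
  by apply: connect1; apply: smooth_rel_smooth.
case wh: (w h).
  by have [->|->] := half_j hj wh; rewrite smooth_j // ?qK connect0 smE ?orbT.
have hE : h = smooth b (smooth b h) by rewrite smoothK.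
have [||e|e] := @half_j (smooth b h); rewrite ?w_smooth ?wh ?smooth_cross //.
  have hq : h = smooth a q by rewrite hE e smooth_j.
  by apply/or3P; apply: Or33; rewrite e connect0 andbT smooth_rel_sym hq; apply: smE.
have hp : h = smooth a p by rewrite hE e smooth_j ?qK.
by apply/or3P; apply: Or32; rewrite e connect0 andbT smooth_rel_sym hp; apply: smE.
Qed.

Let connect_pq : connect (saddle_rel a b) (inl p) (inl q).
Proof.
apply: (@connect_trans _ _ (inl (smooth b p))).
  by apply/sub_saddle_r/connect1/smooth_rel_smooth.
rewrite smooth_j // saddle_rel_sym.
by apply/sub_saddle_l/connect1/smooth_rel_smooth.
Qed.

(** If [p] and [q] lie on different circles of [a], the transposition merges these, and the saddle
    surface has as many components as [b] has circles. Otherwise it splits a circle, and the surface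
    has as many components as [a] has circles. *)
Lemma card_saddle :
  (#|{: component (smooth_rel a)}| + #|{: component (smooth_rel b)}| =
   2 * #|{: component (saddle_rel a b)}| + 1)%N.
Proof.
have := @card_component_add_edge _ (smooth_rel a) (saddle_rel a b) (inl p) (inl q)
  (@smooth_rel_sym a) (@saddle_rel_sym a b) _ connect_pq edgeE.
have sub : subrel (smooth_rel a) (connect (saddle_rel a b)).
  by move=> x y xy; apply: connect1; rewrite /saddle_rel /= xy.
move=> /(_ sub); rewrite !card_circle.
pose P : W := Sub (inl p) wp; pose Q : W := Sub (inl q) wq.
have -> : perm (@turnW_inj b) = (tperm P Q * perm (@turnW_inj a))%g.
  apply/permP => x; rewrite permM [LHS]permE [RHS]permE; apply: val_inj.
  case: tpermP => [->|->|xP xQ] /=.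
  - by rewrite smooth_j.
  - by rewrite smooth_j // qK.
  case ex: (val x) => [h|i] //=; congr (inl (Defs.arc D _)); apply: smooth_nj.
  have wh : w h by have := valP x; rewrite ex.
  apply/eqP => hj; have [hp|hq] := half_j hj wh.
    by apply: xP; apply: val_inj; rewrite ex hp.
  by apply: xQ; apply: val_inj; rewrite ex hq.
set t := (tperm P Q * _)%g.
have : (#|porbits t| + (P \notin porbit (perm (@turnW_inj a)) Q).*2 =
    #|porbits (perm (@turnW_inj a))| + (P != Q))%N := porbits_mul_tperm _ _ _.
have -> : (P != Q) by apply: contraNneq pq => /(congr1 val) /= [->].
have -> : (P \notin porbit (perm (@turnW_inj a)) Q) = ~~ connect (smooth_rel a) (inl p) (inl q).
  rewrite mem_porbit_connect -connect_turnW smooth_rel_sym //.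
move: #|porbits _| #|porbits _| #|{: component _}| => c d e /=.
case: (connect _ _ _) => /=; lia.
Qed.

End Saddle.
End Chequered.
End Smoothings.

(** * The cube of resolutions *)

Section ColourCount.
Variables (V : finType) (e : rel V) (X : V -> bool).
Hypotheses (sym_e : connect_sym e) (eX : forall x y, e x y -> X x = X y).

Definition colour_count (c : bool) : nat :=
  #|[set A : component e | X (component_repr A) == c]|.

Lemma connect_colour x y : connect e x y -> X x = X y.
Proof. exact: connect_const. Qed.

Lemma colour_repr x : X (component_repr (component_of e x)) = X x.
Proof. by apply/esym/connect_colour/component_repr_connect. Qed.

Lemma colour_countE c :
  colour_count c = #|[set [set y | connect e x y] | x in [pred x | X x == c]]|.
Proof.
rewrite /colour_count -(card_imset _ val_inj); apply: eq_card => B.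
apply/imsetP/imsetP => [[A]|[x]].
  rewrite inE => Ac ->; exists (component_repr A); first by rewrite inE.
  by rewrite -{1}(component_reprK sym_e A).
rewrite inE => xc ->; exists (component_of e x) => //.
by rewrite inE colour_repr.
Qed.

Lemma colour_count_split c :
  #|{: component e}| = (colour_count c + colour_count (~~ c))%N.
Proof.
rewrite /colour_count -(cardsC [set A : component e | X (component_repr A) == c]).
congr (_ + _)%N; apply: eq_card => A; rewrite !inE.
by case: c; case: (X _).
Qed.

End ColourCount.

Lemma eq_colour_count (V : finType) (e e' : rel V) (X : V -> bool) c :
  connect_sym e -> connect_sym e' ->
  (forall x y, e x y -> X x = X y) -> (forall x y, e' x y -> X x = X y) ->
  (forall x y, X x = c -> e x y = e' x y) ->
  colour_count e X c = colour_count e' X c.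
Proof.
move=> sym sym' eX eX' ee; rewrite !colour_countE //; congr #|pred_of_set _|.
apply: eq_in_imset => x; rewrite inE => /eqP xc; apply/setP => y; rewrite !inE.
have sub (r r' : rel V) : (forall u v, r u v -> X u = X v) ->
    (forall u v, X u = c -> r u v -> r' u v) -> connect r x y -> connect r' x y.
  move=> rX rr /connectP[p + ->]; elim: p x xc => [|z p IH] u uc /=; first by rewrite connect0.
  case/andP => uz zp; apply: connect_trans (connect1 (rr _ _ uc uz)) (IH z _ zp).
  by rewrite -(rX _ _ uz).
by apply/idP/idP; apply: sub => // u v uc; rewrite ee.
Qed.

Section KhovanovDifferential.
Variable D : link_diagram.
Local Notation n := (ncross D).
Implicit Types (a b c : state D) (X : point D -> bool).

Definition coloured a X := forall u v, smooth_rel a u v -> X u = X v.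

Section Flip.
Variables (j : 'I_n) (a b : state D) (X : point D -> bool).
Hypotheses (flip : flips j a b) (aX : coloured a X) (bX : coloured b X).

Let saddleX u v : saddle_rel a b u v -> X u = X v.
Proof. by case/orP; [apply: aX|apply: bX]. Qed.

(** From an even half-edge the 0-smoothing leads to the next one, from an odd one the 1-smoothing
    does; together they go all the way around the crossing. *)
Lemma colour_crossing h : h.1 = j -> X (inl h) = X (inl (j, 0)).
Proof.
have /andP[/negbTE aj /eqP bE] := flip.
have rot g : g.1 = j -> X (inl (rotate g)) = X (inl g).
  move=> gj; case og: (odd g.2).
    have <- : smooth b g = rotate g by rewrite /smooth /rotate gj bE ffunE eqxx og.
    by apply/esym/bX/smooth_rel_smooth.
  have <- : smooth a g = rotate g by rewrite /smooth /rotate gj aj og.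
  by apply/esym/aX/smooth_rel_smooth.
have rotn m : X (inl (iter m (@rotate n) (j, 0))) = X (inl (j, 0)).
  elim: m => //= m <-; apply: rot.
  by elim: m => //= m ->.
case: h => i k /= ->; rewrite -[RHS](rotn k); congr (X (inl _)).
by case: k => [[|[|[|[|]]]] kP] //=; rewrite /rotate /=; congr (_, _); apply: val_inj.
Qed.

(** A refinement of [card_saddle] by colour: circles of the colour not present at the crossing are
    the same for [a], [b] and the saddle, and subtracting them from the total count leaves the other
    colour. *)
Lemma saddle_colour_count w :
  (forall h, w (Defs.arc D h) = ~~ w h) -> (forall h, w (rotate h) = ~~ w h) ->
  forall col, (colour_count (smooth_rel a) X col + colour_count (smooth_rel b) X col =
    2 * colour_count (saddle_rel a b) X col + (X (inl (j, 0%R)) == col))%N.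
Proof.
move=> w_arc w_rot.
have off col : X (inl (j, 0)) <> col ->
   colour_count (smooth_rel a) X col = colour_count (smooth_rel b) X col /\
   colour_count (saddle_rel a b) X col = colour_count (smooth_rel b) X col.
  move=> jcol; have ab u v : X u = col -> smooth_rel a u v = smooth_rel b u v.
    case: u v => [h|i] [h'|i'] //= hcol; rewrite (@eq_smooth _ a b h) //.
    have /andP[_ /eqP ->] := flip; rewrite ffunE; case: eqP => // hj.
    by case: jcol; rewrite -(colour_crossing hj).
  split; apply: eq_colour_count => //; try exact: smooth_rel_sym; try exact: saddle_rel_sym.
  by move=> u v ucol; rewrite /saddle_rel /= ab // orbb.
have tot := card_saddle w_arc w_rot flip.
move=> col; have [jcol|jcol] := eqVneq (X (inl (j, 0))) col; last first.
  by have [-> ->] := off col (elimN eqP jcol); rewrite addn0 mul2n addnn.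
have [] := off (~~ col); first by rewrite jcol; case: (col).
move: tot; rewrite (colour_count_split (smooth_rel a) X col).
rewrite (colour_count_split (smooth_rel b) X col) (colour_count_split (saddle_rel a b) X col).
move=> tot e1 e2; move: tot; rewrite e1 e2 => {e1 e2}.
move: (colour_count _ _ _) (colour_count _ _ _) (colour_count _ _ _) (colour_count _ _ _).
move=> p q r s; lia.
Qed.

End Flip.

(** The intermediate state smooths the crossing [j] as [c] does and all others as [a] does. *)
Lemma coloured_between j k a b c X :
  flips j a b -> flips k b c -> coloured a X -> coloured c X -> coloured b X.
Proof.
move=> /andP[aj /eqP bE] /andP[bk /eqP cE] aX cX [h|i] [h'|i'] //= /orP[] /eqP ->.
  by apply: aX; apply: smooth_rel_arc.
have [hj|hj] := eqVneq h.1 j.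
  have -> : smooth b h = smooth c h.
    by apply: eq_smooth; rewrite cE ffunE bE ffunE hj eqxx; case: eqP.
  by apply: cX; apply: smooth_rel_smooth.
have -> : smooth b h = smooth a h by apply: eq_smooth; rewrite bE ffunE (negbTE hj).
by apply: aX; apply: smooth_rel_smooth.
Qed.

Definition spread a (x : {ffun circle a -> bool}) : point D -> bool :=
  fun pt => x (component_of (smooth_rel a) pt).

Definition gather a X : {ffun circle a -> bool} := [ffun A => X (component_repr A)].

Lemma spread_coloured a (x : {ffun circle a -> bool}) : coloured a (spread x).
Proof.
move=> u v uv; congr (x _); apply/eqP; rewrite component_of_eq ?connect1 //.
exact: smooth_rel_sym.
Qed.

Lemma gatherK a X : coloured a X -> spread (gather a X) =1 X.
Proof. by move=> aX u; rewrite /spread ffunE; apply: colour_repr => //; apply: smooth_rel_sym. Qed.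

Lemma spreadK a (x : {ffun circle a -> bool}) : gather a (spread x) = x.
Proof.
apply/ffunP => A; rewrite ffunE /spread component_reprK //; exact: smooth_rel_sym.
Qed.

Section States.
Variables (F : fieldType) (h : F).
Hypothesis h_neq0 : h != 0.

Definition handle_prod (e : rel (point D)) X : F :=
  \prod_(A : component e) handle h (X (component_repr A)).

Lemma handle_prod_neq0 e X : handle_prod e X != 0.
Proof. by apply/prodf_neq0 => A _; apply: handle_neq0. Qed.

Lemma handle_prodE e X :
  handle_prod e X = \prod_col handle h col ^+ colour_count e X col.
Proof.
rewrite /handle_prod (partition_big (fun A : component e => X (component_repr A)) predT) //=.
apply: eq_bigr => col _; rewrite /colour_count cardsE -prodr_const.
by apply: eq_bigr => A /eqP ->.
Qed.

Lemma eq_handle_prod e X X' : X =1 X' -> handle_prod e X = handle_prod e X'.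
Proof. by move=> XX; apply: eq_bigr => A _; rewrite XX. Qed.

(** Every component of the saddle meets the boundary, so its colouring is forced; one exists exactly
    when [x] and [y] induce the same colouring of the points. *)
Lemma state_sum_saddle a b (x : {ffun circle a -> bool}) (y : {ffun circle b -> bool}) :
  state_sum h (saddle a b) x y =
  if [forall pt, spread x pt == spread y pt] then
    handle_prod (smooth_rel b) (spread x) / handle_prod (saddle_rel a b) (spread x)
  else 0.
Proof.
rewrite state_sum_cob_of //.
have syma := @smooth_rel_sym _ a; have symb := @smooth_rel_sym _ b.
have syms := @saddle_rel_sym _ a b.
have reprA pt : connect (saddle_rel a b) pt (component_repr (component_of (smooth_rel a) pt)).
  by apply: sub_saddle_l; apply: component_repr_connect.
have reprB pt : connect (saddle_rel a b) pt (component_repr (component_of (smooth_rel b) pt)).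
  by apply: sub_saddle_r; apply: component_repr_connect.
case: ifPn => [/forallP xy|]; last first.
  rewrite negb_forall => /existsP[pt /eqP xy].
  rewrite /colouring_sum [X in _ * X]big_pred0 ?mulr0 // => col /=.
  apply/negP => /forallP cz; apply: xy.
  have /eqP /= := cz (inl (component_of (smooth_rel a) pt)).
  have /eqP /= := cz (inr (component_of (smooth_rel b) pt)).
  rewrite /spread => <- <-; congr (col _); apply/eqP; rewrite component_of_eq //.
  by apply: connect_trans (reprB pt); rewrite syms.
have sX u v : saddle_rel a b u v -> spread x u = spread x v.
  by case/orP => [/spread_coloured //|uv]; rewrite !(eqP (xy _)); apply: spread_coloured.
pose col0 : {ffun component (saddle_rel a b) -> bool} :=
  [ffun B => spread x (component_repr B)].
rewrite /colouring_sum (big_pred1 col0) => [|col] /=; last first.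
  apply/forallP/eqP => [cz|-> [A|A]] /=.
  - apply/ffunP => B; rewrite ffunE -[in LHS](component_reprK syms B).
    have /eqP /= := cz (inl (component_of (smooth_rel a) (component_repr B))).
    rewrite /spread => <-; congr (col _); apply/eqP; rewrite component_of_eq //.
  - rewrite ffunE (colour_repr syms sX) /spread component_reprK //.
  - rewrite ffunE (colour_repr syms sX) (eqP (xy _)) /spread component_reprK //.
rewrite big_nil mulr1; congr (_ * _).
  apply: eq_bigr => A _; congr (handle h _).
  by rewrite (eqP (xy _)) /spread component_reprK.
rewrite /handle_prod -prodfV; apply: eq_bigr => B _.
by rewrite ffunE sub0r exprN1.
Qed.

End States.
End KhovanovDifferential.

(** * Anticommuting squares and the complex of a diagram *)

Section KhovanovComplex.
Variable D : link_diagram.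
Local Notation n := (ncross D).
Implicit Types (j k : 'I_n) (a b c : state D).

Definition flip j a : state D := [ffun i => if i == j then true else a i].

Lemma flipsE j a b : flips j a b = ~~ a j && (b == flip j a).
Proof. by []. Qed.

Lemma sum_flip (P : pred 'I_n) j a : ~~ a j ->
  (\sum_(i | P i) flip j a i = \sum_(i | P i) a i + P j)%N.
Proof.
move=> aj; have -> : (P j : nat) = (\sum_(i | P i) (i == j))%N.
  case Pj: (P j); first by rewrite (bigD1 j) //= eqxx big1 // => i /andP[_ /negbTE ->].
  by rewrite big1 // => i Pi; case: eqP => // ij; rewrite ij Pj in Pi.
rewrite -big_split /=; apply: eq_bigr => i _; rewrite ffunE.
by case: eqP => [->|]; rewrite ?(negbTE aj) ?addn0.
Qed.

Lemma weight_flips j a b : flips j a b -> weight b = (weight a + 1)%N.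
Proof. by rewrite flipsE => /andP[aj /eqP ->]; apply: sum_flip. Qed.

Definition sign j a : int := (-1) ^+ (\sum_(i < n | (i < j)%N) a i)%N.

Lemma sign_flip j k a : ~~ a j -> sign k (flip j a) = (-1) ^+ (j < k)%N * sign k a.
Proof. by move=> aj; rewrite /sign sum_flip // exprD mulrC. Qed.

Lemma sign_swap j k a : j != k -> ~~ a j -> ~~ a k ->
  sign j a * sign k (flip j a) = - (sign k a * sign j (flip k a)).
Proof.
move=> jk aj ak; rewrite !sign_flip //.
have -> : (k < j)%N = ~~ (j < k)%N by rewrite -leqNgt ltn_neqAle eq_sym jk.
by case: (j < k)%N; rewrite /= ?expr1 ?expr0; ring.
Qed.

Variable w : half_edge n -> bool.
Hypotheses (w_arc : forall x, w (Defs.arc D x) = ~~ w x)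
  (w_rot : forall x, w (rotate x) = ~~ w x).

Section Field.
Variables (F : fieldType) (h : F).
Hypothesis h_transcendental : forall p : {poly int}, (map_poly intr p).[h] = 0 -> p = 0.
Let h_neq0 := transcendental_neq0 h_transcendental.

Definition two_saddles a b c (x : {ffun circle a -> bool}) (z : {ffun circle c -> bool}) : F :=
  \sum_(y : {ffun circle b -> bool}) state_sum h (saddle a b) x y * state_sum h (saddle b c) y z.

Lemma two_saddlesE j k a b c (x : {ffun circle a -> bool}) (z : {ffun circle c -> bool}) :
  flips j a b -> flips k b c ->
  two_saddles b x z =
  if [forall pt, spread x pt == spread z pt] then
    handle_prod h (smooth_rel b) (spread x) / handle_prod h (saddle_rel a b) (spread x) *
    (handle_prod h (smooth_rel c) (spread x) / handle_prod h (saddle_rel b c) (spread x))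
  else 0.
Proof.
move=> ab bc; rewrite /two_saddles.
under eq_bigr do rewrite !state_sum_saddle //.
case: ifPn => [/forallP xz|xz]; last first.
  apply: big1 => y _; case: ifP => [/forallP xy|]; last by rewrite mul0r.
  rewrite ifN ?mulr0 //; apply: contra xz => /forallP yz.
  by apply/forallP => pt; rewrite (eqP (xy pt)) yz.
have bX : coloured b (spread x).
  apply: coloured_between ab bc (@spread_coloured _ _ _) _ => u v uv.
  by rewrite !(eqP (xz _)); apply: spread_coloured.
have bE := gatherK bX.
rewrite (bigD1 (gather b (spread x))) //= [X in _ + X]big1 ?addr0 => [|y yx].
  rewrite !ifT; first last.
  - by apply/forallP => pt; rewrite bE.
  - by apply/forallP => pt; rewrite bE.
  by rewrite !(eq_handle_prod _ _ bE).
rewrite ifN ?mul0r //; apply: contra yx => /forallP xy.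
rewrite -(spreadK y); apply/eqP/ffunP => A; rewrite !ffunE.
by rewrite (eqP (xy _)).
Qed.

(** Both composites are supported on colourings common to [x] and [z], where they are products of
    powers of the handle values. By [saddle_colour_count] along the four edges of the square, the
    exponents agree for each colour. *)
Lemma two_saddles_swap j k a b b' c (x : {ffun circle a -> bool}) (z : {ffun circle c -> bool}) :
  flips j a b -> flips k b c -> flips k a b' -> flips j b' c ->
  two_saddles b x z = two_saddles b' x z.
Proof.
move=> ab bc ab' b'c; rewrite (two_saddlesE _ _ ab bc) (two_saddlesE _ _ ab' b'c).
case: ifP => // /forallP xz; set X := spread x.
have aX : coloured a X := @spread_coloured _ _ x.
have cX : coloured c X.
  by move=> u v uv; rewrite /X !(eqP (xz _)); apply: spread_coloured.
have bX := coloured_between ab bc aX cX; have b'X := coloured_between ab' b'c aX cX.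
have prodE : handle_prod h (smooth_rel b) X *
    (handle_prod h (saddle_rel a b') X * handle_prod h (saddle_rel b' c) X) =
    handle_prod h (smooth_rel b') X *
    (handle_prod h (saddle_rel a b) X * handle_prod h (saddle_rel b c) X).
  rewrite !handle_prodE -!big_split /=; apply: eq_bigr => col _; rewrite -!exprD.
  congr (_ ^+ _).
  have := saddle_colour_count ab aX bX w_arc w_rot col.
  have := saddle_colour_count bc bX cX w_arc w_rot col.
  have := saddle_colour_count ab' aX b'X w_arc w_rot col.
  have := saddle_colour_count b'c b'X cX w_arc w_rot col.
  lia.
have nz e : handle_prod h e X != 0 := handle_prod_neq0 h_neq0 e X.
rewrite !mulf_div; apply/eqP; rewrite eqr_div ?mulf_neq0 //.
by rewrite mulrAC prodE mulrAC.
Qed.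

Lemma lin_sum_Kh_diff r (a : idx (Kh_obj D r)) (b : idx (Kh_obj D (r + 1)))
    (x : {ffun circle (val a) -> bool}) (y : {ffun circle (val b) -> bool}) :
  lin_sum h (Kh_diff a b) x y =
  \sum_(j | flips j (val a) (val b)) state_sum h (saddle (val a) (val b)) x y *~ sign j (val a).
Proof. by rewrite lin_sum_sum; apply: eq_bigr => j _; rewrite lin_sumU. Qed.

Lemma sum_Kh_idx (V : nmodType) r (phi : state D -> V) :
  (forall b, (weight b)%:Z != r + (nneg D)%:Z -> phi b = 0) ->
  \sum_(b : idx (Kh_obj D r)) phi (val b) = \sum_b phi b.
Proof.
move=> phi0; rewrite [RHS](bigID (fun b => (weight b)%:Z == r + (nneg D)%:Z)) /=.
rewrite [X in _ = _ + X]big1 ?addr0 //.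
rewrite [RHS](reindex_omap (val : idx (Kh_obj D r) -> state D) insub) /=; last first.
  by move=> b bw; rewrite insubT.
by apply: eq_bigl => b; rewrite valK eqxx (valP b).
Qed.

(** The term for an ordered pair of crossings is the negative of the term for the reversed pair, so
    the double sum equals its own negative. *)
Lemma Kh_diff_diff r (a : idx (Kh_obj D r)) (c : idx (Kh_obj D (r + 1 + 1)))
    (x : {ffun circle (val a) -> bool}) (z : {ffun circle (val c) -> bool}) :
  lin_sum h (mor_comp (@Kh_diff D r) (@Kh_diff D (r + 1)) a c) x z = 0.
Proof.
rewrite lin_sum_sum.
pose U j k : F := if ~~ val a j && flips k (flip j (val a)) (val c) then
  two_saddles (flip j (val a)) x z *~ (sign j (val a) * sign k (flip j (val a))) else 0.
transitivity (\sum_j \sum_k U j k).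
  pose phi b : F := \sum_(y : {ffun circle b -> bool})
    (\sum_(j | flips j (val a) b) state_sum h (saddle (val a) b) x y *~ sign j (val a)) *
    (\sum_(k | flips k b (val c)) state_sum h (saddle b (val c)) y z *~ sign k b).
  transitivity (\sum_(b : idx (Kh_obj D (r + 1))) phi (val b)).
    apply: eq_bigr => b _; rewrite lin_sum_comp //; apply: eq_bigr => y _.
    by rewrite !lin_sum_Kh_diff.
  rewrite sum_Kh_idx => [|b bw]; last first.
    apply: big1 => y _; rewrite [X in X * _]big_pred0 ?mul0r // => j; apply/negP => ab.
    case/eqP: bw; rewrite (weight_flips ab) PoszD (eqP (valP a)); ring.
  transitivity (\sum_b \sum_(j | flips j (val a) b) \sum_(k | flips k b (val c))
      two_saddles b x z *~ (sign j (val a) * sign k b)).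
    apply: eq_bigr => b _; rewrite /phi.
    under eq_bigr do rewrite mulr_suml; rewrite exchange_big; apply: eq_bigr => j _.
    under eq_bigr do rewrite mulr_sumr; rewrite exchange_big; apply: eq_bigr => k _.
    rewrite /two_saddles -mulrzl mulr_sumr; apply: eq_bigr => y _.
    by rewrite -mulrzl -[X in _ * X = _]mulrzl intrM; ring.
  rewrite (exchange_big_dep (fun j => ~~ val a j)) => [|b j _ /andP[]//] /=.
  rewrite big_mkcond; apply: eq_bigr => j _; rewrite /U.
  case: ifP => aj /=; last by rewrite big1.
  rewrite (big_pred1 (flip j (val a))) => [|b]; last by rewrite flipsE aj.
  by rewrite big_mkcond.
have UC j k : U j k = - U k j.
  have swap : forall j k, ~~ val a j && flips k (flip j (val a)) (val c) ->
      [/\ j != k, ~~ val a k & flips j (flip k (val a)) (val c)].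
    move=> {}j {}k /andP[aj /andP[]]; rewrite ffunE.
    have [//|kj ak /eqP cE] := eqVneq k j; split; rewrite ?[_ == k]eq_sym //.
    rewrite flipsE ffunE ![j == k]eq_sym (negbTE kj) aj cE.
    by apply/eqP/ffunP => i; rewrite !ffunE; do 2?case: ifP.
  rewrite /U; case: ifPn => [jk|jk]; last first.
    by rewrite ifN ?oppr0 //; apply: contra jk => /swap[_ -> ->].
  have [njk ak kj] := swap _ _ jk; have /andP[aj kc] := jk.
  have aE i : ~~ val a i -> flips i (val a) (flip i (val a)).
    by rewrite flipsE eqxx andbT.
  rewrite ak kj (two_saddles_swap x z (aE _ aj) kc (aE _ ak) kj).
  by rewrite (sign_swap njk aj ak) mulrNz.
(* Transcendence applied to the constant polynomial 2 excludes characteristic 2. *)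
have two : (2 : F) != 0.
  apply/eqP => two0; have /eqP : (2%:P : {poly int}) = 0; last by rewrite polyC_eq0.
  by apply: h_transcendental; rewrite map_polyC hornerC.
set s := \sum_j _; have : s = - s.
  by rewrite /s [LHS]exchange_big -sumrN; apply: eq_bigr => j _; rewrite -sumrN; apply: eq_bigr.
move/eqP; rewrite -addr_eq0 -mulr2n -mulr_natl mulf_eq0 (negbTE two) /= => /eqP //.
Qed.

End Field.

Variable p : point D.

Definition special r (a : idx (Kh_obj D r)) : circle (val a) :=
  component_of (smooth_rel (val a)) p.

Lemma saddle_homogeneous j a b : flips j a b ->
  homogeneous (component_of (smooth_rel a) p) (component_of (smooth_rel b) p) (-1) (saddle a b).
Proof.
move=> ab; split.
  rewrite /marked !ffunE; congr enum_rank; apply/eqP.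
  rewrite component_of_eq; last exact: saddle_rel_sym.
  apply: (@connect_trans _ _ p).
    rewrite saddle_rel_sym; apply: sub_saddle_l.
    by apply: component_repr_connect; apply: smooth_rel_sym.
  by apply: sub_saddle_r; apply: component_repr_connect; apply: smooth_rel_sym.
rewrite (euler_char_glued (cob_of_glued _ _)) sumr_const.
have := card_saddle w_arc w_rot ab.
change #|xpredT| with #|{: component (saddle_rel a b)}|.
change #|circle a| with #|{: component (smooth_rel a)}|.
change #|circle b| with #|{: component (smooth_rel b)}|.
move: #|_| #|_| #|_| => m1 m2 m3 m; rewrite mulr0 subr0 -[_ *+ m1]mulr_natl natz /=; lia.
Qed.

Lemma Kh_diff_homogeneous r (a : idx (Kh_obj D r)) (b : idx (Kh_obj D (r + 1))) :
  supported (homogeneous (special a) (special b) (shift a - shift b)) (Kh_diff a b).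
Proof.
have -> : shift a - shift b = -1 by rewrite /=; ring.
by apply: supported_sum => j ab; apply: supportedU; apply: saddle_homogeneous ab.
Qed.

Lemma Kh_is_complex (F : fieldType) (h : F) :
  (forall q : {poly int}, (map_poly intr q).[h] = 0 -> q = 0) -> is_complex (Kh D).
Proof.
move=> h_transcendental; split.
(* The weight lies between 0 and [n], and the degree is the weight minus [nneg D]. *)
- exists (n + nneg D)%N%:Z => r rN; apply: eq_card0 => -[a /= aw]; exfalso.
  have : (weight a <= n)%N.
    rewrite /weight -[X in (_ <= X)%N]card_ord -sum1_card.
    by apply: leq_sum => i _; case: (a i).
  by move: rN; rewrite /= in aw *; lia.
- move=> r; apply: mor_deg0_supported => a b.
  apply: (supported_weaken _ (@Kh_diff_homogeneous r a b)).
  by move=> C [_ ->]; ring.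
- move=> r a c.
  apply: (@matrix_of_faithful _ _ h_transcendental _ _ (special a) (special c)).
  + apply: supported_sum => b _; apply: homogeneous_marked.
    exact: homogeneous_comp (@Kh_diff_homogeneous r a b) (@Kh_diff_homogeneous (r + 1) b c).
  + exact: supported0.
  + by move=> x z; rewrite matrix_of0; apply: Kh_diff_diff.
Qed.

End KhovanovComplex.

Theorem theorem2 (D : link_diagram) (p : point D) :
  (exists (I : int -> finType) (s : forall r, I r -> int)
          (d : forall r, mor (special_sum (s r)) (special_sum (s (r + 1)))),
     (forall r i j, connected_lin (d r i j)) /\
     kom_iso (Kh D) (PreComplex d)) /\
  (exists phi : {poly int} -> lin special_circle special_circle,
     tube_ring_iso phi).
Proof.
split; last by exists tube_poly; exact: tube_poly_iso polyX_transcendental.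
(* An arc joins an outgoing half-edge to an incoming one. *)
have arc_neq h : Defs.arc D h != h.
  by apply/eqP => hh; have := arc_oriented h; rewrite hh; case: incoming.
have [w [w_arc w_rot]] := planar_checkerboard (@arcK D) arc_neq (arc_planar D).
apply: (deloop_complex polyX_transcendental (A := Kh D) (sp := special p)).
  exact: (Kh_is_complex w_arc w_rot p polyX_transcendental).
exact: Kh_diff_homogeneous w_arc w_rot p.
Qed.
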